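(* Let $\Gamma\subset\mathbb{C}$ be a lattice and let $\Gamma'$ be a subgroup of index $2$ in $\Gamma$. Then the following statements hold. (i) Let $\omega\in\Gamma'\setminus 2\Gamma$ and let $e_1,e_2,e_3$ be the (distinct) roots of the polynomial $4x^3-g_2(\Gamma)x-g_3(\Gamma)$, numbered so that $e_1=\wp(\omega/2;\Gamma)$. Then $\Gamma'$ is optimal if and only if $|e_2-e_3|\le\min\{|e_1-e_2|,|e_1-e_3|\}$. (ii) $\Gamma'$ is optimal if and only if there is $\omega\in\Gamma$ such that $\omega\in\Gamma'$ and $|\omega|=\inf\{|w|:w\in\Gamma\setminus\{0\}\}$.
   Context: A lattice is a discrete additive subgroup of $\mathbb{C}$ of rank $2$. For a discrete subgroup $\Gamma\subset\mathbb{C}$, $\wp(z;\Gamma)=\frac1{z^2}+\sum_{u\in\Gamma\setminus\{0\}}\left(\frac1{(z-u)^2}-\frac1{u^2}\right)$, $g_2(\Gamma)=\sum_{u\in\Gamma\setminus\{0\}}60u^{-4}$, $g_3(\Gamma)=\sum_{u\in\Gamma\setminus\{0\}}140u^{-6}$, and $\Delta(\Gamma)=g_2(\Gamma)^3-27g_3(\Gamma)^2$. A subgroup $\Gamma'$ of index $2$ in a lattice $\Gamma$ is called optimal if $|\Delta(\Gamma')|\le|\Delta(G)|$ for all subgroups $G\subset\Gamma$ of index $2$. *)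

(* Defs.v *)
From Stdlib Require Import Reals ZArith.
From Coquelicot Require Import Coquelicot.
From Stdlib Require Import List.
Open Scope C_scope.

(** Subsets of the complex plane are predicates [C -> Prop]. *)

Definition Csum (l : list C) : C := fold_right Cplus 0 l.

Definition is_subgroup (G : C -> Prop) : Prop :=
  G 0 /\ (forall x y, G x -> G y -> G (x - y)).

Definition subset (A B : C -> Prop) : Prop := forall x, A x -> B x.

(** The subspace topology on [G] is discrete. *)
Definition is_discrete (G : C -> Prop) : Prop :=
  forall x, G x -> locally x (fun y => G y -> y = x).

Definition Z_comb (ms : list Z) (ws : list C) : C :=
  Csum (map (fun p => RtoC (IZR (fst p)) * snd p) (combine ms ws)).

Definition Z_independent (ws : list C) : Prop :=
  forall ms : list Z,
    length ms = length ws -> Z_comb ms ws = 0 -> Forall (fun m => m = 0%Z) ms.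

(** Rank of an abelian group: the maximal number of [Z]-linearly independent
    elements. *)
Definition has_rank (n : nat) (G : C -> Prop) : Prop :=
  (exists ws, length ws = n /\ Forall G ws /\ Z_independent ws) /\
  (forall ws, Forall G ws -> Z_independent ws -> (length ws <= n)%nat).

Definition is_lattice (G : C -> Prop) : Prop :=
  is_subgroup G /\ is_discrete G /\ has_rank 2 G.

(** [H] is a subgroup of [G] of index [n]; [ts] is a complete system of
    representatives, without repetition, of the cosets of [H] in [G]. *)
Definition is_subgroup_of_index (n : nat) (G H : C -> Prop) : Prop :=
  is_subgroup H /\ subset H G /\
  exists ts : list C,
    length ts = n /\ NoDup ts /\ Forall G ts /\
    (forall x, G x -> exists! t, In t ts /\ H (x - t)).

(** The filter of the finite subsets of [A], directed by inclusion; a finite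
    set is represented by a list without repetition. *)
Definition finite_subsets (A : C -> Prop) (P : list C -> Prop) : Prop :=
  exists l0, Forall A l0 /\
    (forall l, NoDup l -> Forall A l -> incl l0 l -> P l).

(** Unconditional (unordered) summation of [f] over [A]. As with [RInt],
    [usum A f] is a junk value when the family is not summable. *)
Definition is_usum (A : C -> Prop) (f : C -> C) (s : C) : Prop :=
  filterlim (fun l => Csum (map f l)) (finite_subsets A) (locally s).

Definition usum (A : C -> Prop) (f : C -> C) : C :=
  @iota C_CompleteNormedModule (is_usum A f).

Definition nonzero (G : C -> Prop) (u : C) : Prop := G u /\ u <> 0.

Definition wp (z : C) (G : C -> Prop) : C :=
  / z ^ 2 + usum (nonzero G) (fun u => / (z - u) ^ 2 - / u ^ 2).

Definition g2 (G : C -> Prop) : C := usum (nonzero G) (fun u => 60 * / u ^ 4).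

Definition g3 (G : C -> Prop) : C := usum (nonzero G) (fun u => 140 * / u ^ 6).

Definition Delta (G : C -> Prop) : C := g2 G ^ 3 - 27 * g3 G ^ 2.

(** Optimality of a subgroup [G'] of index 2 in the lattice [G]. *)
Definition is_optimal (G G' : C -> Prop) : Prop :=
  is_subgroup_of_index 2 G G' /\
  forall H, is_subgroup_of_index 2 G H ->
    (Cmod (Delta G') <= Cmod (Delta H))%R.

(* Main.v *)
(** Write [e1], [e2], [e3] for the values of the Weierstrass function [P] at the half
    periods [a / 2], [b / 2], [(a + b) / 2] of [Gamma = Z a + Z b]. The subgroup of
    index 2 containing [a] is twice the lattice [Gamma] together with [a / 2 + Gamma],
    so its invariants are given by [P ''] and [P ''''] at [a / 2], and the differential
    equation of [P] yields [16 Delta = (e2 - e3) ^ 4 (e1 - e2) (e1 - e3)]. Its modulus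
    is [|e2 - e3| ^ 3] times a factor common to the three subgroups, which is (i).

    For (ii) one shows that [|e2 - e3| <= |e1 - e3|] when [a] is a shortest vector,
    and that equality forces a shortest vector in [b + 2 Gamma]. In the equality case a
    rotation makes [e1] and [e2] complex conjugate, hence [g2], [g3] and, by the
    recursion coming from the differential equation, all sums of [u ^ - 2 k] real. As
    [k] grows the shortest vectors dominate these sums, so their set is invariant under
    complex conjugation, and the power series of [P] at half of a shortest vector
    shows that conjugation carries the class of [a] to the class of [b]. For the
    inequality, [b] is moved to [b + t i a] with [t > 0]: equality is then impossible,
    [e2 - e3] tends to 0 and [e1] does not, and one concludes by continuity.

    The differential equation is obtained without Liouville's theorem, from the
    absolutely convergent double series for [P * P '] and partial fractions. *)

From Stdlib Require Import Reals Lra Lia List Permutation Classical ClassicalEpsilon ZArith.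
From Coquelicot Require Import Coquelicot.
Require Import Defs.
Open Scope C_scope.

(** * Unconditional sums *)

(** For [b / a] in the upper half plane the quotient of [e2 - e3] by [e1 - e3] is lambda / (lambda -
    1), with lambda the modular function of level 2, so (ii) amounts to a mapping property of
    lambda. It is obtained without coverings or modular forms: equality is a rigid situation, and
    one path towards the cusp decides the sign when there is no equality. Equality may hold at the
    start of the path; this is why it is excluded for [t > 0] only, and why the resulting inequality
    is not strict.

    Only even exponents occur in the power sums, so these determine the squares of the shortest
    vectors. This suffices, because [v] and [- v] lie in the same class modulo [2 Gamma].

    A vanishing derivative is integrated only along real segments that avoid the lattice. The
    constants of integration are therefore read off on a ray starting at the origin, and the
    differential equations are available at those points which are joined to the origin by such a
    ray. Half of a basis vector is such a point. *)

Definition csum {T : Type} (f : T -> C) (l : list T) : C := Csum (map f l).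

Fixpoint rsum {T : Type} (g : T -> R) (l : list T) : R :=
  match l with nil => 0%R | x :: l' => (g x + rsum g l')%R end.

Definition eq_em {T : Type} (x y : T) : {x = y} + {x <> y} :=
  excluded_middle_informative (x = y).

Definition has_sum {T : Type} (f : T -> C) (s : C) : Prop :=
  forall eps : R, (0 < eps)%R ->
    exists l0, forall l, NoDup l -> incl l0 l -> (Cmod (csum f l - s) < eps)%R.

Definition bounded_sums {T : Type} (g : T -> R) (M : R) : Prop :=
  forall l, NoDup l -> (rsum g l <= M)%R.

Definition summable {T : Type} (g : T -> R) : Prop :=
  (forall x, 0 <= g x)%R /\ exists M, bounded_sums g M.

Definition tsum {T : Type} (f : T -> C) : C := epsilon (inhabits (RtoC 0)) (has_sum f).

Lemma Csum_app (l1 l2 : list C) : Csum (l1 ++ l2) = Csum l1 + Csum l2.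
Proof. induction l1; simpl; [ring|rewrite IHl1; ring]. Qed.

Lemma csum_app {T : Type} (f : T -> C) l1 l2 :
  csum f (l1 ++ l2) = csum f l1 + csum f l2.
Proof. unfold csum. rewrite map_app. apply Csum_app. Qed.

Lemma rsum_app {T : Type} (g : T -> R) l1 l2 :
  rsum g (l1 ++ l2) = (rsum g l1 + rsum g l2)%R.
Proof. induction l1; simpl; [ring|rewrite IHl1; ring]. Qed.

Lemma csum_plus {T : Type} (f g : T -> C) l :
  csum (fun x => f x + g x) l = csum f l + csum g l.
Proof. unfold csum; induction l; simpl; [ring|rewrite IHl; ring]. Qed.

Lemma csum_scal {T : Type} (c : C) (f : T -> C) l :
  csum (fun x => c * f x) l = c * csum f l.
Proof. unfold csum; induction l; simpl; [ring|rewrite IHl; ring]. Qed.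

Lemma csum_ext_in {T : Type} (f g : T -> C) l :
  (forall x, In x l -> f x = g x) -> csum f l = csum g l.
Proof. intros H. unfold csum. rewrite (map_ext_in f g l H); auto. Qed.

Lemma csum_zero {T : Type} (f : T -> C) l :
  (forall x, In x l -> f x = 0) -> csum f l = 0.
Proof.
  unfold csum; induction l; simpl; intros H; [easy|].
  rewrite IHl, H by auto. ring.
Qed.

Lemma rsum_le {T : Type} (f g : T -> R) l :
  (forall x, In x l -> (f x <= g x)%R) -> (rsum f l <= rsum g l)%R.
Proof.
  induction l; simpl; intros H; [lra|].
  assert (f a <= g a)%R by auto. assert (rsum f l <= rsum g l)%R by auto. lra.
Qed.

Lemma rsum_scal {T : Type} c (g : T -> R) l :
  rsum (fun x => c * g x)%R l = (c * rsum g l)%R.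
Proof. induction l; simpl; [ring|rewrite IHl; ring]. Qed.

Lemma rsum_plus {T : Type} (f g : T -> R) l :
  rsum (fun x => f x + g x)%R l = (rsum f l + rsum g l)%R.
Proof. induction l; simpl; [ring|rewrite IHl; ring]. Qed.

Lemma rsum_nonneg {T : Type} (g : T -> R) l :
  (forall x, 0 <= g x)%R -> (0 <= rsum g l)%R.
Proof. intros H; induction l; simpl; [lra|specialize (H a); lra]. Qed.

Lemma rsum_map {A T : Type} (h : A -> T) (g : T -> R) l :
  rsum g (map h l) = rsum (fun a => g (h a)) l.
Proof. induction l; simpl; congruence. Qed.

Lemma csum_map {A T : Type} (h : A -> T) (g : T -> C) l :
  csum g (map h l) = csum (fun a => g (h a)) l.
Proof. unfold csum; rewrite map_map; auto. Qed.

Lemma Cmod_csum_le {T : Type} (f : T -> C) (g : T -> R) l :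
  (forall x, Cmod (f x) <= g x)%R -> (Cmod (csum f l) <= rsum g l)%R.
Proof.
  intros H; unfold csum; induction l; simpl.
  - rewrite Cmod_0; lra.
  - eapply Rle_trans; [apply Cmod_triangle|]. specialize (H a). lra.
Qed.

Lemma csum_split {T : Type} (f : T -> C) (P : T -> bool) l :
  csum f l = csum f (filter P l) + csum f (filter (fun x => negb (P x)) l).
Proof.
  unfold csum; induction l; simpl; [ring|].
  destruct (P a); simpl; rewrite IHl; ring.
Qed.

Lemma rsum_split {T : Type} (f : T -> R) (P : T -> bool) l :
  rsum f l = (rsum f (filter P l) + rsum f (filter (fun x => negb (P x)) l))%R.
Proof.
  induction l; simpl; [ring|].
  destruct (P a); simpl; rewrite IHl; ring.
Qed.

Lemma Csum_perm l l' : Permutation l l' -> Csum l = Csum l'.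
Proof.
  induction 1; simpl; auto; try ring.
  - rewrite IHPermutation; ring.
  - congruence.
Qed.

Lemma csum_same {T : Type} (f : T -> C) l l' :
  NoDup l -> NoDup l' -> (forall x, In x l <-> In x l') -> csum f l = csum f l'.
Proof.
  intros. apply Csum_perm, Permutation_map,
    NoDup_Permutation; auto.
Qed.

Lemma rsum_perm {T : Type} (f : T -> R) l l' :
  Permutation l l' -> rsum f l = rsum f l'.
Proof.
  induction 1; simpl; auto; try ring.
  - rewrite IHPermutation; ring.
  - congruence.
Qed.

Definition mem {T : Type} (l : list T) (x : T) : bool :=
  if in_dec eq_em x l then true else false.

Lemma mem_true {T : Type} (l : list T) x : mem l x = true <-> In x l.
Proof. unfold mem; destruct (in_dec eq_em x l); split; easy. Qed.

Definition lunion {T : Type} (l1 l2 : list T) : list T :=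
  l1 ++ filter (fun x => negb (mem l1 x)) l2.

Lemma lunion_NoDup {T : Type} (l1 l2 : list T) :
  NoDup l1 -> NoDup l2 -> NoDup (lunion l1 l2).
Proof.
  intros H1 H2. apply NoDup_app; auto.
  - apply NoDup_filter; auto.
  - intros x Hx Hx2. apply filter_In in Hx2 as [_ Hx2].
    apply mem_true in Hx. rewrite Hx in Hx2. discriminate.
Qed.

Lemma lunion_In {T : Type} (l1 l2 : list T) x :
  In x (lunion l1 l2) <-> In x l1 \/ In x l2.
Proof.
  unfold lunion. rewrite in_app_iff, filter_In.
  destruct (mem l1 x) eqn:E; simpl.
  - apply mem_true in E. tauto.
  - tauto.
Qed.

Lemma nodup_em {T : Type} (l : list T) :
  exists l', NoDup l' /\ forall x, In x l' <-> In x l.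
Proof.
  exists (nodup eq_em l). split; [apply NoDup_nodup|intros; apply nodup_In].
Qed.

Lemma has_sum_unique {T : Type} (f : T -> C) s s' :
  has_sum f s -> has_sum f s' -> s = s'.
Proof.
  intros H H'.
  apply NNPP; intros E.
  assert (P : (0 < Cmod (s - s'))%R).
  { apply Cmod_gt_0. intros E'. apply E.
    replace s with (s - s' + s') by ring. rewrite E'; ring. }
  destruct (H (Cmod (s - s') / 2)%R ltac:(lra)) as [l0 H0].
  destruct (H' (Cmod (s - s') / 2)%R ltac:(lra)) as [l1 H1].
  destruct (nodup_em (l0 ++ l1)) as [l [Hl Il]].
  specialize (H0 l Hl ltac:(intros x Hx; apply Il, in_or_app; auto)).
  specialize (H1 l Hl ltac:(intros x Hx; apply Il, in_or_app; auto)).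
  assert (Cmod (s - s') <= Cmod (csum f l - s') + Cmod (csum f l - s))%R.
  { replace (s - s') with ((csum f l - s') + - (csum f l - s)) by ring.
    eapply Rle_trans; [apply Cmod_triangle|]. rewrite Cmod_opp. lra. }
  lra.
Qed.

Lemma tsum_has_sum {T : Type} (f : T -> C) s : has_sum f s -> tsum f = s.
Proof.
  intros H. apply has_sum_unique with f; auto.
  unfold tsum. apply epsilon_spec. exists s; auto.
Qed.

Lemma has_sum_ext {T : Type} (f g : T -> C) s :
  (forall x, f x = g x) -> has_sum f s -> has_sum g s.
Proof.
  intros E H eps He. destruct (H eps He) as [l0 H0]. exists l0. intros l Hl Il.
  rewrite <- (csum_ext_in f g); auto.
Qed.

Lemma has_sum_plus {T : Type} (f g : T -> C) s t :
  has_sum f s -> has_sum g t -> has_sum (fun x => f x + g x) (s + t).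
Proof.
  intros Hf Hg eps He.
  destruct (Hf (eps / 2)%R ltac:(lra)) as [l0 H0].
  destruct (Hg (eps / 2)%R ltac:(lra)) as [l1 H1].
  exists (l0 ++ l1). intros l Hl Il. rewrite csum_plus.
  specialize (H0 l Hl ltac:(intros x Hx; apply Il, in_or_app; auto)).
  specialize (H1 l Hl ltac:(intros x Hx; apply Il, in_or_app; auto)).
  replace (csum f l + csum g l - (s + t)) with ((csum f l - s) + (csum g l - t))
    by ring.
  eapply Rle_lt_trans; [apply Cmod_triangle|]. lra.
Qed.

Lemma has_sum_scal {T : Type} (c : C) (f : T -> C) s :
  has_sum f s -> has_sum (fun x => c * f x) (c * s).
Proof.
  intros Hf eps He. pose proof (Cmod_ge_0 c) as Hc.
  destruct (Hf (eps / (Cmod c + 1))%R) as [l0 H0].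
  { apply Rdiv_lt_0_compat; lra. }
  exists l0. intros l Hl Il. rewrite csum_scal.
  specialize (H0 l Hl Il).
  replace (c * csum f l - c * s) with (c * (csum f l - s)) by ring.
  rewrite Cmod_mult. apply Rlt_div_r in H0; [|lra].
  pose proof (Cmod_ge_0 (csum f l - s)). nra.
Qed.

Lemma has_sum_opp {T : Type} (f : T -> C) s :
  has_sum f s -> has_sum (fun x => - f x) (- s).
Proof.
  intros H. replace (- s) with (- (1) * s) by ring.
  eapply has_sum_ext; [|apply has_sum_scal, H]. intros; simpl; ring.
Qed.

Lemma has_sum_minus {T : Type} (f g : T -> C) s t :
  has_sum f s -> has_sum g t -> has_sum (fun x => f x - g x) (s - t).
Proof. intros Hf Hg. apply has_sum_plus; auto. apply has_sum_opp; auto. Qed.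

Lemma has_sum_zero {T : Type} : has_sum (fun _ : T => RtoC 0) 0.
Proof.
  intros eps He. exists nil. intros l _ _. rewrite csum_zero by auto.
  replace (RtoC 0 - 0) with (RtoC 0) by ring. rewrite Cmod_0; auto.
Qed.

Lemma has_sum_single {T : Type} (x0 : T) (f : T -> C) :
  (forall x, x <> x0 -> f x = 0) -> has_sum f (f x0).
Proof.
  intros H eps He. exists (x0 :: nil). intros l Hl Il.
  assert (In x0 l) as Hx by (apply Il; left; auto).
  apply in_split in Hx as [l1 [l2 ->]].
  apply NoDup_remove_2 in Hl.
  rewrite csum_app. unfold csum at 2; simpl. fold (csum f l2).
  rewrite !csum_zero.
  - replace (0 + (f x0 + 0) - f x0) with (RtoC 0) by ring. rewrite Cmod_0; auto.
  - intros x Hx. apply H. intros ->. apply Hl, in_or_app; auto.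
  - intros x Hx. apply H. intros ->. apply Hl, in_or_app; auto.
Qed.

(** Indices outside the image of [h] contribute 0, so a finite list may be traded for its part in
    the image, and a list of preimages may be enlarged by such indices, without changing the sum. *)
Lemma has_sum_reindex {A T : Type} (h : A -> T) (f : T -> C) s :
  (forall a b, h a = h b -> a = b) ->
  (forall x, f x <> 0 -> exists a, h a = x) ->
  has_sum f s <-> has_sum (fun a => f (h a)) s.
Proof.
  intros Hi Hs.
  set (P := fun x => if excluded_middle_informative (exists a, h a = x)
                     then true else false).
  assert (HP : forall x, P x = true <-> exists a, h a = x).
  { intros x; unfold P; destruct excluded_middle_informative; split; easy. }
  assert (pull : forall l, (forall x, In x l -> P x = true) ->
            exists k, map h k = l).
  { induction l; intros H; [exists nil; auto|].
    destruct IHl as [k <-]; [intros; apply H; right; auto|].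
    destruct (proj1 (HP a)) as [b <-]; [apply H; left; auto|].
    exists (b :: k); auto. }
  split; intros H eps He; destruct (H eps He) as [l0 H0].
  - destruct (pull (filter P l0)) as [k0 Hk0].
    { intros x Hx; apply filter_In in Hx; tauto. }
    exists k0. intros k Hk Ik. rewrite <- csum_map.
    set (n0 := nodup eq_em l0).
    set (l := lunion (map h k) (filter (fun x => negb (P x)) n0)).
    assert (Hl : NoDup l).
    { apply lunion_NoDup.
      - apply FinFun.Injective_map_NoDup; auto.
      - apply NoDup_filter, NoDup_nodup. }
    replace (csum f (map h k)) with (csum f l).
    + apply H0; auto. intros x Hx. apply lunion_In.
      destruct (P x) eqn:E.
      * left. assert (In x (map h k0)) as Hm by (rewrite Hk0; apply filter_In; auto).
        apply in_map_iff in Hm as [a [<- Ha]]. apply in_map; auto.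
      * right. apply filter_In; split; [apply nodup_In; auto|rewrite E; auto].
    + unfold l, lunion. rewrite csum_app, (csum_zero _ (filter _ (filter _ _))).
      * ring.
      * intros x Hx. apply filter_In in Hx as [Hx _].
        apply filter_In in Hx as [_ Hx]. apply NNPP; intros Hn.
        apply Hs, HP in Hn. rewrite Hn in Hx; discriminate.
  - exists (map h l0). intros l Hl Il.
    destruct (pull (filter P l)) as [k Hk].
    { intros x Hx; apply filter_In in Hx; tauto. }
    rewrite (csum_split f P), (csum_zero f (filter (fun x => negb (P x)) l)).
    + rewrite <- Hk, csum_map, Cplus_0_r. apply H0.
      * apply (NoDup_map_inv h). rewrite Hk. apply NoDup_filter; auto.
      * intros a Ha. assert (In (h a) (map h k)) as Hm.
        { rewrite Hk. apply filter_In; split; [apply Il, in_map; auto|].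
          apply HP; eauto. }
        apply in_map_iff in Hm as [b [E Hb]]. apply Hi in E; subst; auto.
    + intros x Hx. apply filter_In in Hx as [_ Hx]. apply NNPP; intros Hn.
      apply Hs, HP in Hn. rewrite Hn in Hx; discriminate.
Qed.

Lemma rsum_incl {T : Type} (g : T -> R) l l' :
  (forall x, 0 <= g x)%R -> NoDup l -> NoDup l' -> incl l l' ->
  (rsum g l <= rsum g l')%R.
Proof.
  intros Hg Hl Hl' I.
  rewrite (rsum_split g (mem l) l').
  assert (Permutation l (filter (mem l) l')) as P.
  { apply NoDup_Permutation; auto; [apply NoDup_filter; auto|].
    intros x. rewrite filter_In, mem_true. split; auto. tauto. }
  rewrite <- (rsum_perm g _ _ P).
  pose proof (rsum_nonneg g (filter (fun x => negb (mem l x)) l') Hg). lra.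
Qed.

Lemma summable_tail {T : Type} (g : T -> R) (eps : R) :
  summable g -> (0 < eps)%R ->
  exists l0, NoDup l0 /\ forall l, NoDup l -> (forall x, In x l -> ~ In x l0) ->
    (rsum g l < eps)%R.
Proof.
  intros [Hg [M HM]] He.
  set (E := fun r => exists l, NoDup l /\ r = rsum g l).
  destruct (completeness E) as [s [Hu Hs]].
  { exists M. intros r [l [Hl ->]]; auto. }
  { exists 0%R. exists nil; split; [constructor|auto]. }
  apply NNPP; intros Hn.
  assert (B : (s <= s - eps)%R); [|lra].
  apply Hs. intros r [l0 [Hl0 ->]].
  apply Rnot_lt_le; intros Hr. apply Hn. exists l0. split; auto. intros l Hl Hd.
  assert (rsum g (l0 ++ l) <= s)%R as H1.
  { apply Hu. exists (l0 ++ l). split; auto. apply NoDup_app; auto.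
    intros x H1 H2; apply (Hd x); auto. }
  rewrite rsum_app in H1. lra.
Qed.

Lemma summable_le {T : Type} (f g : T -> R) :
  (forall x, 0 <= f x <= g x)%R -> summable g -> summable f.
Proof.
  intros H [_ [M HM]]. split; [intros; apply H|]. exists M. intros l Hl.
  eapply Rle_trans; [|apply (HM l Hl)]. apply rsum_le. intros; apply H.
Qed.

Lemma summable_scal {T : Type} c (g : T -> R) :
  (0 <= c)%R -> summable g -> summable (fun x => c * g x)%R.
Proof.
  intros Hc [Hg [M HM]]. split; [intros; apply Rmult_le_pos; auto|].
  exists (c * M)%R. intros l Hl. rewrite rsum_scal.
  apply Rmult_le_compat_l; auto.
Qed.

Lemma summable_plus {T : Type} (f g : T -> R) :
  summable f -> summable g -> summable (fun x => f x + g x)%R.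
Proof.
  intros [Hf [M HM]] [Hg [N HN]].
  split; [intros x; specialize (Hf x); specialize (Hg x); lra|].
  exists (M + N)%R. intros l Hl. rewrite rsum_plus.
  specialize (HM l Hl); specialize (HN l Hl); lra.
Qed.

Lemma summable_inj {A T : Type} (h : A -> T) (g : T -> R) :
  (forall a b, h a = h b -> a = b) -> summable g -> summable (fun a => g (h a)).
Proof.
  intros Hi [Hg [M HM]]. split; auto. exists M. intros l Hl.
  rewrite <- rsum_map. apply HM. apply FinFun.Injective_map_NoDup; auto.
Qed.

Lemma has_sum_nonneg_exists {T : Type} (g : T -> R) :
  summable g -> exists s : R, has_sum (fun x => RtoC (g x)) s.
Proof.
  intros [Hg [M HM]].
  set (E := fun r => exists l, NoDup l /\ r = rsum g l).
  destruct (completeness E) as [s [Hu Hs]].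
  { exists M. intros r [l [Hl ->]]; auto. }
  { exists 0%R. exists nil; split; [constructor|auto]. }
  exists s. intros eps He.
  assert (exists l0, NoDup l0 /\ (s - eps < rsum g l0)%R) as [l0 [Hl0 H0]].
  { apply NNPP; intros Hn. assert (B : (s <= s - eps)%R); [|lra].
    apply Hs. intros r [l [Hl ->]]. apply Rnot_lt_le; intros Hr.
    apply Hn; exists l; auto. }
  exists l0. intros l Hl Il.
  replace (csum (fun x => RtoC (g x)) l) with (RtoC (rsum g l)).
  - rewrite <- RtoC_minus, Cmod_R.
    assert (rsum g l <= s)%R by (apply Hu; exists l; auto).
    pose proof (rsum_incl g l0 l Hg Hl0 Hl Il).
    rewrite Rabs_left1 by lra. lra.
  - clear. unfold csum. induction l; simpl; auto. rewrite RtoC_plus, IHl; auto.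
Qed.

Definition abs_summable {T : Type} (f : T -> C) : Prop :=
  summable (fun x => Cmod (f x)).

Lemma abs_summable_le {T : Type} (f : T -> C) (g : T -> R) :
  (forall x, Cmod (f x) <= g x)%R -> summable g -> abs_summable f.
Proof.
  intros H. apply summable_le. intros x; split; [apply Cmod_ge_0|auto].
Qed.

Lemma im_le_Cmod (c : C) : (Rabs (Im c) <= Cmod c)%R.
Proof. eapply Rle_trans; [|apply Rmax_Cmod]. apply Rmax_r. Qed.

Lemma has_sum_real_exists {T : Type} (g : T -> R) :
  summable (fun x => Rabs (g x)) -> exists s : R, has_sum (fun x => RtoC (g x)) s.
Proof.
  intros H.
  destruct (has_sum_nonneg_exists (fun x => (Rabs (g x) + g x) / 2)%R) as [s Hs].
  { apply summable_le with (2 := H). intros x.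
    unfold Rabs; destruct Rcase_abs; lra. }
  destruct (has_sum_nonneg_exists (fun x => (Rabs (g x) - g x) / 2)%R) as [t Ht].
  { apply summable_le with (2 := H). intros x.
    unfold Rabs; destruct Rcase_abs; lra. }
  exists (s - t)%R. rewrite RtoC_minus.
  eapply has_sum_ext; [|apply has_sum_minus; [apply Hs|apply Ht]].
  intros x; simpl. rewrite <- RtoC_minus. f_equal. field.
Qed.

Lemma abs_summable_has_sum {T : Type} (f : T -> C) :
  abs_summable f -> has_sum f (tsum f).
Proof.
  intros H. unfold tsum. apply epsilon_spec.
  destruct (has_sum_real_exists (fun x => Re (f x))) as [s Hs].
  { apply summable_le with (2 := H). intros x; split; [apply Rabs_pos|].
    apply re_le_Cmod. }
  destruct (has_sum_real_exists (fun x => Im (f x))) as [t Ht].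
  { apply summable_le with (2 := H). intros x; split; [apply Rabs_pos|].
    apply im_le_Cmod. }
  exists (s + Ci * t).
  eapply has_sum_ext; [|apply has_sum_plus; [apply Hs|apply has_sum_scal, Ht]].
  intros x; simpl. destruct (f x) as [a b]; unfold Ci, RtoC, Cplus, Cmult; simpl.
  f_equal; ring.
Qed.

Lemma has_sum_bound {T : Type} (f : T -> C) (g : T -> R) s M :
  has_sum f s -> (forall x, Cmod (f x) <= g x)%R -> bounded_sums g M ->
  (Cmod s <= M)%R.
Proof.
  intros Hf Hg HM. apply Rnot_lt_le; intros Hn.
  destruct (Hf (Cmod s - M)%R ltac:(lra)) as [l0 H0].
  destruct (nodup_em l0) as [l [Hl Il]].
  specialize (H0 l Hl ltac:(intros x Hx; apply Il; auto)).
  pose proof (Cmod_csum_le f g l Hg) as H1. specialize (HM l Hl).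
  assert (Cmod s <= Cmod (csum f l) + Cmod (csum f l - s))%R; [|lra].
  replace s with (csum f l + - (csum f l - s)) at 1 by ring.
  eapply Rle_trans; [apply Cmod_triangle|]. rewrite Cmod_opp. lra.
Qed.

(** The half of Fubini that is needed: a rectangle [I * J] with [J] large enough contains the finite
    set that controls the sum over pairs, and each of the finitely many rows over [I] is close to
    its own sum. *)
Lemma has_sum_section {A B : Type} (F : A * B -> C) (r : A -> C) s :
  has_sum F s -> (forall a, has_sum (fun b => F (a, b)) (r a)) -> has_sum r s.
Proof.
  intros HF Hr eps He.
  destruct (HF (eps / 2)%R ltac:(lra)) as [l0 H0].
  exists (map fst l0). intros I HI II.
  (* Each row may err by [d], together at most [eps / 2]; the [+ 1] covers an empty [I]. *)
  set (d := (eps / 2 / (INR (length I) + 1))%R).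
  pose proof (pos_INR (length I)) as Hn.
  assert (Hd : (0 < d)%R) by (unfold d; apply Rdiv_lt_0_compat; lra).
  assert (Hd2 : (INR (length I) * d <= eps / 2)%R).
  { unfold d. apply Rmult_le_reg_r with (INR (length I) + 1)%R; [lra|].
    field_simplify; [|lra]. nra. }
  clearbody d.
  assert (HJ : exists J, NoDup J /\ (forall p, In p l0 -> In (snd p) J) /\
     forall a, In a I -> (Cmod (csum (fun b => F (a, b)) J - r a) < d)%R).
  { assert (HJ0 : exists J0, forall a, In a I -> forall J, NoDup J -> incl J0 J ->
       (Cmod (csum (fun b => F (a, b)) J - r a) < d)%R).
    { clear - Hr Hd. induction I as [|a I [J0 IH]].
      - exists nil. intros ? [].
      - destruct (Hr a d Hd) as [J1 H1]. exists (J0 ++ J1).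
        intros a' [<-|Ha] J HJ IJ.
        + apply H1; auto. intros x Hx; apply IJ, in_or_app; auto.
        + apply IH; auto. intros x Hx; apply IJ, in_or_app; auto. }
    destruct HJ0 as [J0 HJ0].
    destruct (nodup_em (map snd l0 ++ J0)) as [J [HJ IJ]].
    exists J. repeat split; auto.
    - intros p Hp. apply IJ, in_or_app. left. apply in_map; auto.
    - intros a Ha. apply HJ0; auto. intros x Hx; apply IJ, in_or_app; auto. }
  destruct HJ as [J [HJ [HJ0 HJ1]]].
  specialize (H0 (list_prod I J)).
  assert (E : csum F (list_prod I J) = csum (fun a => csum (fun b => F (a, b)) J) I).
  { clear. unfold csum at 2. induction I; simpl; auto.
    rewrite csum_app, csum_map, IHI. auto. }
  rewrite E in H0.
  assert (Bd : (Cmod (csum r I - csum (fun a => csum (fun b => F (a, b)) J) I)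
             <= INR (length I) * d)%R).
  { clear - HJ1. induction I as [|a I IH].
    - unfold csum; simpl. replace (RtoC 0 - 0) with (RtoC 0) by ring.
      rewrite Cmod_0; lra.
    - unfold csum in *. simpl map. simpl Csum. simpl length. rewrite S_INR.
      match goal with |- (Cmod (?x + ?y - (?u + ?v)) <= _)%R =>
        replace (x + y - (u + v)) with (- (u - x) + (y - v)) by ring end.
      eapply Rle_trans; [apply Cmod_triangle|]. rewrite Cmod_opp.
      specialize (IH (fun a' H => HJ1 a' (or_intror H))).
      specialize (HJ1 a (or_introl eq_refl)). lra. }
  replace (csum r I - s) with
    ((csum r I - csum (fun a => csum (fun b => F (a, b)) J) I) +
     (csum (fun a => csum (fun b => F (a, b)) J) I - s)) by ring.
  eapply Rle_lt_trans; [apply Cmod_triangle|].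
  assert (Cmod (csum (fun a => csum (fun b => F (a, b)) J) I - s) < eps / 2)%R.
  { apply H0.
    - clear - HI HJ. induction HI; simpl; [constructor|].
      apply NoDup_app; auto.
      + apply FinFun.Injective_map_NoDup; auto. intros u v E; congruence.
      + intros [u v] H1 H2. apply in_map_iff in H1 as [w [E _]].
        apply in_prod_iff in H2 as [H2 _]. congruence.
    - intros [a b] Hp. apply in_prod.
      + apply II. change a with (fst (a, b)). apply in_map; auto.
      + apply (HJ0 (a, b)); auto. }
  lra.
Qed.

Lemma summable_section {A B : Type} (g : A * B -> R) (a : A) :
  summable g -> summable (fun b => g (a, b)).
Proof. intros H. apply (summable_inj (fun b => (a, b))); auto. congruence. Qed.

Lemma summable_prod {A B : Type} (f : A -> R) (g : B -> R) :
  summable f -> summable g -> summable (fun p : A * B => f (fst p) * g (snd p))%R.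
Proof.
  intros [Hf [M HM]] [Hg [N HN]].
  assert (Hp : forall p : A * B, (0 <= f (fst p) * g (snd p))%R).
  { intros; apply Rmult_le_pos; auto. }
  split; auto.
  exists (M * N)%R. intros l Hl.
  set (I := nodup eq_em (map fst l)). set (J := nodup eq_em (map snd l)).
  assert (HI : NoDup I) by apply NoDup_nodup.
  assert (HJ : NoDup J) by apply NoDup_nodup.
  apply Rle_trans with (rsum (fun p : A * B => f (fst p) * g (snd p))%R (list_prod I J)).
  - apply rsum_incl; auto.
    + clear - HI HJ. induction HI; simpl; [constructor|].
      apply NoDup_app; auto.
      * apply FinFun.Injective_map_NoDup; auto. intros u v E; congruence.
      * intros [u v] H1 H2. apply in_map_iff in H1 as [w [E _]].
        apply in_prod_iff in H2 as [H2 _]. congruence.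
    + intros [a b] Hp'. apply in_prod; apply nodup_In.
      * change a with (fst (a, b)). apply in_map; auto.
      * change b with (snd (a, b)). apply in_map; auto.
  - replace (rsum _ (list_prod I J)) with (rsum f I * rsum g J)%R.
    + pose proof (rsum_nonneg f I Hf). pose proof (rsum_nonneg g J Hg).
      specialize (HM I HI). specialize (HN J HJ).
      apply Rmult_le_compat; auto.
    + clear. induction I; simpl; [ring|].
      rewrite rsum_app, rsum_map, <- IHI. simpl. rewrite rsum_scal. ring.
Qed.

Lemma filter_list_forall {U T : Type} (F : (U -> Prop) -> Prop) {FF : Filter F}
  (Q : T -> U -> Prop) (l : list T) :
  (forall x, In x l -> F (Q x)) -> F (fun u => forall x, In x l -> Q x u).
Proof.
  induction l; intros H.
  - apply filter_forall. intros u x [].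
  - eapply filter_imp; [|apply filter_and; [apply (H a); left; auto|
      apply IHl; intros; apply H; right; auto]].
    intros u [H1 H2] x [<-|Hx]; auto.
Qed.

(** Dominated convergence for series along an arbitrary filter. It serves for exponents tending to
    infinity, and for a moving lattice whose parameter tends to a point or to infinity. *)
Lemma dominated_sum {U T : Type} (F : (U -> Prop) -> Prop) {FF : Filter F}
  (f : U -> T -> C) (f0 : T -> C) (g : T -> R) (s : U -> C) (s0 : C) :
  summable g ->
  F (fun u => forall x, Cmod (f u x) <= g x)%R ->
  (forall x, Cmod (f0 x) <= g x)%R ->
  (forall x eps, (0 < eps)%R -> F (fun u => Cmod (f u x - f0 x) < eps)%R) ->
  (forall u, has_sum (f u) (s u)) -> has_sum f0 s0 ->
  forall eps, (0 < eps)%R -> F (fun u => Cmod (s u - s0) < eps)%R.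
Proof.
  intros Hg Hd Hd0 Hc Hs Hs0 eps He.
  (* Outside [l0], a family bounded by [g] has sum at most [eps / 4]: one [eps / 8] comes from the
     tail of [g], the other from stopping the family at a finite list. *)
  destruct (summable_tail g (eps / 8)%R Hg ltac:(lra)) as [l0 [Hl0 Ht]].
  set (n := (INR (length l0) + 1)%R).
  assert (Hn : (0 < n)%R) by (unfold n; pose proof (pos_INR (length l0)); lra).
  assert (Hn2 : (INR (length l0) * (eps / 4 / n) <= eps / 4)%R).
  { apply Rmult_le_reg_r with n; [lra|]. field_simplify; [|lra].
    unfold n. nra. }
  clearbody n.
  assert (tail : forall (h : T -> C) t, (forall x, Cmod (h x) <= g x)%R ->
     has_sum h t -> (Cmod (t - csum h l0) <= eps / 4)%R).
  { intros h t Hh Hst. apply Rnot_lt_le; intros Hlt.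
    destruct (Hst (eps / 8)%R ltac:(lra)) as [l1 H1].
    set (l := lunion l0 (nodup eq_em l1)).
    specialize (H1 l).
    assert (Cmod (csum h l - t) < eps / 8)%R as H2.
    { apply H1; [apply lunion_NoDup; auto; apply NoDup_nodup|].
      intros x Hx. apply lunion_In; right; apply nodup_In; auto. }
    unfold l, lunion in H2. rewrite csum_app in H2.
    set (k := filter (fun x => negb (mem l0 x)) (nodup eq_em l1)) in *.
    assert (rsum g k < eps / 8)%R as H3.
    { apply Ht; [apply NoDup_filter, NoDup_nodup|].
      intros x Hx Hx0. apply filter_In in Hx as [_ Hx]. apply mem_true in Hx0.
      rewrite Hx0 in Hx; discriminate. }
    pose proof (Cmod_csum_le h g k Hh) as H4.
    assert (Cmod (t - csum h l0) <= Cmod (csum h k) + Cmod (csum h l0 + csum h k - t))%R; [|lra].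
    replace (t - csum h l0) with (csum h k + - (csum h l0 + csum h k - t)) by ring.
    eapply Rle_trans; [apply Cmod_triangle|]. rewrite Cmod_opp. lra. }
  assert (H1 : F (fun u => forall x, In x l0 -> (Cmod (f u x - f0 x) < eps / 4 / n)%R)).
  { apply (filter_list_forall F (fun x u => (Cmod (f u x - f0 x) < eps / 4 / n)%R)).
    intros x _. apply Hc. apply Rdiv_lt_0_compat; lra. }
  eapply filter_imp; [|apply filter_and; [exact Hd|exact H1]].
  intros u [Hu1 Hu2].
  pose proof (tail _ _ Hu1 (Hs u)) as T1. pose proof (tail _ _ Hd0 Hs0) as T2.
  assert (B : (Cmod (csum (f u) l0 - csum f0 l0) <= INR (length l0) * (eps / 4 / n))%R).
  { clear - Hu2. induction l0 as [|a l IH]; unfold csum in *; simpl.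
    - replace (RtoC 0 - 0) with (RtoC 0) by ring. rewrite Cmod_0; lra.
    - match goal with |- (Cmod (?x + ?y - (?u + ?v)) <= ?r)%R =>
        replace (x + y - (u + v)) with ((x - u) + (y - v)) by ring;
        change r with (INR (S (length l)) * (eps / 4 / n))%R end.
      rewrite S_INR.
      eapply Rle_trans; [apply Cmod_triangle|].
      specialize (IH (fun a' H => Hu2 a' (or_intror H))).
      specialize (Hu2 a (or_introl eq_refl)).
      lra. }
  replace (s u - s0) with ((s u - csum (f u) l0) + (csum (f u) l0 - csum f0 l0)
     + - (s0 - csum f0 l0)) by ring.
  eapply Rle_lt_trans; [apply Cmod_triangle|]. rewrite Cmod_opp.
  eapply Rle_lt_trans; [apply Rplus_le_compat_r, Cmod_triangle|]. lra.
Qed.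

(** * Lattice sums *)

Lemma summable_image {A T : Type} (h : A -> T) (g : T -> R) :
  (forall x, 0 <= g x)%R -> (forall x, g x <> 0%R -> exists a, h a = x) ->
  summable (fun a => g (h a)) -> summable g.
Proof.
  intros Hg Hs [_ [M HM]]. split; auto. exists M. intros l Hl.
  set (P := fun x => if Req_EM_T (g x) 0 then false else true).
  rewrite (rsum_split g P).
  assert (pull : forall l, (forall x, In x l -> P x = true) ->
            exists k, map h k = l).
  { clear l Hl. induction l; intros H; [exists nil; auto|].
    destruct IHl as [k <-]; [intros; apply H; right; auto|].
    destruct (Hs a) as [b <-].
    - specialize (H a (or_introl eq_refl)). unfold P in H.
      destruct Req_EM_T; easy.
    - exists (b :: k); auto. }
  destruct (pull (filter P l)) as [k Hk].
  { intros x Hx; apply filter_In in Hx; tauto. }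
  rewrite <- Hk, rsum_map.
  assert (rsum g (filter (fun x => negb (P x)) l) <= 0)%R as H0.
  { clear. induction l; simpl; [lra|]. unfold P at 1.
    destruct Req_EM_T; simpl; lra. }
  assert (NoDup k) as Hk2.
  { apply (NoDup_map_inv h). rewrite Hk. apply NoDup_filter; auto. }
  specialize (HM k Hk2). lra.
Qed.

Lemma summable_nat (g : nat -> R) M :
  (forall n, 0 <= g n)%R -> (forall n, rsum g (seq 0 n) <= M)%R -> summable g.
Proof.
  intros Hg HM. split; auto. exists M. intros l Hl.
  apply Rle_trans with (2 := HM (S (list_max l))).
  apply rsum_incl; auto; [apply seq_NoDup|].
  intros x Hx. apply in_seq. split; [lia|].
  assert (H : (list_max l <= list_max l)%nat) by lia.
  apply list_max_le in H. rewrite Forall_forall in H. specialize (H x Hx). lia.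
Qed.

Lemma summable_Z_even (g : Z -> R) :
  (forall m, 0 <= g m)%R -> (forall m, g (- m)%Z = g m) ->
  summable (fun n => g (Z.of_nat n)) -> summable g.
Proof.
  intros Hg He Hn.
  set (g1 := fun m => if Z_lt_dec m 0 then 0%R else g m).
  set (g2 := fun m => if Z_lt_dec m 0 then g m else 0%R).
  apply summable_le with (fun m => g1 m + g2 m)%R.
  { intros m; split; auto. unfold g1, g2; destruct Z_lt_dec; lra. }
  assert (H0 : forall m, (0 <= g1 m /\ 0 <= g2 m)%R).
  { intros m; unfold g1, g2; specialize (Hg m); destruct Z_lt_dec; lra. }
  apply summable_plus.
  - apply (summable_image Z.of_nat).
    + intros; apply H0.
    + intros m Hm. exists (Z.to_nat m). unfold g1 in Hm.
      destruct Z_lt_dec; [easy|lia].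
    + apply summable_le with (2 := Hn). intros n; split; [apply H0|].
      unfold g1; destruct Z_lt_dec; [lia|lra].
  - apply (summable_image (fun n => (- Z.of_nat n)%Z)).
    + intros; apply H0.
    + intros m Hm. exists (Z.to_nat (- m)). unfold g2 in Hm.
      destruct Z_lt_dec; [lia|easy].
    + apply summable_le with (2 := Hn). intros n; split; [apply H0|].
      unfold g2; destruct Z_lt_dec; [rewrite He|]; auto; lra.
Qed.

(** * Summability over the integers with exponent 5 / 4 *)

Definition root4 (x : R) : R := sqrt (sqrt x).

Lemma root4_pos x : (0 < x)%R -> (0 < root4 x)%R.
Proof. intros; apply sqrt_lt_R0, sqrt_lt_R0; auto. Qed.

Lemma root4_pow x : (0 <= x)%R -> (root4 x ^ 4 = x)%R.
Proof.
  intros. unfold root4.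
  replace (sqrt (sqrt x) ^ 4)%R with
    ((sqrt (sqrt x) * sqrt (sqrt x)) * (sqrt (sqrt x) * sqrt (sqrt x)))%R by ring.
  rewrite sqrt_sqrt by apply sqrt_pos. apply sqrt_sqrt; auto.
Qed.

(** With [a] and [b] the fourth roots of [x] and [x + 1], [1 = b ^ 4 - a ^ 4 = (b - a) (b + a) (b ^
    2 + a ^ 2)] is at most [(b - a) * 4 b ^ 3]. This replaces the comparison with an integral. *)
Lemma inv_54_telescope (x : R) :
  (0 < x)%R ->
  (/ ((x + 1) * root4 (x + 1)) <= 4 * (/ root4 x - / root4 (x + 1)))%R.
Proof.
  intros Hx.
  pose proof (root4_pos x Hx) as Ha. pose proof (root4_pos (x + 1) ltac:(lra)) as Hb.
  pose proof (root4_pow x ltac:(lra)) as Ea.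
  pose proof (root4_pow (x + 1) ltac:(lra)) as Eb.
  set (a := root4 x) in *. set (b := root4 (x + 1)) in *.
  assert (a < b)%R.
  { apply Rnot_le_lt; intros Hle. assert (b ^ 4 <= a ^ 4)%R by (apply pow_incr; lra). lra. }
  assert (E1 : ((b - a) * ((b + a) * (b ^ 2 + a ^ 2)) = 1)%R) by nra.
  assert (B : (((b + a) * (b ^ 2 + a ^ 2)) <= 4 * b ^ 3)%R).
  { replace (4 * b ^ 3)%R with ((b + b) * (b ^ 2 + b ^ 2))%R by ring.
    apply Rmult_le_compat; nra. }
  assert (B2 : (1 <= (b - a) * (4 * b ^ 3))%R).
  { rewrite <- E1 at 1. apply Rmult_le_compat_l; lra. }
  apply Rmult_le_reg_r with (a * b * b ^ 4)%R.
  { apply Rmult_lt_0_compat; [apply Rmult_lt_0_compat; auto|apply pow_lt; auto]. }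
  assert (b ^ 3 > 0)%R by (apply pow_lt; auto).
  rewrite <- Eb.
  replace (/ (b ^ 4 * b) * (a * b * b ^ 4))%R with a by (field; lra).
  replace (4 * (/ a - / b) * (a * b * b ^ 4))%R with
    (((b - a) * (4 * b ^ 3)) * b)%R by (field; lra).
  nra.
Qed.

(** The exponent 5 / 4 is half of the exponent 5 / 2 used for lattice vectors: the weight of a
    vector is bounded by a constant times a product of two such weights, one for each coordinate. *)
Definition w54 (x : R) : R := / (x * root4 x).

Lemma w54_pos x : (0 < x)%R -> (0 < w54 x)%R.
Proof.
  intros. apply Rinv_0_lt_compat, Rmult_lt_0_compat; auto. apply root4_pos; auto.
Qed.

Lemma summable_w54_Z : summable (fun m : Z => w54 (1 + Rabs (IZR m))).
Proof.
  assert (Hp : forall m : Z, (0 <= w54 (1 + Rabs (IZR m)))%R).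
  { intros m. left. apply w54_pos. pose proof (Rabs_pos (IZR m)); lra. }
  apply summable_Z_even; auto.
  { intros m. rewrite opp_IZR, Rabs_Ropp; auto. }
  apply summable_nat with (w54 1 + 4)%R; auto.
  assert (B : forall n, (rsum (fun n => w54 (1 + Rabs (IZR (Z.of_nat n)))) (seq 0 (S n))
     <= w54 1 + 4 * (1 - / root4 (1 + INR n)))%R).
  { induction n.
    - simpl. rewrite Rabs_R0, Rplus_0_r. unfold root4; rewrite Rplus_0_r, !sqrt_1. lra.
    - rewrite seq_S, rsum_app. cbn [rsum]. rewrite Nat.add_0_l.
      rewrite <- INR_IZR_INZ, (Rabs_pos_eq _ (pos_INR _)).
      pose proof (inv_54_telescope (1 + INR n)%R) as H.
      rewrite S_INR. pose proof (pos_INR n).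
      replace (1 + (INR n + 1))%R with (1 + INR n + 1)%R by ring.
      unfold w54 at 2. specialize (H ltac:(lra)). lra. }
  intros [|n].
  - simpl. pose proof (w54_pos 1 ltac:(lra)). lra.
  - eapply Rle_trans; [apply B|].
    pose proof (root4_pos (1 + INR n)) as H. pose proof (pos_INR n).
    assert (0 < / root4 (1 + INR n))%R by (apply Rinv_0_lt_compat, H; lra). lra.
Qed.

(** * Indicator functions and weights of lattice vectors *)

Definition chiR (G : C -> Prop) (u : C) : R :=
  if excluded_middle_informative (G u) then 1%R else 0%R.

(** A sum over [G] is written as a sum over the whole plane with this factor. Translations and
    reflections of the index are then bijections of the plane. *)
Definition chi (G : C -> Prop) (u : C) : C := RtoC (chiR G u).

(* The exponent [5 / 2] is the one needed to dominate the double series of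
   [P * S3]: its terms have total degree 5, shared between two lattice vectors. *)
Definition wt (u : C) : R := / ((1 + Cmod u) ^ 2 * sqrt (1 + Cmod u)).

(** The form in which the analysis uses a lattice: the differential equations and the asymptotics of
    the sums are proved from it without a basis. *)
Definition summable_lattice (G : C -> Prop) : Prop :=
  is_subgroup G /\
  (exists d, (0 < d)%R /\ forall u, G u -> u <> 0 -> (d <= Cmod u)%R) /\
  summable (fun u => chiR G u * wt u)%R.

Lemma wt_pos u : (0 < wt u)%R.
Proof.
  pose proof (Cmod_ge_0 u). apply Rinv_0_lt_compat, Rmult_lt_0_compat.
  - apply pow_lt; lra.
  - apply sqrt_lt_R0; lra.
Qed.

Lemma chiR_bounds G u : (0 <= chiR G u <= 1)%R.
Proof. unfold chiR; destruct excluded_middle_informative; lra. Qed.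

Lemma chiR_1 (G : C -> Prop) u : G u -> chiR G u = 1%R.
Proof. intros; unfold chiR; destruct excluded_middle_informative; easy. Qed.

Lemma chiR_0 (G : C -> Prop) u : ~ G u -> chiR G u = 0%R.
Proof. intros; unfold chiR; destruct excluded_middle_informative; easy. Qed.

Lemma chi_1 (G : C -> Prop) u : G u -> chi G u = 1.
Proof. intros; unfold chi; rewrite chiR_1; auto. Qed.

Lemma chi_0 (G : C -> Prop) u : ~ G u -> chi G u = 0.
Proof. intros; unfold chi; rewrite chiR_0; auto. Qed.

Lemma Cmod_chi G u : Cmod (chi G u) = chiR G u.
Proof. unfold chi. rewrite Cmod_R, Rabs_pos_eq; auto. apply chiR_bounds. Qed.

Lemma chi_iff (G H : C -> Prop) u v : (G u <-> H v) -> chi G u = chi H v.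
Proof.
  intros E. unfold chi, chiR.
  destruct (excluded_middle_informative (G u)), (excluded_middle_informative (H v)); tauto.
Qed.

Lemma sub_opp G x : is_subgroup G -> G x -> G (- x).
Proof. intros [H0 H] Hx. replace (- x) with (0 - x) by ring. auto. Qed.

Lemma sub_plus G x y : is_subgroup G -> G x -> G y -> G (x + y).
Proof.
  intros HG Hx Hy. replace (x + y) with (x - - y) by ring.
  apply HG; auto. apply sub_opp; auto.
Qed.

Lemma chi_shift G w u : is_subgroup G -> G w -> chi G (u + w) = chi G u.
Proof.
  intros HG Hw. apply chi_iff. split; intros.
  - replace u with (u + w - w) by ring. apply HG; auto.
  - apply sub_plus; auto.
Qed.

Lemma chi_opp G u : is_subgroup G -> chi G (- u) = chi G u.
Proof.
  intros HG. apply chi_iff. split; intros.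
  - replace u with (- - u) by ring. apply sub_opp; auto.
  - apply sub_opp; auto.
Qed.

Definition has_basis (a b : C) (G : C -> Prop) : Prop :=
  Im (b * Cconj a) <> 0%R /\
  forall z, G z <-> exists m n : Z, z = IZR m * a + IZR n * b.

(** Cramer's rule: for [z = x a + y b], [y * D] is [Im (z * Cconj a)] and [x * D] is
    [- Im (z * Cconj b)], so both coordinates are bounded by multiples of [Cmod z]. *)
Lemma basis_lower (a b : C) :
  Im (b * Cconj a) <> 0%R ->
  exists c, (0 < c)%R /\ forall x y : R, (c * (Rabs x + Rabs y) <= Cmod (x * a + y * b))%R.
Proof.
  intros Hd. set (D := Im (b * Cconj a)) in *.
  assert (Ha : (0 < Cmod a)%R).
  { apply Cmod_gt_0. intros ->. apply Hd. unfold D.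
    destruct b; simpl; ring. }
  assert (Hb : (0 < Cmod b)%R).
  { apply Cmod_gt_0. intros ->. apply Hd. unfold D.
    destruct a; simpl; ring. }
  assert (HD : (0 < Rabs D)%R) by (apply Rabs_pos_lt; auto).
  exists (Rabs D / (Cmod a + Cmod b))%R. split.
  { apply Rdiv_lt_0_compat; lra. }
  intros x y. set (z := x * a + y * b).
  assert (Hy : (Rabs y * Rabs D <= Cmod z * Cmod a)%R).
  { rewrite <- Rabs_mult.
    replace (y * D)%R with (Im (z * Cconj a)).
    - rewrite <- (Cmod_conj a), <- Cmod_mult. apply im_le_Cmod.
    - unfold z, D. destruct a, b; simpl; ring. }
  assert (Hx : (Rabs x * Rabs D <= Cmod z * Cmod b)%R).
  { rewrite <- Rabs_mult.
    replace (x * D)%R with (- Im (z * Cconj b))%R.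
    - rewrite Rabs_Ropp, <- (Cmod_conj b), <- Cmod_mult. apply im_le_Cmod.
    - unfold z, D. destruct a, b; simpl; ring. }
  apply Rmult_le_reg_r with (Cmod a + Cmod b)%R; [lra|].
  field_simplify; [|lra]. lra.
Qed.

Lemma w54_le (x y : R) : (0 < x <= y)%R -> (w54 y <= w54 x)%R.
Proof.
  intros [Hx Hy]. apply Rinv_le_contravar.
  - apply Rmult_lt_0_compat; auto. apply root4_pos; auto.
  - apply Rmult_le_compat; try lra.
    + left; apply root4_pos; lra.
    + apply sqrt_le_1_alt, sqrt_le_1_alt; auto.
Qed.

Lemma w54_mult (x y : R) : (0 < x)%R -> (0 < y)%R -> w54 (x * y) = (w54 x * w54 y)%R.
Proof.
  intros. unfold w54, root4. rewrite !sqrt_mult by (try apply sqrt_pos; lra).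
  rewrite <- Rinv_mult. f_equal. ring.
Qed.

Lemma wt_w54 u : wt u = w54 ((1 + Cmod u) ^ 2).
Proof.
  unfold wt, w54, root4. rewrite sqrt_pow2; auto. pose proof (Cmod_ge_0 u); lra.
Qed.

Lemma basis_slat a b G : has_basis a b G -> summable_lattice G.
Proof.
  intros [Hd HG]. destruct (basis_lower a b Hd) as [c [Hc Hl]].
  split; [|split].
  - split.
    + apply HG. exists 0%Z, 0%Z. ring.
    + intros x y Hx Hy. apply HG in Hx as [m [n ->]]. apply HG in Hy as [m' [n' ->]].
      apply HG. exists (m - m')%Z, (n - n')%Z. rewrite !minus_IZR, !RtoC_minus. ring.
  - exists c. split; auto. intros u Hu Hu0. apply HG in Hu as [m [n ->]].
    eapply Rle_trans; [|apply Hl]. rewrite <- (Rmult_1_r c) at 1.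
    apply Rmult_le_compat_l; [lra|].
    rewrite <- !abs_IZR, <- plus_IZR. apply IZR_le.
    assert (m <> 0 \/ n <> 0)%Z; [|lia].
    apply NNPP; intros Hn. assert (m = 0 /\ n = 0)%Z as [-> ->] by lia.
    apply Hu0. ring.
  - set (h := fun p : Z * Z => IZR (fst p) * a + IZR (snd p) * b).
    apply (summable_image h).
    + intros u. pose proof (wt_pos u). pose proof (chiR_bounds G u). nra.
    + intros u Hu. destruct (classic (G u)) as [H|H].
      * apply HG in H as [m [n ->]]. exists (m, n); auto.
      * rewrite chiR_0 in Hu; auto. lra.
    (* As [k <= 1] and [k <= c], [1 + Cmod u] is at least [k (1 + |m| + |n|)], and the square of
       this is at least [k ^ 2 (1 + |m|) (1 + |n|)]. The weight thus splits between the
       coordinates. *)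
    + set (k := Rmin 1 c).
      assert (Hk : (0 < k)%R) by (unfold k; apply Rmin_glb_lt; lra).
      pose proof (Rmin_l 1 c) as k1. pose proof (Rmin_r 1 c) as kc. fold k in k1, kc.
      apply summable_le with (fun p => w54 (k ^ 2) *
         (w54 (1 + Rabs (IZR (fst p))) * w54 (1 + Rabs (IZR (snd p)))))%R.
      * intros [m n]. split.
        { pose proof (wt_pos (h (m, n))). pose proof (chiR_bounds G (h (m, n))). nra. }
        rewrite (chiR_1 G) by (apply HG; unfold h; simpl; eauto).
        rewrite Rmult_1_l, wt_w54. simpl fst; simpl snd.
        pose proof (Rabs_pos (IZR m)). pose proof (Rabs_pos (IZR n)).
        rewrite <- !w54_mult by (try apply pow_lt; try apply Rmult_lt_0_compat; lra).
        apply w54_le. split.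
        { repeat apply Rmult_lt_0_compat; lra. }
        specialize (Hl (IZR m) (IZR n)). fold (h (m, n)) in Hl.
        change (IZR m * a + IZR n * b) with (h (m, n)) in Hl.
        assert (Hz : (k * (1 + Rabs (IZR m) + Rabs (IZR n)) <= 1 + Cmod (h (m, n)))%R) by nra.
        apply Rle_trans with ((k * (1 + Rabs (IZR m) + Rabs (IZR n))) ^ 2)%R.
        { rewrite Rpow_mult_distr. apply Rmult_le_compat_l; [apply pow_le; lra|]. nra. }
        apply pow_incr. split; auto. apply Rmult_le_pos; lra.
      * apply summable_scal; [left; apply w54_pos, pow_lt; auto|].
        apply (summable_prod (fun m => w54 (1 + Rabs (IZR m)))
                             (fun n => w54 (1 + Rabs (IZR n))));
          apply summable_w54_Z.
Qed.

(** Two points of [G] closer than [d / 2] to [z] coincide, so the points of [G] other than [z] keep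
    a distance [e] from it; far away the triangle inequality takes over. The point [z] may itself
    belong to [G]. *)
Lemma slat_dist G (z : C) : summable_lattice G ->
  exists c, (0 < c)%R /\ forall u, G u -> u <> z -> (c * (1 + Cmod u) <= Cmod (z - u))%R.
Proof.
  intros [HG [[d [Hd Hsep]] _]].
  assert (exists e, (0 < e)%R /\ forall u, G u -> u <> z -> (e <= Cmod (z - u))%R)
    as [e [He H]].
  { destruct (classic (exists u, G u /\ u <> z /\ (Cmod (z - u) < d / 2)%R))
      as [[u1 [H1 [H2 H3]]]|Hn].
    - exists (Cmod (z - u1)). split.
      { apply Cmod_gt_0. intros E. apply H2. replace u1 with (z - (z - u1)) by ring.
        rewrite E; ring. }
      intros u Hu Hz. apply Rnot_lt_le; intros Hlt.
      destruct (classic (u = u1)) as [->|Hne]; [lra|].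
      assert (d <= Cmod (u - u1))%R.
      { apply Hsep; [apply HG; auto|]. intros E. apply Hne.
        replace u with (u - u1 + u1) by ring. rewrite E; ring. }
      assert (Cmod (u - u1) <= Cmod (z - u1) + Cmod (z - u))%R; [|lra].
      replace (u - u1) with (z - u1 + - (z - u)) by ring.
      eapply Rle_trans; [apply Cmod_triangle|]. rewrite Cmod_opp. lra.
    - exists (d / 2)%R. split; [lra|]. intros u Hu Hz. apply Rnot_lt_le; intros Hlt.
      apply Hn. exists u; auto. }
  pose proof (Cmod_ge_0 z).
  (* From [e <= Cmod (z - u)] and [Cmod u <= Cmod z + Cmod (z - u)] follows [e (1 + Cmod u) <= (1 +
     e + Cmod z) Cmod (z - u)]. *)
  exists (e / (1 + e + Cmod z))%R. split; [apply Rdiv_lt_0_compat; lra|].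
  intros u Hu Hz. specialize (H u Hu Hz).
  apply Rmult_le_reg_r with (1 + e + Cmod z)%R; [lra|].
  assert (Cmod u <= Cmod z + Cmod (z - u))%R.
  { replace u with (z + - (z - u)) at 1 by ring.
    eapply Rle_trans; [apply Cmod_triangle|]. rewrite Cmod_opp. lra. }
  field_simplify; [|lra]. nra.
Qed.

(** * The sums P, S_k and E_k of a lattice *)

Lemma Cinv_0 : / (RtoC 0) = 0.
Proof. unfold Cinv, RtoC; simpl. f_equal; unfold Rdiv; ring. Qed.

Lemma Cinv_pow (x : C) k : / x ^ k = (/ x) ^ k.
Proof.
  destruct (classic (x = 0)) as [->|H].
  - destruct k; [simpl; field; apply C1_nz|]. rewrite Cinv_0. simpl.
    rewrite !Cmult_0_l. apply Cinv_0.
  - rewrite Cpow_inv; auto.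
Qed.

Lemma Cmod_inv_le (x : C) (r : R) : (0 < r)%R -> (x <> 0 -> (r <= Cmod x)%R) ->
  (Cmod (/ x) <= / r)%R.
Proof.
  intros Hr H. destruct (classic (x = 0)) as [->|Hx].
  - rewrite Cinv_0, Cmod_0. left. apply Rinv_0_lt_compat; auto.
  - rewrite Cmod_inv by auto. apply Rinv_le_contravar; auto.
Qed.

Lemma pow3_wt u : (/ (1 + Cmod u) ^ 3 <= wt u)%R.
Proof.
  pose proof (Cmod_ge_0 u) as Hu. unfold wt.
  assert (0 < sqrt (1 + Cmod u))%R by (apply sqrt_lt_R0; lra).
  apply Rinv_le_contravar; [apply Rmult_lt_0_compat; auto; apply pow_lt; lra|].
  replace ((1 + Cmod u) ^ 3)%R with ((1 + Cmod u) ^ 2 * (1 + Cmod u))%R by ring.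
  apply Rmult_le_compat_l; [apply pow_le; lra|].
  pose proof (sqrt_sqrt (1 + Cmod u) ltac:(lra)).
  assert (1 <= sqrt (1 + Cmod u))%R.
  { rewrite <- sqrt_1 at 1. apply sqrt_le_1_alt; lra. }
  nra.
Qed.

Lemma pow_inv_wt (x u : C) c k : (0 < c)%R -> (3 <= k)%nat ->
  (x <> 0 -> (c * (1 + Cmod u) <= Cmod x)%R) ->
  (Cmod (/ x ^ k) <= / c ^ k * wt u)%R.
Proof.
  intros Hc Hk H. pose proof (Cmod_ge_0 u) as Hu.
  rewrite Cinv_pow, Cmod_pow.
  apply Rle_trans with ((/ (c * (1 + Cmod u))) ^ k)%R.
  { apply pow_incr. split; [apply Cmod_ge_0|].
    apply Cmod_inv_le; auto. apply Rmult_lt_0_compat; lra. }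
  rewrite Rinv_mult, Rpow_mult_distr, pow_inv.
  apply Rmult_le_compat_l.
  { left. apply Rinv_0_lt_compat, pow_lt; auto. }
  eapply Rle_trans; [|apply pow3_wt]. rewrite pow_inv.
  apply Rinv_le_contravar; [apply pow_lt; lra|].
  apply Rle_pow; [lra|auto].
Qed.

(* As [/ 0 = 0], the index [u = 0] needs no exclusion: it contributes [/ z ^ 2] to
   [Psum], the term outside the sum in [wp], and nothing to [Esum]. *)
Definition Ssum (G : C -> Prop) (k : nat) (z : C) : C :=
  tsum (fun u => chi G u * / (z - u) ^ k).
Definition Psum (G : C -> Prop) (z : C) : C :=
  tsum (fun u => chi G u * (/ (z - u) ^ 2 - / u ^ 2)).
Definition Esum (G : C -> Prop) (k : nat) : C :=
  tsum (fun u => chi G u * / u ^ k).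

Lemma abs_summable_wt G (f : C -> C) K :
  summable_lattice G -> (0 <= K)%R -> (forall u, G u -> Cmod (f u) <= K * wt u)%R ->
  abs_summable (fun u => chi G u * f u).
Proof.
  intros [_ [_ HS]] HK H.
  apply abs_summable_le with (fun u => K * (chiR G u * wt u))%R;
    [|apply summable_scal; auto].
  intros u. rewrite Cmod_mult, Cmod_chi.
  destruct (classic (G u)) as [Hu|Hu].
  - rewrite (chiR_1 G u Hu). specialize (H u Hu). lra.
  - rewrite (chiR_0 G u Hu). lra.
Qed.

Lemma summable_point {T : Type} (x0 : T) (c : R) : (0 <= c)%R ->
  summable (fun x => if eq_em x x0 then c else 0%R).
Proof.
  intros Hc. assert (Hp : forall x : T, (0 <= (if eq_em x x0 then c else 0))%R).
  { intros x; destruct eq_em; lra. }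
  split; auto.
  exists c. intros l Hl. induction Hl; simpl; [lra|].
  destruct (eq_em x x0) as [->|]; [|lra].
  enough (rsum (fun x => if eq_em x x0 then c else 0%R) l <= 0)%R by lra.
  clear IHHl Hl. induction l; simpl; [lra|]. simpl in H.
  destruct eq_em as [->|]; [exfalso; auto|].
  enough (rsum (fun x => if eq_em x x0 then c else 0%R) l <= 0)%R by lra. auto.
Qed.

Lemma abs_summable_off {T : Type} (x0 : T) (f f' : T -> C) :
  abs_summable f -> (forall x, x <> x0 -> f' x = f x) -> abs_summable f'.
Proof.
  intros Hf H.
  apply abs_summable_le with
    (fun x => Cmod (f x) + (if eq_em x x0 then Cmod (f' x0) else 0))%R.
  - intros x. destruct eq_em as [->|Hx].
    + pose proof (Cmod_ge_0 (f x0)); lra.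
    + rewrite H by auto. lra.
  - apply summable_plus; auto. apply summable_point, Cmod_ge_0.
Qed.

Lemma S_abs G k z : summable_lattice G -> (3 <= k)%nat ->
  abs_summable (fun u => chi G u * / (z - u) ^ k).
Proof.
  intros HG Hk. destruct (slat_dist G z HG) as [c [Hc H]].
  apply abs_summable_wt with (/ c ^ k)%R; auto.
  { left. apply Rinv_0_lt_compat, pow_lt; auto. }
  intros u Hu. apply pow_inv_wt; auto. intros Hn. apply H; auto.
  intros ->. apply Hn; ring.
Qed.

Lemma S_has_sum G k z : summable_lattice G -> (3 <= k)%nat ->
  has_sum (fun u => chi G u * / (z - u) ^ k) (Ssum G k z).
Proof. intros. apply abs_summable_has_sum, S_abs; auto. Qed.

Lemma E_abs G k : summable_lattice G -> (3 <= k)%nat ->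
  abs_summable (fun u => chi G u * / u ^ k).
Proof.
  intros HG Hk. destruct (slat_dist G 0 HG) as [c [Hc H]].
  apply abs_summable_wt with (/ c ^ k)%R; auto.
  { left. apply Rinv_0_lt_compat, pow_lt; auto. }
  intros u Hu. apply pow_inv_wt; auto. intros Hn.
  replace (Cmod u) with (Cmod (0 - u)) at 2; [apply H; auto|].
  rewrite <- Cmod_opp. f_equal. ring.
Qed.

Lemma E_has_sum G k : summable_lattice G -> (3 <= k)%nat ->
  has_sum (fun u => chi G u * / u ^ k) (Esum G k).
Proof. intros. apply abs_summable_has_sum, E_abs; auto. Qed.

Lemma inv_sq_diff (p u : C) : p <> 0 -> u <> 0 ->
  / p ^ 2 - / u ^ 2 = (p + u) * (/ (p ^ 2 * u) - / (p * u ^ 2)).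
Proof. intros. field. auto. Qed.

Lemma inv_sq_diff_wt (p u w : C) c : (0 < c)%R -> p <> 0 -> u <> 0 ->
  (c * (1 + Cmod w) <= Cmod p)%R -> (c * (1 + Cmod w) <= Cmod u)%R ->
  (Cmod (/ p ^ 2 - / u ^ 2) <= Cmod (p + u) * (2 * / c ^ 3) * wt w)%R.
Proof.
  intros Hc Hp Hu Bp Bu. rewrite inv_sq_diff, Cmod_mult, Rmult_assoc by auto.
  apply Rmult_le_compat_l; [apply Cmod_ge_0|].
  pose proof (Cmod_ge_0 w) as H0. pose proof (pow3_wt w) as H3.
  set (r := (c * (1 + Cmod w))%R) in *.
  assert (Hr : (0 < r)%R) by (apply Rmult_lt_0_compat; lra).
  assert (B : (/ r ^ 3 <= / c ^ 3 * wt w)%R).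
  { unfold r. rewrite Rpow_mult_distr, Rinv_mult. apply Rmult_le_compat_l; auto.
    left; apply Rinv_0_lt_compat, pow_lt; auto. }
  assert (B1 : forall x : C, x <> 0 -> (r ^ 3 <= Cmod x)%R ->
     (Cmod (/ x) <= / c ^ 3 * wt w)%R).
  { intros x Hx Hb. eapply Rle_trans; [|apply B]. apply Cmod_inv_le; auto.
    apply pow_lt; auto. }
  eapply Rle_trans; [apply Cmod_triangle|]. rewrite Cmod_opp.
  enough (Cmod (/ (p * u ^ 2)) <= / c ^ 3 * wt w /\
          Cmod (/ (p ^ 2 * u)) <= / c ^ 3 * wt w)%R by lra.
  split; apply B1.
  - apply Cmult_neq_0; auto. apply Cpow_nz; auto.
  - rewrite Cmod_mult, Cmod_pow. simpl. apply Rmult_le_compat; try lra; try nra.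
  - apply Cmult_neq_0; auto. apply Cpow_nz; auto.
  - rewrite Cmod_mult, Cmod_pow.
    replace (r ^ 3)%R with (r ^ 2 * r)%R by ring.
    apply Rmult_le_compat; [apply pow_le; lra|lra|apply pow_incr; lra|lra].
Qed.

Lemma slat_dist2 G (z : C) : summable_lattice G ->
  exists c, (0 < c)%R /\ forall u, G u ->
    (u <> z -> (c * (1 + Cmod u) <= Cmod (z - u))%R) /\
    (u <> 0 -> (c * (1 + Cmod u) <= Cmod u)%R).
Proof.
  intros HG. destruct (slat_dist G z HG) as [c [Hc H]].
  destruct (slat_dist G 0 HG) as [c' [Hc' H']].
  exists (Rmin c c'). split; [apply Rmin_glb_lt; auto|].
  intros u Hu. pose proof (Cmod_ge_0 u). split; intros Hn.
  - eapply Rle_trans; [|apply H; auto]. apply Rmult_le_compat_r; [lra|apply Rmin_l].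
  - replace (Cmod u) with (Cmod (0 - u)) at 2.
    + eapply Rle_trans; [|apply H'; auto]. apply Rmult_le_compat_r; [lra|apply Rmin_r].
    + rewrite <- Cmod_opp. f_equal. ring.
Qed.

Lemma P_abs G z : summable_lattice G ->
  abs_summable (fun u => chi G u * (/ (z - u) ^ 2 - / u ^ 2)).
Proof.
  intros HG. destruct (slat_dist2 G z HG) as [c [Hc H]].
  set (f := fun u => if eq_em u z then RtoC 0 else if eq_em u 0 then RtoC 0 else
                     / (z - u) ^ 2 - / u ^ 2).
  apply abs_summable_off with (x0 := RtoC 0) (f := fun u : C => if eq_em u (RtoC 0) then RtoC 0 else
     chi G u * (/ (z - u) ^ 2 - / u ^ 2)).
  2: { intros u Hu. destruct eq_em; easy. }
  apply abs_summable_off with (x0 := z) (f := fun u => chi G u * f u).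
  2: { intros u Hu. unfold f. destruct (eq_em u z); [easy|].
       destruct (eq_em u (RtoC 0)); auto. ring. }
  apply abs_summable_wt with (Cmod z * (2 * / c ^ 3))%R; auto.
  { apply Rmult_le_pos; [apply Cmod_ge_0|].
    assert (0 < / c ^ 3)%R by (apply Rinv_0_lt_compat, pow_lt; auto). lra. }
  intros u Hu. unfold f. pose proof (wt_pos u) as Hw.
  assert (0 < / c ^ 3)%R by (apply Rinv_0_lt_compat, pow_lt; auto).
  assert (0 <= Cmod z * (2 * / c ^ 3) * wt u)%R.
  { apply Rmult_le_pos; [|lra]. apply Rmult_le_pos; [apply Cmod_ge_0|lra]. }
  destruct (eq_em u z); [rewrite Cmod_0; auto|].
  destruct (eq_em u (RtoC 0)); [rewrite Cmod_0; auto|].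
  destruct (H u Hu) as [Bz B0].
  replace (Cmod z) with (Cmod (z - u + u)) by (f_equal; ring).
  apply inv_sq_diff_wt; auto.
  intros E. apply n. replace u with (z - (z - u)) by ring. rewrite E; ring.
Qed.

Lemma P_has_sum G z : summable_lattice G ->
  has_sum (fun u => chi G u * (/ (z - u) ^ 2 - / u ^ 2)) (Psum G z).
Proof. intros. apply abs_summable_has_sum, P_abs; auto. Qed.

Lemma has_sum_shift (f : C -> C) w s :
  has_sum f s <-> has_sum (fun u => f (u + w)) s.
Proof.
  apply has_sum_reindex.
  - intros a b E. replace a with (a + w - w) by ring. rewrite E; ring.
  - intros x _. exists (x - w). ring.
Qed.

Lemma has_sum_reflect (f : C -> C) w s :
  has_sum f s <-> has_sum (fun u => f (w - u)) s.
Proof.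
  apply has_sum_reindex.
  - intros a b E. replace a with (w - (w - a)) by ring. rewrite E; ring.
  - intros x _. exists (w - x). ring.
Qed.

Lemma S_periodic G k z w : summable_lattice G -> (3 <= k)%nat -> G w ->
  Ssum G k (z + w) = Ssum G k z.
Proof.
  intros HG Hk Hw. apply tsum_has_sum, (has_sum_shift _ w).
  eapply has_sum_ext; [|apply S_has_sum; auto]. intros u; simpl.
  rewrite chi_shift by (auto; apply HG). do 3 f_equal. ring.
Qed.

Lemma Cinv_sq_opp (x : C) : / (- x) ^ 2 = / x ^ 2.
Proof. f_equal. ring. Qed.

(* The difference does not involve [z], and the reflection [u -> - u - w] changes
   its sign. *)
Lemma P_periodic G z w : summable_lattice G -> G w -> Psum G (z + w) = Psum G z.
Proof.
  intros HG Hw. pose proof (proj1 HG) as HS.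
  assert (H : has_sum (fun u => chi G u * (/ u ^ 2 - / (u + w) ^ 2))
                (Psum G (z + w) - Psum G z)).
  { eapply has_sum_ext; [|apply has_sum_minus;
      [exact (proj1 (has_sum_shift _ w _) (P_has_sum G (z + w) HG))
      |apply (P_has_sum G z); auto]].
    intros u; simpl. rewrite chi_shift by auto.
    replace (z + w - (u + w)) with (z - u) by ring. ring. }
  assert (H' : has_sum (fun u => chi G u * (/ u ^ 2 - / (u + w) ^ 2))
                (- (Psum G (z + w) - Psum G z))).
  { eapply has_sum_ext; [|exact (has_sum_opp _ _ (proj1 (has_sum_reflect _ (- w) _) H))].
    intros u; cbv beta. replace (- w - u) with (- (u + w)) by ring.
    rewrite chi_opp, chi_shift by auto.
    replace (- (u + w) + w) with (- u) by ring.
    rewrite !Cinv_sq_opp. ring. }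
  pose proof (has_sum_unique _ _ _ H H') as E.
  set (d := Psum G (z + w) - Psum G z) in *.
  assert (d + d = 0) as E2 by (rewrite E at 1; ring).
  assert (d = 0) as E3.
  { replace d with ((d + d) / 2) by field. rewrite E2. field. }
  replace (Psum G (z + w)) with (d + Psum G z) by (unfold d; ring).
  rewrite E3; ring.
Qed.

Lemma S_opp G k z : summable_lattice G -> (3 <= k)%nat ->
  Ssum G k (- z) = (- (1)) ^ k * Ssum G k z.
Proof.
  intros HG Hk. apply tsum_has_sum, (has_sum_reflect _ 0).
  eapply has_sum_ext; [|apply has_sum_scal, S_has_sum; auto]. intros u; simpl.
  replace (0 - u) with (- u) by ring. rewrite chi_opp by apply HG.
  rewrite !Cinv_pow.
  replace (- z - - u) with (- (1) * (z - u)) by ring.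
  assert (E : / (- (1) * (z - u)) = - (1) * / (z - u)).
  { destruct (classic (z - u = 0)) as [->|Hn].
    - rewrite !Cmult_0_r, Cinv_0. ring.
    - field. auto. }
  rewrite E, Cpow_mult_l. ring.
Qed.

Lemma P_opp G z : summable_lattice G -> Psum G (- z) = Psum G z.
Proof.
  intros HG. apply tsum_has_sum, (has_sum_reflect _ 0).
  eapply has_sum_ext; [|apply P_has_sum; auto]. intros u; cbv beta.
  replace (0 - u) with (- u) by ring. rewrite chi_opp by apply HG.
  replace (- z - - u) with (- (z - u)) by ring.
  rewrite !Cinv_sq_opp; auto.
Qed.

Lemma E_odd G k : summable_lattice G -> (3 <= k)%nat -> Nat.Odd k -> Esum G k = 0.
Proof.
  intros HG Hk Ho.
  assert (H : has_sum (fun u => chi G u * / u ^ k) (- Esum G k)).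
  { apply (has_sum_reflect _ 0).
    eapply has_sum_ext; [|apply has_sum_opp, E_has_sum; eauto].
    intros u; simpl. replace (0 - u) with (- u) by ring. rewrite chi_opp by apply HG.
    destruct Ho as [j ->].
    replace ((- u) ^ (2 * j + 1)) with (- u ^ (2 * j + 1)).
    - rewrite !Cinv_pow. destruct (classic (u = 0)) as [->|Hu].
      + rewrite Nat.add_1_r; simpl. rewrite Cinv_0.
        replace (- (0 * 0 ^ (j + (j + 0)))) with (RtoC 0) by ring. rewrite Cinv_0. ring.
      + rewrite <- Cinv_pow. field. apply Cpow_nz; auto.
    - rewrite !Cpow_add_r, !Cpow_mult_r. simpl.
      replace (- u * (- u * 1)) with (u * (u * 1)) by ring. ring. }
  pose proof (has_sum_unique _ _ _ H (E_has_sum G k HG Hk)) as E.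
  replace (Esum G k) with ((Esum G k - - Esum G k) / 2) by field.
  rewrite E. field.
Qed.

(** * The identity [P * S3 = S5] *)

Definition w52 (x : R) : R := / (x ^ 2 * sqrt x).

Lemma w52_pos x : (0 < x)%R -> (0 < w52 x)%R.
Proof.
  intros. apply Rinv_0_lt_compat, Rmult_lt_0_compat; [apply pow_lt|apply sqrt_lt_R0]; auto.
Qed.

Lemma w52_mult (x y : R) : (0 <= x)%R -> (0 <= y)%R -> w52 (x * y) = (w52 x * w52 y)%R.
Proof.
  intros. unfold w52. rewrite sqrt_mult, <- Rinv_mult by auto. f_equal. ring.
Qed.

Lemma w52_le (x y : R) : (0 < x <= y)%R -> (w52 y <= w52 x)%R.
Proof.
  intros [Hx Hy]. apply Rinv_le_contravar.
  - apply Rmult_lt_0_compat; [apply pow_lt|apply sqrt_lt_R0]; auto.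
  - apply Rmult_le_compat; [apply pow_le; lra|apply sqrt_pos|apply pow_incr; lra|].
    apply sqrt_le_1_alt; auto.
Qed.

Lemma w52_sq x : (0 < x)%R -> w52 (x ^ 2) = (/ x ^ 5)%R.
Proof. intros. unfold w52. rewrite sqrt_pow2 by lra. f_equal. ring. Qed.

(* The two smallest of [a], [b], [c] can absorb the factor of the largest one. *)
Lemma w52_three (a b c : R) : (0 < a)%R -> (0 < b)%R -> (0 < c)%R ->
  (/ (a ^ 2 * b ^ 2 * c) <= w52 a * w52 b + w52 b * w52 c + w52 a * w52 c)%R.
Proof.
  intros Ha Hb Hc.
  assert (sq : forall x, (0 < x)%R -> exists y, (0 < y)%R /\ x = (y ^ 2)%R).
  { intros x Hx. exists (sqrt x). split; [apply sqrt_lt_R0; auto|].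
    rewrite pow2_sqrt; lra. }
  destruct (sq a Ha) as [x [Hx ->]]. destruct (sq b Hb) as [y [Hy ->]].
  destruct (sq c Hc) as [z [Hz ->]]. clear sq Ha Hb Hc.
  rewrite !w52_sq by auto.
  assert (P5 : forall u, (0 < u -> 0 < / u ^ 5)%R).
  { intros; apply Rinv_0_lt_compat, pow_lt; auto. }
  pose proof (P5 x Hx) as Wa. pose proof (P5 y Hy) as Wb. pose proof (P5 z Hz) as Wc.
  pose proof (Rmult_lt_0_compat _ _ Wa Wb). pose proof (Rmult_lt_0_compat _ _ Wb Wc).
  pose proof (Rmult_lt_0_compat _ _ Wa Wc).
  assert (I : forall u v q : R, (0 < u)%R -> (0 < v)%R -> (u ^ 5 * v ^ 5 <= q)%R ->
     (/ q <= / u ^ 5 * / v ^ 5)%R).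
  { intros u v q Hu Hv Hq. rewrite <- Rinv_mult. apply Rinv_le_contravar; auto.
    apply Rmult_lt_0_compat; apply pow_lt; auto. }
  assert (Q : forall s t, (0 < s -> 0 < t -> 0 <= s ^ 4 * t ^ 4)%R).
  { intros; apply Rmult_le_pos; apply pow_le; lra. }
  destruct (Rle_dec x z) as [xz|xz]; [destruct (Rle_dec y z) as [yz|yz]|].
  - enough (/ ((x ^ 2) ^ 2 * (y ^ 2) ^ 2 * z ^ 2) <= / x ^ 5 * / y ^ 5)%R by lra.
    apply I; auto.
    replace (x ^ 5 * y ^ 5)%R with ((x ^ 4 * y ^ 4) * (x * y))%R by ring.
    replace ((x ^ 2) ^ 2 * (y ^ 2) ^ 2 * z ^ 2)%R with ((x ^ 4 * y ^ 4) * (z * z))%R by ring.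
    apply Rmult_le_compat_l; auto. apply Rmult_le_compat; lra.
  - enough (/ ((x ^ 2) ^ 2 * (y ^ 2) ^ 2 * z ^ 2) <= / x ^ 5 * / z ^ 5)%R by lra.
    apply I; auto.
    replace (x ^ 5 * z ^ 5)%R with ((x ^ 4 * z ^ 2) * (x * z ^ 3))%R by ring.
    replace ((x ^ 2) ^ 2 * (y ^ 2) ^ 2 * z ^ 2)%R with ((x ^ 4 * z ^ 2) * (y * y ^ 3))%R by ring.
    apply Rmult_le_compat_l; [apply Rmult_le_pos; apply pow_le; lra|].
    apply Rmult_le_compat; [lra|apply pow_le; lra|lra|apply pow_incr; lra].
  - destruct (Rle_dec x y) as [xy|xy].
    + enough (/ ((x ^ 2) ^ 2 * (y ^ 2) ^ 2 * z ^ 2) <= / x ^ 5 * / z ^ 5)%R by lra.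
      apply I; auto.
      replace (x ^ 5 * z ^ 5)%R with ((x ^ 4 * z ^ 2) * (x * z ^ 3))%R by ring.
      replace ((x ^ 2) ^ 2 * (y ^ 2) ^ 2 * z ^ 2)%R with ((x ^ 4 * z ^ 2) * (y * y ^ 3))%R by ring.
      apply Rmult_le_compat_l; [apply Rmult_le_pos; apply pow_le; lra|].
      apply Rmult_le_compat; [lra|apply pow_le; lra|lra|apply pow_incr; lra].
    + enough (/ ((x ^ 2) ^ 2 * (y ^ 2) ^ 2 * z ^ 2) <= / y ^ 5 * / z ^ 5)%R by lra.
      apply I; auto.
      replace (y ^ 5 * z ^ 5)%R with ((y ^ 4 * z ^ 2) * (y * z ^ 3))%R by ring.
      replace ((x ^ 2) ^ 2 * (y ^ 2) ^ 2 * z ^ 2)%R with ((y ^ 4 * z ^ 2) * (x * x ^ 3))%R by ring.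
      apply Rmult_le_compat_l; [apply Rmult_le_pos; apply pow_le; lra|].
      apply Rmult_le_compat; [lra|apply pow_le; lra|lra|apply pow_incr; lra].
Qed.

Lemma sub_eq_0 (x y : C) : x - y = 0 -> x = y.
Proof. intros H. replace x with (x - y + y) by ring. rewrite H; ring. Qed.

(** The difference of the inverse squares contains the factor [q + w = p], which cancels one of the
    three powers of [p]. What is left are two terms of degree 5, each with an exponent at most 2 in
    every variable, as [w52_three] requires. *)
Lemma double_term_bound (p q w : C) : p <> 0 -> q <> 0 -> w <> 0 -> p = q + w ->
  (Cmod (/ p ^ 3 * (/ q ^ 2 - / w ^ 2)) <=
   2 * (w52 (Cmod p) * w52 (Cmod q) + w52 (Cmod p) * w52 (Cmod w)
        + w52 (Cmod q) * w52 (Cmod w)))%R.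
Proof.
  intros Hp Hq Hw E.
  assert (Ep : / p ^ 3 * (/ q ^ 2 - / w ^ 2) = / (p ^ 2 * q ^ 2 * w) - / (w ^ 2 * p ^ 2 * q)).
  { rewrite inv_sq_diff, <- E by auto. field. auto. }
  rewrite Ep. eapply Rle_trans; [apply Cmod_triangle|]. rewrite Cmod_opp.
  pose proof (proj1 (Cmod_gt_0 p) Hp). pose proof (proj1 (Cmod_gt_0 q) Hq).
  pose proof (proj1 (Cmod_gt_0 w) Hw).
  pose proof (w52_three (Cmod p) (Cmod q) (Cmod w)) as T1.
  pose proof (w52_three (Cmod w) (Cmod p) (Cmod q)) as T2.
  assert (Hp2 := Cpow_nz p 2 Hp). assert (Hq2 := Cpow_nz q 2 Hq).
  assert (Hw2 := Cpow_nz w 2 Hw).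
  rewrite !Cmod_inv, !Cmod_mult, !Cmod_pow by (repeat (first [assumption|apply Cmult_neq_0])).
  specialize (T1 ltac:(auto) ltac:(auto) ltac:(auto)).
  specialize (T2 ltac:(auto) ltac:(auto) ltac:(auto)). lra.
Qed.

Definition dterm (G : C -> Prop) (z : C) (x : C * C) : C :=
  chi G (fst x) * chi G (snd x) *
    (/ (z - fst x) ^ 3 * (/ (z - fst x - snd x) ^ 2 - / snd x ^ 2)).

Lemma dterm_abs G z : summable_lattice G -> ~ G z -> abs_summable (dterm G z).
Proof.
  intros HG Hz. pose proof (proj1 HG) as HS. pose proof (proj2 (proj2 HG)) as Hsum.
  destruct (slat_dist2 G z HG) as [c [Hc H]].
  set (g := fun u => (chiR G u * wt u)%R) in *.
  set (K := w52 c). assert (HK : (0 < K)%R) by (apply w52_pos; auto).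
  assert (Hg0 : forall u, (0 <= g u)%R).
  { intros u. unfold g. pose proof (chiR_bounds G u). pose proof (wt_pos u). nra. }
  assert (Hgu : forall u, G u -> g u = wt u).
  { intros u Hu. unfold g. rewrite chiR_1 by auto. ring. }
  assert (B1 : forall u, G u -> (w52 (Cmod (z - u)) <= K * g u)%R).
  { intros u Hu. rewrite Hgu by auto. pose proof (Cmod_ge_0 u).
    change (wt u) with (w52 (1 + Cmod u)). unfold K. rewrite <- w52_mult by lra.
    apply w52_le. split; [apply Rmult_lt_0_compat; lra|].
    apply (H u Hu). intros ->; auto. }
  assert (B2 : forall u, G u -> u <> 0 -> (w52 (Cmod u) <= K * g u)%R).
  { intros u Hu Hu0. rewrite Hgu by auto. pose proof (Cmod_ge_0 u).
    change (wt u) with (w52 (1 + Cmod u)). unfold K. rewrite <- w52_mult by lra.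
    apply w52_le. split; [apply Rmult_lt_0_compat; lra|].
    apply (H u Hu); auto. }
  assert (Sgg : summable (fun x : C * C => g (fst x) * g (snd x))%R)
    by (apply summable_prod; auto).
  (* The index [w = 0] is treated apart: its term is [/ (z - v) ^ 5], and [K0] is chosen so that
     [K0 * (g v * g 0)] equals [/ c ^ 5 * wt v]. *)
  set (K0 := (/ c ^ 5 * / wt 0)%R).
  assert (HK0 : (0 < K0)%R).
  { unfold K0. pose proof (wt_pos 0). apply Rmult_lt_0_compat; apply Rinv_0_lt_compat; auto.
    apply pow_lt; auto. }
  apply abs_summable_le with (fun x =>
    2 * K ^ 2 * (g (fst x) * g (fst x + snd x)%C + g (fst x) * g (snd x)
                + g (fst x + snd x)%C * g (snd x)) + K0 * (g (fst x) * g (snd x)))%R.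
  - intros [v w]. unfold dterm. simpl fst; simpl snd.
    rewrite !Cmod_mult, !Cmod_chi.
    assert (T0 : forall a b, (0 <= g a * g b)%R) by (intros; apply Rmult_le_pos; auto).
    assert (Kp : (0 <= 2 * K ^ 2 * (g v * g (v + w)%C + g v * g w + g (v + w)%C * g w))%R).
    { pose proof (T0 v (v + w)). pose proof (T0 v w). pose proof (T0 (v + w) w).
      apply Rmult_le_pos; [|lra]. pose proof (pow_lt K 2 HK). lra. }
    pose proof (Rmult_le_pos _ _ (Rlt_le _ _ HK0) (T0 v w)) as K0p.
    destruct (classic (G v)) as [Hv|Hv]; [|rewrite (chiR_0 G v Hv); lra].
    destruct (classic (G w)) as [Hw|Hw]; [|rewrite (chiR_0 G w Hw); lra].
    rewrite !chiR_1, !Rmult_1_l by auto.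
    assert (Hvw : G (v + w)) by (apply sub_plus; auto).
    assert (Np : z - v <> 0) by (intros E; apply Hz; rewrite (sub_eq_0 _ _ E); auto).
    assert (Nq : z - v - w <> 0).
    { intros E; apply Hz. replace z with (v + w); auto.
      apply eq_sym, sub_eq_0. rewrite <- E. ring. }
    rewrite <- Cmod_mult.
    destruct (classic (w = 0)) as [->|Hw0].
    + enough (Cmod (/ (z - v) ^ 3 * (/ (z - v - 0) ^ 2 - / 0 ^ 2)) <= K0 * (g v * g 0))%R
        by lra.
      replace (/ (z - v) ^ 3 * (/ (z - v - 0) ^ 2 - / 0 ^ 2)) with (/ (z - v) ^ 5).
      * rewrite (Hgu v Hv), (Hgu 0) by apply HS.
        unfold K0. replace (/ c ^ 5 * / wt 0 * (wt v * wt 0))%R with (/ c ^ 5 * wt v)%R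
          by (field; split; apply Rgt_not_eq; [apply wt_pos|auto]).
        apply pow_inv_wt; [auto|lia|]. intros _. apply (H v Hv). intros ->; auto.
      * replace (z - v - 0) with (z - v) by ring.
        rewrite (Cinv_pow 0 2), Cinv_0. field. auto.
    + pose proof (double_term_bound (z - v) (z - v - w) w Np Nq Hw0 ltac:(ring)) as D.
      pose proof (B1 v Hv) as b1. pose proof (B1 (v + w) Hvw) as b2.
      pose proof (B2 w Hw Hw0) as b3.
      replace (z - (v + w)) with (z - v - w) in b2 by ring.
      assert (T : forall x y a b, (0 <= x -> 0 <= y -> x <= K * a -> y <= K * b ->
          x * y <= K ^ 2 * (a * b))%R).
      { intros x y a b x0 y0 xa yb.
        replace (K ^ 2 * (a * b))%R with ((K * a) * (K * b))%R by ring.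
        apply Rmult_le_compat; auto. }
      assert (W : forall x : C, x <> 0 -> (0 <= w52 (Cmod x))%R).
      { intros x Hx. left. apply w52_pos, Cmod_gt_0; auto. }
      pose proof (T _ _ _ _ (W _ Np) (W _ Nq) b1 b2).
      pose proof (T _ _ _ _ (W _ Np) (W _ Hw0) b1 b3).
      pose proof (T _ _ _ _ (W _ Nq) (W _ Hw0) b2 b3).
      set (g1 := g v) in *. set (g2 := g (v + w)%C) in *. set (g3 := g w) in *.
      lra.
  (* Up to the injections [(v, w) -> (v, v + w)] and [(v, w) -> (v + w, w)], all the majorants are
     products of one weight for each of the two indices. *)
  - apply summable_plus; [|apply summable_scal; [lra|auto]].
    apply summable_scal; [pose proof (pow_lt K 2 HK); lra|].
    apply summable_plus; [apply summable_plus|]; auto.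
    + apply (summable_inj (fun x : C * C => (fst x, fst x + snd x))
        (fun x => g (fst x) * g (snd x))%R); auto.
      intros [a b] [a' b'] E. pose proof (f_equal fst E) as E1.
      pose proof (f_equal snd E) as E2. cbv beta iota delta [fst snd] in E1, E2.
      subst a'. f_equal. replace b with (a + b - a) by ring. rewrite E2; ring.
    + apply (summable_inj (fun x : C * C => (fst x + snd x, snd x))
        (fun x => g (fst x) * g (snd x))%R); auto.
      intros [a b] [a' b'] E. pose proof (f_equal fst E) as E1.
      pose proof (f_equal snd E) as E2. cbv beta iota delta [fst snd] in E1, E2.
      subst b'. f_equal. replace a with (a + b - b) by ring. rewrite E1; ring.
Qed.

(* Periodicity turns [P z / (z - v) ^ 3] into [P (z - v) / (z - v) ^ 3], so the product
   is a double series over [v] and [w]. Summed over [v] first, the contributions of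
   [w] and [- w] cancel for [w <> 0], again by periodicity. *)
Lemma P_S3 G z : summable_lattice G -> ~ G z -> Psum G z * Ssum G 3 z = Ssum G 5 z.
Proof.
  intros HG Hz. pose proof (proj1 HG) as HS. pose proof (dterm_abs G z HG Hz) as HA.
  pose proof (abs_summable_has_sum _ HA) as Hs. set (s := tsum (dterm G z)) in *.
  assert (E1 : s = Psum G z * Ssum G 3 z).
  { apply (has_sum_unique (fun v => Psum G z * (chi G v * / (z - v) ^ 3))).
    - apply (has_sum_section _ _ s Hs). intros v.
      destruct (classic (G v)) as [Hv|Hv].
      + eapply has_sum_ext with (fun w => (chi G v * / (z - v) ^ 3) *
          (chi G w * (/ (z - v - w) ^ 2 - / w ^ 2))).
        { intros w. unfold dterm; simpl fst; simpl snd. ring. }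
        rewrite (Cmult_comm (Psum G z)). apply has_sum_scal.
        rewrite <- (P_periodic G z (- v)) by (auto; apply sub_opp; auto).
        apply P_has_sum; auto.
      + eapply has_sum_ext with (fun w => RtoC 0).
        { intros w. unfold dterm; simpl fst. rewrite (chi_0 G v Hv). ring. }
        rewrite (chi_0 G v Hv). replace (Psum G z * (0 * / (z - v) ^ 3)) with (RtoC 0) by ring.
        apply has_sum_zero.
    - apply has_sum_scal, S_has_sum; auto. }
  set (D := fun x : C * C => dterm G z (snd x, fst x)).
  assert (HD : has_sum D s).
  { apply (has_sum_reindex (fun x : C * C => (snd x, fst x)) (dterm G z)); auto.
    - intros [a b] [a' b']; simpl; congruence.
    - intros [a b] _. exists (b, a); auto. }
  assert (DA : abs_summable D).
  { apply (summable_inj (fun x : C * C => (snd x, fst x)) (fun x => Cmod (dterm G z x))); auto.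
    intros [a b] [a' b']; simpl; congruence. }
  set (r := fun w => tsum (fun v => D (w, v))).
  assert (Hr : forall w, has_sum (fun v => D (w, v)) (r w)).
  { intros w. apply abs_summable_has_sum.
    apply (summable_section (fun x => Cmod (D x)) w); auto. }
  pose proof (has_sum_section D r s HD Hr) as HR.
  assert (R2 : has_sum (fun w => r w + r (- w)) (s + s)).
  { apply has_sum_plus; auto.
    eapply has_sum_ext; [|exact (proj1 (has_sum_reflect _ 0 _) HR)].
    intros w; cbv beta. f_equal. ring. }
  assert (r0 : r 0 = Ssum G 5 z).
  { apply (has_sum_unique (fun v => D (RtoC 0, v))); auto.
    eapply has_sum_ext; [|apply (S_has_sum G 5 z); auto; lia].
    intros v; unfold D, dterm; simpl fst; simpl snd. rewrite (chi_1 G 0) by apply HS.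
    replace (z - v - 0) with (z - v) by ring.
    rewrite (Cinv_pow 0 2), Cinv_0, !Cinv_pow. ring. }
  assert (rw : forall w : C, w <> 0 -> r w + r (- w) = 0).
  { intros w Hw0. destruct (classic (G w)) as [Hw|Hw].
    (* The sum for [- w] is shifted by [v -> v + w], so that both terms have their poles where
       [z - v] or [z - v - w] vanishes. The poles of order three cancel, and what remains is the
       general term of a difference of two values of [P]. *)
    - assert (H1 : has_sum (fun v => chi G v * ((/ (z - v) ^ 2 - / (z - v - w) ^ 2) * / w ^ 3))
         (r w + r (- w))).
      { eapply has_sum_ext; [|apply has_sum_plus;
          [apply Hr|exact (proj1 (has_sum_shift _ w _) (Hr (- w)))]].
        intros v. unfold D, dterm; simpl fst; simpl snd.
        rewrite chi_opp, chi_shift, (chi_1 G w) by auto.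
        destruct (classic (G v)) as [Hv|Hv]; [|rewrite (chi_0 G v Hv); ring].
        assert (Np : z - v <> 0) by (intros E; apply Hz; rewrite (sub_eq_0 _ _ E); auto).
        assert (Nq : z - v - w <> 0).
        { intros E; apply Hz. replace z with (v + w); [apply sub_plus; auto|].
          apply eq_sym, sub_eq_0. rewrite <- E. ring. }
        rewrite (chi_1 G v Hv).
        replace (z - (v + w) - - w) with (z - v) by ring.
        replace (z - (v + w)) with (z - v - w) by ring.
        set (p := z - v) in *.
        field. repeat split; auto. }
      assert (H2 : has_sum (fun v => chi G v * ((/ (z - v) ^ 2 - / (z - v - w) ^ 2) * / w ^ 3))
         (/ w ^ 3 * (Psum G z - Psum G (z + - w)))).
      { eapply has_sum_ext; [|apply has_sum_scal, has_sum_minus;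
          [apply (P_has_sum G z)|apply (P_has_sum G (z + - w))]; auto].
        intros v; cbv beta. replace (z + - w - v) with (z - v - w) by ring. ring. }
      rewrite (has_sum_unique _ _ _ H1 H2), P_periodic by (auto; apply sub_opp; auto). ring.
    - assert (Z : forall w, ~ G w -> r w = 0).
      { clear - Hr. intros w Hw. apply (has_sum_unique (fun v => D (w, v))); auto.
        eapply has_sum_ext; [|apply has_sum_zero].
        intros v. unfold D, dterm; simpl. rewrite (chi_0 G w Hw). ring. }
      rewrite !Z; auto; [ring|]. intros Hn. apply Hw.
      replace w with (- - w) by ring. apply sub_opp; auto. }
  assert (E2 : s + s = Ssum G 5 z + Ssum G 5 z).
  { apply (has_sum_unique (fun w => r w + r (- w))); auto.
    replace (Ssum G 5 z + Ssum G 5 z) with (r 0 + r (- 0))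
      by (rewrite Copp_0, r0; auto).
    apply (has_sum_single (RtoC 0) (fun w => r w + r (- w))); auto. }
  rewrite <- E1. replace s with ((s + s) / 2) by field. rewrite E2. field.
Qed.

(** * Derivatives *)

(** A complex derivative with a quadratic remainder: such remainders can be added up over a series
    directly, without exchanging limits. *)
Definition qderiv (f : C -> C) (z l : C) : Prop :=
  exists K d : R, (0 <= K)%R /\ (0 < d)%R /\
    forall h, (Cmod h < d)%R -> (Cmod (f (z + h)%C - f z - h * l) <= K * Cmod h ^ 2)%R.

Lemma qderiv_ext f g z l : (forall x, f x = g x) -> qderiv f z l -> qderiv g z l.
Proof.
  intros E [K [d [HK [Hd H]]]]. exists K, d. repeat split; auto.
  intros h Hh. rewrite <- !E; auto.
Qed.

Lemma qderiv_const c z : qderiv (fun _ => c) z 0.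
Proof.
  exists 0%R, 1%R. repeat split; try lra. intros h _.
  replace (c - c - h * 0) with (RtoC 0) by ring. rewrite Cmod_0; lra.
Qed.

Lemma qderiv_plus f g z l m :
  qderiv f z l -> qderiv g z m -> qderiv (fun x => f x + g x) z (l + m).
Proof.
  intros [K [d [HK [Hd H]]]] [K' [d' [HK' [Hd' H']]]].
  exists (K + K')%R, (Rmin d d'). repeat split; [lra|apply Rmin_glb_lt; auto|].
  intros h Hh. pose proof (Rmin_l d d'). pose proof (Rmin_r d d').
  specialize (H h ltac:(lra)). specialize (H' h ltac:(lra)).
  replace (f (z + h)%C + g (z + h)%C - (f z + g z) - h * (l + m)) with
    ((f (z + h)%C - f z - h * l) + (g (z + h)%C - g z - h * m)) by ring.
  eapply Rle_trans; [apply Cmod_triangle|]. lra.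
Qed.

Lemma qderiv_lip f z l : qderiv f z l ->
  exists K d : R, (0 <= K)%R /\ (0 < d)%R /\
    forall h, (Cmod h < d)%R -> (Cmod (f (z + h)%C - f z) <= K * Cmod h)%R.
Proof.
  intros [K [d [HK [Hd H]]]]. exists (K * d + Cmod l)%R, d.
  pose proof (Cmod_ge_0 l). repeat split; auto; [nra|].
  intros h Hh. specialize (H h Hh). pose proof (Cmod_ge_0 h).
  replace (f (z + h)%C - f z) with ((f (z + h)%C - f z - h * l) + h * l) by ring.
  eapply Rle_trans; [apply Cmod_triangle|]. rewrite Cmod_mult.
  assert (Cmod h ^ 2 <= d * Cmod h)%R by nra. nra.
Qed.

Lemma qderiv_mult f g z l m :
  qderiv f z l -> qderiv g z m ->
  qderiv (fun x => f x * g x) z (l * g z + f z * m).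
Proof.
  intros Hf Hg. destruct (qderiv_lip _ _ _ Hf) as [L [e [HL [He Lf]]]].
  destruct (qderiv_lip _ _ _ Hg) as [L' [e' [HL' [He' Lg]]]].
  destruct Hf as [K [d [HK [Hd H]]]]. destruct Hg as [K' [d' [HK' [Hd' H']]]].
  exists (K * Cmod (g z) + Cmod (f z) * K' + L * L')%R, (Rmin (Rmin d d') (Rmin e e')).
  pose proof (Cmod_ge_0 (f z)). pose proof (Cmod_ge_0 (g z)).
  repeat split; [nra|repeat apply Rmin_glb_lt; auto|].
  intros h Hh. apply Rmin_Rgt in Hh as [Hh1 Hh2].
  apply Rmin_Rgt in Hh1 as [? ?]. apply Rmin_Rgt in Hh2 as [? ?].
  specialize (H h ltac:(lra)). specialize (H' h ltac:(lra)).
  specialize (Lf h ltac:(lra)). specialize (Lg h ltac:(lra)).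
  replace (f (z + h)%C * g (z + h)%C - f z * g z - h * (l * g z + f z * m)) with
    ((f (z + h)%C - f z - h * l) * g z + f z * (g (z + h)%C - g z - h * m)
     + (f (z + h)%C - f z) * (g (z + h)%C - g z)) by ring.
  pose proof (Cmod_ge_0 h).
  eapply Rle_trans; [apply Cmod_triangle|].
  eapply Rle_trans; [apply Rplus_le_compat_r, Cmod_triangle|]. rewrite !Cmod_mult.
  assert (Cmod (f (z + h)%C - f z - h * l) * Cmod (g z) <= K * Cmod h ^ 2 * Cmod (g z))%R
    by (apply Rmult_le_compat_r; auto).
  assert (Cmod (f z) * Cmod (g (z + h)%C - g z - h * m) <= Cmod (f z) * (K' * Cmod h ^ 2))%R
    by (apply Rmult_le_compat_l; auto).
  assert (Cmod (f (z + h)%C - f z) * Cmod (g (z + h)%C - g z) <= (L * Cmod h) * (L' * Cmod h))%R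
    by (apply Rmult_le_compat; auto; apply Cmod_ge_0).
  nra.
Qed.

Lemma qderiv_scal c f z l : qderiv f z l -> qderiv (fun x => c * f x) z (c * l).
Proof.
  intros H. replace (c * l) with (0 * f z + c * l) by ring.
  apply (qderiv_mult (fun _ => c) f); auto. apply qderiv_const.
Qed.

Lemma qderiv_unique f g z l m : qderiv f z l -> qderiv g z m ->
  (exists d, (0 < d)%R /\ forall h, (Cmod h < d)%R -> f (z + h)%C = g (z + h)%C) -> l = m.
Proof.
  intros [K [d [HK [Hd H]]]] [K' [d' [HK' [Hd' H']]]] [e [He E]].
  apply NNPP; intros Hn.
  assert (P : (0 < Cmod (l - m))%R).
  { apply Cmod_gt_0. intros E0. apply Hn, sub_eq_0; auto. }
  set (x := Rmin (Rmin d d') (Rmin e (Cmod (l - m) / (K + K' + 1)))).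
  assert (Hx : (0 < x)%R).
  { unfold x. repeat apply Rmin_glb_lt; auto. apply Rdiv_lt_0_compat; lra. }
  assert (Hx1 : (x / 2 < x)%R) by lra.
  apply Rmin_Rgt in Hx1 as [Hx1 Hx2]. apply Rmin_Rgt in Hx1 as [? ?].
  apply Rmin_Rgt in Hx2 as [? Hx2].
  assert (Cm : Cmod (RtoC (x / 2)) = (x / 2)%R) by (rewrite Cmod_R, Rabs_pos_eq; lra).
  specialize (H (RtoC (x / 2)) ltac:(lra)). specialize (H' (RtoC (x / 2)) ltac:(lra)).
  rewrite <- E in H' by lra.
  assert (E0 : f z = g z).
  { specialize (E 0). rewrite Cmod_0, Cplus_0_r in E. auto. }
  rewrite <- E0 in H'.
  assert (B : (Cmod (RtoC (x / 2) * (l - m)) <= (K + K') * (x / 2) ^ 2)%R).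
  { replace (RtoC (x / 2) * (l - m)) with
      (- (f (z + RtoC (x / 2))%C - f z - RtoC (x / 2) * l)
       + (f (z + RtoC (x / 2))%C - f z - RtoC (x / 2) * m)) by ring.
    eapply Rle_trans; [apply Cmod_triangle|]. rewrite Cmod_opp. rewrite Cm in *. lra. }
  rewrite Cmod_mult, Cm in B.
  assert (B2 : (Cmod (l - m) <= (K + K') * (x / 2))%R).
  { apply Rmult_le_reg_l with (x / 2)%R; [lra|]. lra. }
  apply Rlt_gt in Hx2. apply Rgt_lt in Hx2. apply Rlt_div_r in Hx2; [|lra]. nra.
Qed.

Fixpoint rem_const (k : nat) : R :=
  match k with O => 0%R | S j => (2 * rem_const j + 2 * INR (S j))%R end.

Lemma rem_const_pos k : (0 <= rem_const k)%R.
Proof. induction k; [simpl; lra|]. cbn [rem_const]. pose proof (pos_INR (S k)). lra. Qed.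

(** With [x = / (p + h)] and [y = / p] one has [x - y = - h x y], which gives a recursion in [k] for
    the remainder. [rem_const] records its constants; their factor 2 comes from
    [Cmod x <= 2 * Cmod y]. *)
Lemma inv_pow_remainder (p h : C) k :
  p <> 0 -> (Cmod h <= Cmod p / 2)%R ->
  (Cmod (/ (p + h) ^ k - / p ^ k + INR k * h * / p ^ S k)
   <= rem_const k * Cmod h ^ 2 * Cmod (/ p) ^ S (S k))%R.
Proof.
  intros Hp Hh. pose proof (proj1 (Cmod_gt_0 p) Hp) as Pp.
  assert (Lq : (Cmod p / 2 <= Cmod (p + h))%R).
  { assert (Cmod p <= Cmod (p + h) + Cmod h)%R; [|lra].
    replace p with (p + h + - h) at 1 by ring.
    eapply Rle_trans; [apply Cmod_triangle|]. rewrite Cmod_opp; lra. }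
  assert (Hq : p + h <> 0) by (apply Cmod_gt_0; lra).
  set (x := / (p + h)). set (y := / p).
  assert (Hx : (Cmod x <= 2 * Cmod y)%R).
  { unfold x, y. rewrite !Cmod_inv by auto.
    replace (2 * / Cmod p)%R with (/ (Cmod p / 2))%R by (field; lra).
    apply Rinv_le_contravar; lra. }
  assert (Exy : x - y = - (h * x * y)) by (unfold x, y; field; auto).
  rewrite !Cinv_pow. fold x y.
  pose proof (Cmod_ge_0 h). pose proof (Cmod_ge_0 x). pose proof (Cmod_ge_0 y).
  induction k.
  - simpl INR. simpl rem_const. simpl Cpow.
    replace (1 - 1 + 0 * h * (y * 1)) with (RtoC 0) by ring. rewrite Cmod_0. lra.
  - assert (E : x ^ S k - y ^ S k + INR (S k) * h * y ^ S (S k) =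
       x * (x ^ k - y ^ k + INR k * h * y ^ S k) + INR (S k) * h ^ 2 * x * y ^ S (S k)).
    { rewrite S_INR, RtoC_plus. simpl Cpow.
      match goal with |- ?l = ?r => replace l with
        (r + (x - (y - h * x * y)) * (y ^ k * (1 - (INR k + 1) * h * y))) by ring end.
      replace (x - (y - h * x * y)) with ((x - y) + h * x * y) by ring.
      rewrite Exy. ring. }
    rewrite E. eapply Rle_trans; [apply Cmod_triangle|]. rewrite !Cmod_mult, !Cmod_pow.
    rewrite Cmod_R, Rabs_pos_eq by apply pos_INR.
    cbn [rem_const].
    assert (B1 : (Cmod x * Cmod (x ^ k - y ^ k + INR k * h * y ^ S k) <=
       (2 * Cmod y) * (rem_const k * Cmod h ^ 2 * Cmod y ^ S (S k)))%R).
    { apply Rmult_le_compat; auto. apply Cmod_ge_0. }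
    assert (B2 : (INR (S k) * Cmod h ^ 2 * Cmod x * Cmod y ^ S (S k) <=
       INR (S k) * Cmod h ^ 2 * (2 * Cmod y) * Cmod y ^ S (S k))%R).
    { apply Rmult_le_compat_r; [apply pow_le; auto|].
      apply Rmult_le_compat_l; auto.
      apply Rmult_le_pos; [apply pos_INR|apply pow_le; auto]. }
    replace (Cmod y ^ S (S (S k)))%R with (Cmod y * Cmod y ^ S (S k))%R by (simpl; ring).
    lra.
Qed.

(** * Expansions at the origin *)

(** Only increments are assumed to be sums, so that [k = 2] is covered: the series of
    [/ (z - u) ^ 2] does not converge absolutely, but the series of its increments does, and these
    are the increments of [Psum]. *)
Lemma qderiv_of_sums G k (f : C -> C) z : summable_lattice G -> ~ G z -> (2 <= k)%nat ->
  (forall h, has_sum (fun u => chi G u * (/ (z + h - u) ^ k - / (z - u) ^ k))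
     (f (z + h) - f z)) ->
  qderiv f z (- INR k * Ssum G (S k) z).
Proof.
  intros HG Hz Hk Hf. destruct (slat_dist G z HG) as [c [Hc H]].
  destruct (proj2 (proj2 HG)) as [_ [M HM]].
  pose proof (rem_const_pos k) as Hrc.
  assert (Hck : (0 < / c ^ S (S k))%R) by (apply Rinv_0_lt_compat, pow_lt; auto).
  assert (HM0 : (0 <= M)%R) by (apply (HM nil); constructor).
  exists (rem_const k * / c ^ S (S k) * M)%R, (c / 2)%R. repeat split; [|lra|].
  { apply Rmult_le_pos; auto. apply Rmult_le_pos; lra. }
  intros h Hh.
  assert (HS : has_sum (fun u => chi G u * (/ (z + h - u) ^ k - / (z - u) ^ k
       + INR k * h * / (z - u) ^ S k)) (f (z + h) - f z - h * (- INR k * Ssum G (S k) z))).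
  { replace (f (z + h) - f z - h * (- INR k * Ssum G (S k) z)) with
      (f (z + h) - f z + INR k * h * Ssum G (S k) z) by ring.
    eapply has_sum_ext; [|apply has_sum_plus; [apply Hf|apply has_sum_scal,
      (S_has_sum G (S k) z); auto; lia]].
    intros u; cbv beta. ring. }
  set (K := (rem_const k * / c ^ S (S k) * Cmod h ^ 2)%R).
  assert (HK : (0 <= K)%R).
  { unfold K. apply Rmult_le_pos; [apply Rmult_le_pos; lra|apply pow_le, Cmod_ge_0]. }
  replace (rem_const k * / c ^ S (S k) * M * Cmod h ^ 2)%R with (K * M)%R
    by (unfold K; ring).
  apply (has_sum_bound _ (fun u => K * (chiR G u * wt u))%R _ _ HS).
  - intros u. rewrite Cmod_mult, Cmod_chi.
    destruct (classic (G u)) as [Hu|Hu]; [|rewrite (chiR_0 G u Hu); lra].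
    rewrite (chiR_1 G u Hu), !Rmult_1_l.
    assert (Hn : u <> z) by (intros ->; auto).
    specialize (H u Hu Hn). pose proof (Cmod_ge_0 u).
    assert (c <= Cmod (z - u))%R by nra.
    replace (z + h - u) with (z - u + h) by ring.
    eapply Rle_trans; [apply inv_pow_remainder|].
    + intros E. apply Hn, eq_sym, sub_eq_0; auto.
    + lra.
    + rewrite <- (Cmod_pow (/ (z - u))), <- Cinv_pow. unfold K.
      replace (rem_const k * / c ^ S (S k) * Cmod h ^ 2 * wt u)%R with
        (rem_const k * Cmod h ^ 2 * (/ c ^ S (S k) * wt u))%R by ring.
      apply Rmult_le_compat_l.
      * apply Rmult_le_pos; auto. apply pow_le, Cmod_ge_0.
      * apply pow_inv_wt; auto. lia.
  - intros l Hl. rewrite rsum_scal. apply Rmult_le_compat_l; auto.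
Qed.

Lemma S_qderiv G k z : summable_lattice G -> ~ G z -> (3 <= k)%nat ->
  qderiv (Ssum G k) z (- INR k * Ssum G (S k) z).
Proof.
  intros HG Hz Hk. apply qderiv_of_sums; auto; [lia|]. intros h.
  eapply has_sum_ext; [|apply has_sum_minus; [apply (S_has_sum G k (z + h))|
    apply (S_has_sum G k z)]; auto].
  intros u; cbv beta; ring.
Qed.

Lemma P_qderiv G z : summable_lattice G -> ~ G z -> qderiv (Psum G) z (- (2) * Ssum G 3 z).
Proof.
  intros HG Hz. replace (- (2)) with (- INR 2) by (simpl INR; rewrite RtoC_plus; ring).
  apply qderiv_of_sums; auto. intros h.
  eapply has_sum_ext; [|apply has_sum_minus; [apply (P_has_sum G (z + h))|
    apply (P_has_sum G z)]; auto].
  intros u; cbv beta; ring.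
Qed.

(** * Complex functions of a real variable *)

Definition cderiv (f : R -> C) (t : R) (l : C) : Prop :=
  is_derive (fun s => Re (f s)) t (Re l) /\ is_derive (fun s => Im (f s)) t (Im l).

Lemma is_derive_quadratic (f : R -> R) (t l K d : R) :
  (0 <= K)%R -> (0 < d)%R ->
  (forall s, (Rabs s < d)%R -> (Rabs (f (t + s) - f t - s * l) <= K * s ^ 2)%R) ->
  is_derive f t l.
Proof.
  intros HK Hd H. apply is_derive_Reals. intros eps He.
  assert (Hm : (0 < Rmin d (eps / (K + 1)))%R).
  { apply Rmin_glb_lt; auto. apply Rdiv_lt_0_compat; lra. }
  exists (mkposreal _ Hm). intros h Hh0 Hh. simpl in Hh.
  apply Rmin_Rgt in Hh as [H1 H2].
  specialize (H h H1).
  replace ((f (t + h) - f t) / h - l)%R with ((f (t + h) - f t - h * l) / h)%R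
    by (field; auto).
  unfold Rdiv. rewrite Rabs_mult, Rabs_inv.
  pose proof (Rabs_pos_lt h Hh0) as Ph.
  apply Rmult_lt_reg_r with (Rabs h); auto.
  rewrite Rmult_assoc, Rinv_l, Rmult_1_r by lra.
  rewrite <- (pow2_abs h) in H. apply Rgt_lt, Rlt_div_r in H2; [|lra]. nra.
Qed.

Lemma qderiv_line f (a b l : C) (t : R) :
  qderiv f (a + t * b) l -> cderiv (fun s => f (a + s * b)) t (b * l).
Proof.
  intros [K [d [HK [Hd H]]]]. pose proof (Cmod_ge_0 b) as Hb.
  assert (Hd' : (0 < d / (Cmod b + 1))%R) by (apply Rdiv_lt_0_compat; lra).
  assert (B : forall s : R, (Rabs s < d / (Cmod b + 1))%R ->
    (Cmod (f (a + (t + s)%R * b)%C - f (a + t * b)%C - s * (b * l)) <=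
     K * Cmod b ^ 2 * s ^ 2)%R).
  { intros s Hs. specialize (H (s * b)).
    rewrite Cmod_mult, Cmod_R in H.
    apply Rlt_div_r in Hs; [|lra]. pose proof (Rabs_pos s).
    specialize (H ltac:(nra)). rewrite Rpow_mult_distr, pow2_abs in H.
    rewrite RtoC_plus. replace (a + (t + s) * b) with (a + t * b + s * b) by ring.
    replace (s * (b * l)) with (s * b * l) by ring. lra. }
  assert (HK' : (0 <= K * Cmod b ^ 2)%R) by (apply Rmult_le_pos; auto; apply pow_le; auto).
  assert (ReS : forall (s : R) (x y z : C), Re (x - y - s * z) = (Re x - Re y - s * Re z)%R).
  { intros s [x1 x2] [y1 y2] [z1 z2]; simpl; ring. }
  assert (ImS : forall (s : R) (x y z : C), Im (x - y - s * z) = (Im x - Im y - s * Im z)%R).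
  { intros s [x1 x2] [y1 y2] [z1 z2]; simpl; ring. }
  split; apply is_derive_quadratic with (K * Cmod b ^ 2)%R (d / (Cmod b + 1))%R; auto;
    intros s Hs; specialize (B s Hs).
  - rewrite <- ReS. eapply Rle_trans; [apply re_le_Cmod|auto].
  - rewrite <- ImS. eapply Rle_trans; [apply im_le_Cmod|auto].
Qed.

Lemma cderiv_0_const (f : R -> C) : (forall t, 0 <= t <= 1 -> cderiv f t 0)%R ->
  f 0%R = f 1%R.
Proof.
  intros H.
  assert (Re (f 0%R) = Re (f 1%R)).
  { apply (eq_is_derive (fun s => Re (f s))); [|lra]. intros t Ht. apply H; auto. }
  assert (Im (f 0%R) = Im (f 1%R)).
  { apply (eq_is_derive (fun s => Im (f s))); [|lra]. intros t Ht. apply H; auto. }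
  destruct (f 0%R), (f 1%R); simpl in *; congruence.
Qed.

Lemma qderiv_0_segment f a b :
  (forall t : R, (0 <= t <= 1)%R -> qderiv f (a + t * b) 0) -> f a = f (a + b).
Proof.
  intros H.
  replace (f a) with (f (a + 0%R * b)) by (f_equal; ring).
  replace (f (a + b)) with (f (a + 1%R * b)) by (f_equal; ring).
  apply (cderiv_0_const (fun s : R => f (a + s * b))). intros t Ht.
  replace (RtoC 0) with (b * 0) by ring. apply qderiv_line. auto.
Qed.

Definition ode2 G z : C := Psum G z * Psum G z - Ssum G 4 z.

(** The derivative is [- 4 P S3 + 4 S5], so [P_S3] is precisely what makes it vanish. *)
Lemma ode2_qderiv G z : summable_lattice G -> ~ G z -> qderiv (ode2 G) z 0.
Proof.
  intros HG Hz.
  replace (RtoC 0) with ((- (2) * Ssum G 3 z) * Psum G z + Psum G z * (- (2) * Ssum G 3 z)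
     + (- (1)) * (- INR 4 * Ssum G 5 z)).
  - apply qderiv_ext with (fun x => Psum G x * Psum G x + (- (1)) * Ssum G 4 x).
    { intros x; unfold ode2; ring. }
    apply qderiv_plus.
    + apply qderiv_mult; apply P_qderiv; auto.
    + apply qderiv_scal, S_qderiv; auto.
  - rewrite <- (P_S3 G z) by auto.
    replace (INR 4) with 4%R by (simpl; ring). ring.
Qed.

(** * Orders of magnitude at the origin *)

Definition bigO (n : nat) (f : C -> C) : Prop :=
  exists K d : R, (0 <= K)%R /\ (0 < d <= 1)%R /\
    forall z, (0 < Cmod z < d)%R -> (Cmod (f z) <= K * Cmod z ^ n)%R.

Lemma bigO_plus n f g : bigO n f -> bigO n g -> bigO n (fun z => f z + g z).
Proof.
  intros [K [d [HK [Hd H]]]] [K' [d' [HK' [Hd' H']]]].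
  exists (K + K')%R, (Rmin d d'). pose proof (Rmin_l d d'). pose proof (Rmin_r d d').
  repeat split; [lra|apply Rmin_glb_lt; lra|lra|].
  intros z Hz. specialize (H z ltac:(lra)). specialize (H' z ltac:(lra)).
  eapply Rle_trans; [apply Cmod_triangle|]. lra.
Qed.

Lemma bigO_mult n m f g : bigO n f -> bigO m g -> bigO (n + m) (fun z => f z * g z).
Proof.
  intros [K [d [HK [Hd H]]]] [K' [d' [HK' [Hd' H']]]].
  exists (K * K')%R, (Rmin d d'). pose proof (Rmin_l d d'). pose proof (Rmin_r d d').
  repeat split; [nra|apply Rmin_glb_lt; lra|lra|].
  intros z Hz. specialize (H z ltac:(lra)). specialize (H' z ltac:(lra)).
  rewrite Cmod_mult, pow_add.
  replace (K * K' * (Cmod z ^ n * Cmod z ^ m))%R with ((K * Cmod z ^ n) * (K' * Cmod z ^ m))%R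
    by ring.
  apply Rmult_le_compat; auto; apply Cmod_ge_0.
Qed.

(** The bound [d <= 1] in [bigO] serves this comparison of powers. *)
Lemma bigO_le n m f : (n <= m)%nat -> bigO m f -> bigO n f.
Proof.
  intros Hnm [K [d [HK [Hd H]]]]. exists K, d. repeat split; auto; try lra.
  intros z Hz. eapply Rle_trans; [apply H; auto|]. apply Rmult_le_compat_l; auto.
  replace m with (n + (m - n))%nat by lia. rewrite pow_add.
  rewrite <- (Rmult_1_r (Cmod z ^ n)) at 2. apply Rmult_le_compat_l; [apply pow_le; lra|].
  rewrite <- (pow1 (m - n)). apply pow_incr; lra.
Qed.

Lemma bigO_const c : bigO 0 (fun _ => c).
Proof.
  exists (Cmod c), 1%R. pose proof (Cmod_ge_0 c). repeat split; try lra.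
  intros. simpl. lra.
Qed.

Lemma bigO_pow n : bigO n (fun z => z ^ n).
Proof.
  exists 1%R, 1%R. repeat split; try lra. intros. rewrite Cmod_pow. lra.
Qed.

Lemma bigO_ext n f g : (forall z : C, z <> 0 -> f z = g z) -> bigO n f -> bigO n g.
Proof.
  intros E [K [d [HK [Hd H]]]]. exists K, d. repeat split; auto; try lra.
  intros z Hz. rewrite <- E; auto. apply Cmod_gt_0; lra.
Qed.

Lemma bigO_scal n c f : bigO n f -> bigO n (fun z => c * f z).
Proof. intros H. apply (bigO_mult 0 n (fun _ => c) f); auto. apply bigO_const. Qed.

Lemma bigO_opp n f : bigO n f -> bigO n (fun z => - f z).
Proof.
  intros H. apply bigO_ext with (fun z => - (1) * f z); [intros; ring|].
  apply bigO_scal; auto.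
Qed.

Lemma bigO_0_mult n f g : bigO 0 f -> bigO n g -> bigO n (fun z => f z * g z).
Proof. intros; apply (bigO_mult 0 n); auto. Qed.

(* Coefficients of [1 / (1 - x) ^ k]. *)
Fixpoint gcoef (k n : nat) : R :=
  match k with
  | O => match n with O => 1%R | S _ => 0%R end
  | S k' => (fix c n := match n with O => 1%R | S n' => (c n' + gcoef k' n)%R end) n
  end.

Lemma gcoef_0 k : gcoef k 0 = 1%R.
Proof. destruct k; auto. Qed.

Lemma gcoef_S k n : gcoef (S k) (S n) = (gcoef (S k) n + gcoef k (S n))%R.
Proof. auto. Qed.

Lemma gcoef_pos k : forall n, (0 <= gcoef k n)%R.
Proof.
  induction k; intros n; [destruct n; simpl; lra|].
  induction n; [simpl; lra|]. rewrite gcoef_S. specialize (IHk (S n)). lra.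
Qed.

Lemma gcoef_1 n : gcoef 1 n = 1%R.
Proof. induction n; auto. rewrite gcoef_S, IHn. simpl. lra. Qed.

Lemma gcoef_2 n : gcoef 2 n = (INR n + 1)%R.
Proof. induction n; [simpl; lra|]. rewrite gcoef_S, IHn, gcoef_1, S_INR. lra. Qed.

Lemma gcoef_3 n : gcoef 3 n = ((INR n + 1) * (INR n + 2) / 2)%R.
Proof. induction n; [simpl; lra|]. rewrite gcoef_S, IHn, gcoef_2, S_INR. lra. Qed.

Lemma gcoef_4 n : gcoef 4 n = ((INR n + 1) * (INR n + 2) * (INR n + 3) / 6)%R.
Proof. induction n; [simpl; lra|]. rewrite gcoef_S, IHn, gcoef_3, S_INR. field. Qed.

Fixpoint gbound (k N : nat) : R :=
  match k with O => 0%R | S j => (2 * (gbound j N + gcoef (S j) N))%R end.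

Lemma gbound_pos k N : (0 <= gbound k N)%R.
Proof.
  induction k; cbn [gbound]; [lra|]. pose proof (gcoef_pos (S k) N). lra.
Qed.

Lemma csum_seq_S (f : nat -> C) N : csum f (seq 0 (S N)) = csum f (seq 0 N) + f N.
Proof. rewrite seq_S, csum_app. unfold csum at 2. simpl. ring. Qed.

(** Multiplication by [1 - x] telescopes, by the Pascal rule [gcoef_S], up to one boundary term.
    Induction on [k] then controls the remainder of [/ (1 - x) ^ k], with the constants [gbound]. *)
Lemma geometric_shift k N (x : C) :
  (1 - x) * csum (fun n => gcoef (S k) n * x ^ n) (seq 0 (S N)) =
  csum (fun n => gcoef k n * x ^ n) (seq 0 (S N)) - gcoef (S k) N * x ^ S N.
Proof.
  induction N.
  - unfold csum. simpl seq. simpl map. simpl Csum. rewrite !gcoef_0. simpl. ring.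
  - rewrite csum_seq_S, (csum_seq_S _ (S N)), Cmult_plus_distr_l, IHN, gcoef_S, RtoC_plus.
    simpl Cpow. ring.
Qed.

Lemma geometric_remainder k N (x : C) : (Cmod x <= 1 / 2)%R ->
  (Cmod (/ (1 - x) ^ k - csum (fun n => gcoef k n * x ^ n)%C (seq 0 (S N)))
   <= gbound k N * Cmod x ^ S N)%R.
Proof.
  intros Hx.
  assert (Hy : (1 / 2 <= Cmod (1 - x))%R).
  { assert (Cmod 1 <= Cmod (1 - x) + Cmod x)%R.
    { replace (RtoC 1) with (1 - x + x) at 1 by ring. apply Cmod_triangle. }
    rewrite Cmod_1 in H. lra. }
  assert (Hn : 1 - x <> 0) by (apply Cmod_gt_0; lra).
  induction k.
  - replace (csum _ _) with (RtoC 1).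
    + simpl Cpow. replace (/ 1 - 1) with (RtoC 0) by field. rewrite Cmod_0. simpl; lra.
    + clear. induction N.
      * unfold csum; simpl. ring.
      * rewrite csum_seq_S, <- IHN. simpl. ring.
  - set (D := / (1 - x) ^ k - csum (fun n => gcoef k n * x ^ n) (seq 0 (S N))) in *.
    assert (E : / (1 - x) ^ S k - csum (fun n => gcoef (S k) n * x ^ n) (seq 0 (S N)) =
       / (1 - x) * (D + gcoef (S k) N * x ^ S N)).
    { assert (E1 := geometric_shift k N x).
      assert (E2 : csum (fun n => gcoef (S k) n * x ^ n) (seq 0 (S N)) =
         / (1 - x) * (csum (fun n => gcoef k n * x ^ n) (seq 0 (S N)) - gcoef (S k) N * x ^ S N)).
      { rewrite <- E1. field; auto. }
      rewrite E2. unfold D. simpl Cpow. rewrite !Cinv_pow.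
      replace (/ ((1 - x) * (1 - x) ^ k)) with (/ (1 - x) * (/ (1 - x)) ^ k).
      - ring.
      - rewrite <- Cinv_pow. field. split; [apply Cpow_nz|]; auto. }
    rewrite E, Cmod_mult, Cmod_inv by auto.
    assert (I : (/ Cmod (1 - x) <= 2)%R).
    { replace 2%R with (/ (1 / 2))%R by field. apply Rinv_le_contravar; lra. }
    assert (B : (Cmod (D + gcoef (S k) N * x ^ S N) <= (gbound k N + gcoef (S k) N) * Cmod x ^ S N)%R).
    { eapply Rle_trans; [apply Cmod_triangle|].
      rewrite Cmod_mult, Cmod_R, Cmod_pow, Rabs_pos_eq by apply gcoef_pos. lra. }
    cbn [gbound]. rewrite Rmult_assoc. apply Rmult_le_compat; auto.
    + left. apply Rinv_0_lt_compat. lra.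
    + apply Cmod_ge_0.
Qed.

(** * The differential equations *)

Lemma has_sum_csum {A T : Type} (f : A -> T -> C) (e : A -> C) (l : list A) :
  (forall a, In a l -> has_sum (f a) (e a)) ->
  has_sum (fun x => csum (fun a => f a x) l) (csum e l).
Proof.
  induction l; intros H.
  - apply has_sum_zero.
  - unfold csum; simpl. apply has_sum_plus; [apply H; left; auto|].
    apply IHl. intros; apply H; right; auto.
Qed.

Lemma Cmod_m1_pow k : Cmod ((- (1)) ^ k) = 1%R.
Proof. rewrite Cmod_pow, Cmod_m1. apply pow1. Qed.

Lemma inv_sub_pow_remainder (z u : C) k N : u <> 0 -> (Cmod z <= Cmod u / 2)%R ->
  (Cmod (/ (z - u) ^ k - csum (fun n => (- (1)) ^ k * gcoef k n * z ^ n * / u ^ (n + k))%C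
      (seq 0 (S N)))
   <= gbound k N * Cmod z ^ S N * Cmod (/ u) ^ (S N + k))%R.
Proof.
  intros Hu Hz. pose proof (proj1 (Cmod_gt_0 u) Hu) as Pu.
  set (x := z * / u).
  assert (Hx : (Cmod x = Cmod z * Cmod (/ u))%R) by apply Cmod_mult.
  assert (Hx2 : (Cmod x <= 1 / 2)%R).
  { rewrite Hx, Cmod_inv by auto. apply Rmult_le_reg_r with (Cmod u); auto.
    field_simplify; lra. }
  pose proof (geometric_remainder k N x Hx2) as H.
  assert (Hn : 1 - x <> 0).
  { intros E. apply sub_eq_0 in E. rewrite <- E, Cmod_1 in Hx2. lra. }
  replace (/ (z - u) ^ k - csum (fun n => (- (1)) ^ k * gcoef k n * z ^ n * / u ^ (n + k))
      (seq 0 (S N)))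
    with ((- (1)) ^ k * (/ u) ^ k *
      (/ (1 - x) ^ k - csum (fun n => gcoef k n * x ^ n) (seq 0 (S N)))).
  - rewrite !Cmod_mult, Cmod_m1_pow, Cmod_pow.
    rewrite Hx, Rpow_mult_distr in H.
    rewrite pow_add.
    replace (gbound k N * Cmod z ^ S N * (Cmod (/ u) ^ S N * Cmod (/ u) ^ k))%R with
      (1 * Cmod (/ u) ^ k * (gbound k N * (Cmod z ^ S N * Cmod (/ u) ^ S N)))%R by ring.
    apply Rmult_le_compat_l; auto.
    rewrite Rmult_1_l. apply pow_le, Cmod_ge_0.
  - assert (E1 : (- (1)) ^ k * (/ u) ^ k * / (1 - x) ^ k = / (z - u) ^ k).
    { rewrite !Cinv_pow, <- !Cpow_mult_l. f_equal. unfold x.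
      assert (Huz : u - z <> 0).
      { intros E; apply Hn. unfold x.
        replace (1 - z * / u) with ((u - z) * / u) by (field; auto). rewrite E; ring. }
      field. repeat split; auto. intros E; apply Huz.
      replace (u - z) with (- (z - u)) by ring. rewrite E; ring. }
    assert (E2 : (- (1)) ^ k * (/ u) ^ k * csum (fun n => gcoef k n * x ^ n) (seq 0 (S N)) =
       csum (fun n => (- (1)) ^ k * gcoef k n * z ^ n * / u ^ (n + k)) (seq 0 (S N))).
    { rewrite <- csum_scal. apply csum_ext_in. intros n _.
      rewrite Cpow_add_r. unfold x.
      replace (/ (u ^ n * u ^ k)) with ((/ u) ^ n * (/ u) ^ k).
      - rewrite Cpow_mult_l. ring.
      - rewrite <- !Cinv_pow. field. split; apply Cpow_nz; auto. }
    rewrite <- E1, <- E2. ring.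
Qed.

(** [n0] counts the Taylor terms already subtracted inside the series: 1 for [Psum], 0 for [Ssum].
    The index [u = 0] supplies [/ z ^ k]. Of the [N + k' + 3] factors [/ u] in the remainder, three
    are kept for the convergent sum bounded by [M], and the others are bounded by [/ rho]. *)
Lemma taylor G k' n0 N s z rho M : summable_lattice G -> (1 <= k' + n0)%nat -> (n0 <= S N)%nat ->
  (0 < rho)%R -> (forall u, G u -> u <> 0 -> (rho <= Cmod u)%R) ->
  bounded_sums (fun u => chiR G u * Cmod (/ u ^ 3))%R M -> (Cmod z <= rho / 2)%R ->
  let k := S (S k') in
  has_sum (fun u => chi G u * (/ (z - u) ^ k -
     csum (fun n => (- (1)) ^ k * gcoef k n * z ^ n * / u ^ (n + k)) (seq 0 n0))) s ->
  (Cmod (s - / z ^ k - csum (fun n => (- (1)) ^ k * gcoef k n * z ^ n * Esum G (n + k))%C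
      (seq n0 (S N - n0)))
   <= gbound k N * Cmod z ^ S N * (/ rho) ^ (N + k') * M)%R.
Proof.
  intros HG Hk Hn0 Hrho Hmin HM Hz k Hs.
  set (K := (gbound k N * Cmod z ^ S N * (/ rho) ^ (N + k'))%R).
  assert (Hr : (0 < / rho)%R) by (apply Rinv_0_lt_compat; auto).
  assert (HK : (0 <= K)%R).
  { unfold K. apply Rmult_le_pos; [apply Rmult_le_pos|].
    - apply gbound_pos.
    - apply pow_le, Cmod_ge_0.
    - apply pow_le; lra. }
  assert (HS : has_sum (fun u => chi G u * (/ (z - u) ^ k -
     csum (fun n => (- (1)) ^ k * gcoef k n * z ^ n * / u ^ (n + k)) (seq 0 (S N)))
       - (if eq_em u (RtoC 0) then / z ^ k else 0))
     (s - / z ^ k - csum (fun n => (- (1)) ^ k * gcoef k n * z ^ n * Esum G (n + k))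
      (seq n0 (S N - n0)))).
  { replace (s - / z ^ k - csum (fun n => (- (1)) ^ k * gcoef k n * z ^ n * Esum G (n + k))
      (seq n0 (S N - n0))) with
     (s - csum (fun n => (- (1)) ^ k * gcoef k n * z ^ n * Esum G (n + k))
      (seq n0 (S N - n0)) - / z ^ k) by ring.
    apply has_sum_minus.
    - eapply has_sum_ext; [|apply has_sum_minus; [apply Hs|
       apply (has_sum_csum (fun n u => (- (1)) ^ k * gcoef k n * z ^ n * (chi G u * / u ^ (n + k))))]].
      + intros u; cbv beta.
        replace (seq 0 (S N)) with (seq 0 n0 ++ seq n0 (S N - n0)).
        * rewrite csum_app.
          replace (csum (fun a => (- (1)) ^ k * gcoef k a * z ^ a * (chi G u * / u ^ (a + k)))
             (seq n0 (S N - n0))) with (chi G u *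
             csum (fun n => (- (1)) ^ k * gcoef k n * z ^ n * / u ^ (n + k)) (seq n0 (S N - n0))).
          -- ring.
          -- rewrite <- csum_scal. apply csum_ext_in. intros; ring.
        * change n0 with (0 + n0)%nat at 2. rewrite <- seq_app. f_equal. lia.
      + intros n Hn. apply in_seq in Hn. apply has_sum_scal, E_has_sum; auto. unfold k. lia.
    - pose proof (has_sum_single (RtoC 0) (fun u => if eq_em u (RtoC 0) then / z ^ k else 0)) as H1.
      cbv beta in H1. destruct (eq_em (RtoC 0) (RtoC 0)) as [_|]; [|easy].
      apply H1. intros x Hx. destruct eq_em; easy. }
  apply (has_sum_bound _ (fun u => K * (chiR G u * Cmod (/ u ^ 3)))%R _ _ HS).
  - intros u. cbv beta.
    assert (T0 : (0 <= K * (chiR G u * Cmod (/ u ^ 3)))%R).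
    { apply Rmult_le_pos; auto. apply Rmult_le_pos; [apply chiR_bounds|apply Cmod_ge_0]. }
    destruct (eq_em u (RtoC 0)) as [->|Hu].
    + rewrite (chi_1 G) by apply (proj1 HG).
      rewrite (csum_zero _ (seq 0 (S N))).
      * replace (z - 0) with z by ring.
        replace (1 * (/ z ^ k - 0) - / z ^ k) with (RtoC 0) by ring. rewrite Cmod_0; auto.
      * intros n _. rewrite Cinv_pow, Cinv_0. unfold k. rewrite <- plus_n_Sm. simpl. ring.
    + unfold Cminus at 1. rewrite Copp_0, Cplus_0_r.
      rewrite Cmod_mult, Cmod_chi.
      destruct (classic (G u)) as [HGu|HGu]; [|rewrite (chiR_0 G u HGu); lra].
      rewrite (chiR_1 G u HGu), !Rmult_1_l. specialize (Hmin u HGu Hu).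
      eapply Rle_trans; [apply inv_sub_pow_remainder; auto; lra|].
      unfold K. rewrite Rmult_assoc. rewrite (Rmult_assoc (gbound k N * Cmod z ^ S N)).
      rewrite <- Rmult_assoc.
      apply Rmult_le_compat_l.
      { apply Rmult_le_pos; [apply gbound_pos|apply pow_le, Cmod_ge_0]. }
      rewrite Cinv_pow, Cmod_pow.
      replace (S N + k)%nat with (N + k' + 3)%nat by (unfold k; lia).
      rewrite pow_add. apply Rmult_le_compat_r; [apply pow_le, Cmod_ge_0|].
      apply pow_incr. split; [apply Cmod_ge_0|]. apply Cmod_inv_le; auto.
  - intros l Hl. rewrite rsum_scal. apply Rmult_le_compat_l; auto.
Qed.

Lemma taylor_data G : summable_lattice G -> exists rho M,
  (0 < rho)%R /\ (forall u, G u -> u <> 0 -> (rho <= Cmod u)%R) /\ (0 <= M)%R /\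
  bounded_sums (fun u => chiR G u * Cmod (/ u ^ 3))%R M.
Proof.
  intros HG. destruct (proj1 (proj2 HG)) as [d [Hd H]].
  pose proof (E_abs G 3 HG (le_n 3)) as [_ [M HM]]. exists d, M.
  repeat split; auto.
  - apply (HM nil); constructor.
  - intros l Hl. specialize (HM l Hl). eapply Rle_trans; [|apply HM].
    apply rsum_le. intros u _. rewrite Cmod_mult, Cmod_chi. lra.
Qed.

Lemma P_pre_expansion G z : summable_lattice G ->
  has_sum (fun u => chi G u * (/ (z - u) ^ 2 -
     csum (fun n => (- (1)) ^ 2 * gcoef 2 n * z ^ n * / u ^ (n + 2)) (seq 0 1))) (Psum G z).
Proof.
  intros HG. eapply has_sum_ext; [|apply P_has_sum; auto].
  intros u; cbv beta. unfold csum. simpl. ring.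
Qed.

Lemma S_pre_expansion G k z : summable_lattice G -> (3 <= k)%nat ->
  has_sum (fun u => chi G u * (/ (z - u) ^ k -
     csum (fun n => (- (1)) ^ k * gcoef k n * z ^ n * / u ^ (n + k)) (seq 0 0))) (Ssum G k z).
Proof.
  intros HG Hk. eapply has_sum_ext; [|apply (S_has_sum G k z); auto].
  intros u; cbv beta. unfold csum. simpl. ring.
Qed.

Lemma P_expansion G N : summable_lattice G -> bigO (N + 3) (fun z => z ^ 2 * Psum G z -
  (1 + csum (fun n => gcoef 2 n * Esum G (n + 2) * z ^ (n + 2)) (seq 1 N))).
Proof.
  intros HG. destruct (taylor_data G HG) as [rho [M [Hr [Hmin [HM0 HM]]]]].
  exists (gbound 2 N * (/ rho) ^ (N + 0) * M)%R, (Rmin 1 (rho / 2)).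
  pose proof (Rmin_l 1 (rho / 2)). pose proof (Rmin_r 1 (rho / 2)).
  assert (0 < / rho)%R by (apply Rinv_0_lt_compat; auto).
  split; [|split; [split; [apply Rmin_glb_lt; lra|lra]|]].
  { apply Rmult_le_pos; auto. apply Rmult_le_pos; [apply gbound_pos|apply pow_le; lra]. }
  intros z Hz. assert (Hz0 : z <> 0) by (apply Cmod_gt_0; lra).
  pose proof (taylor G 0 1 N (Psum G z) z rho M HG ltac:(lia) ltac:(lia) Hr Hmin HM
    ltac:(lra) (P_pre_expansion G z HG)) as T.
  replace (S N - 1)%nat with N in T by lia.
  match goal with |- (Cmod ?a <= _)%R => replace a with (z ^ 2 *
    (Psum G z - / z ^ 2 - csum (fun n => (- (1)) ^ 2 * gcoef 2 n * z ^ n * Esum G (n + 2)) (seq 1 N))) end.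
  - rewrite Cmod_mult, Cmod_pow.
    replace (gbound 2 N * (/ rho) ^ (N + 0) * M * Cmod z ^ (N + 3))%R with
      (Cmod z ^ 2 * (gbound 2 N * Cmod z ^ S N * (/ rho) ^ (N + 0) * M))%R.
    + apply Rmult_le_compat_l; auto. apply pow_le; lra.
    + replace (N + 3)%nat with (2 + S N)%nat by lia. rewrite (pow_add (Cmod z)). ring.
  - unfold Cminus. rewrite !Cmult_plus_distr_l.
    replace (z ^ 2 * - / z ^ 2) with (- (1)) by (field; auto).
    replace (csum (fun n => gcoef 2 n * Esum G (n + 2) * z ^ (n + 2)) (seq 1 N)) with
     (z ^ 2 * csum (fun n => (- (1)) ^ 2 * gcoef 2 n * z ^ n * Esum G (n + 2)) (seq 1 N)).
    + ring.
    + rewrite <- csum_scal. apply csum_ext_in. intros n _. rewrite Cpow_add_r. ring.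
Qed.

Lemma S_expansion G k N : summable_lattice G -> (3 <= k)%nat ->
  bigO (S N + k) (fun z => z ^ k * Ssum G k z -
  (1 + csum (fun n => (- (1)) ^ k * gcoef k n * Esum G (n + k) * z ^ (n + k)) (seq 0 (S N)))).
Proof.
  intros HG Hk. destruct (taylor_data G HG) as [rho [M [Hr [Hmin [HM0 HM]]]]].
  destruct k as [|[|k']]; [lia|lia|]. set (k := S (S k')) in *.
  exists (gbound k N * (/ rho) ^ (N + k') * M)%R, (Rmin 1 (rho / 2)).
  pose proof (Rmin_l 1 (rho / 2)). pose proof (Rmin_r 1 (rho / 2)).
  assert (0 < / rho)%R by (apply Rinv_0_lt_compat; auto).
  split; [|split; [split; [apply Rmin_glb_lt; lra|lra]|]].
  { apply Rmult_le_pos; auto. apply Rmult_le_pos; [apply gbound_pos|apply pow_le; lra]. }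
  intros z Hz. assert (Hz0 : z <> 0) by (apply Cmod_gt_0; lra).
  pose proof (taylor G k' 0 N (Ssum G k z) z rho M HG ltac:(lia) ltac:(lia) Hr Hmin HM
    ltac:(lra) (S_pre_expansion G k z HG Hk)) as T. cbv zeta in T. fold k in T.
  replace (S N - 0)%nat with (S N) in T by lia.
  match goal with |- (Cmod ?a <= _)%R => replace a with (z ^ k *
    (Ssum G k z - / z ^ k - csum (fun n => (- (1)) ^ k * gcoef k n * z ^ n * Esum G (n + k)) (seq 0 (S N)))) end.
  - rewrite Cmod_mult, Cmod_pow.
    replace (gbound k N * (/ rho) ^ (N + k') * M * Cmod z ^ (S N + k))%R with
      (Cmod z ^ k * (gbound k N * Cmod z ^ S N * (/ rho) ^ (N + k') * M))%R.
    + apply Rmult_le_compat_l; auto. apply pow_le; lra.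
    + rewrite (pow_add (Cmod z)). ring.
  - unfold Cminus. rewrite !Cmult_plus_distr_l.
    replace (z ^ k * - / z ^ k) with (- (1)) by (field; apply Cpow_nz; auto).
    replace (csum (fun n => (- (1)) ^ k * gcoef k n * Esum G (n + k) * z ^ (n + k)) (seq 0 (S N))) with
     (z ^ k * csum (fun n => (- (1)) ^ k * gcoef k n * z ^ n * Esum G (n + k)) (seq 0 (S N))).
    + ring.
    + rewrite <- csum_scal. apply csum_ext_in. intros n _. rewrite Cpow_add_r. ring.
Qed.

Lemma odd3 : Nat.Odd 3. Proof. exists 1%nat; auto. Qed.
Lemma odd5 : Nat.Odd 5. Proof. exists 2%nat; auto. Qed.

Lemma P_exp7 G : summable_lattice G -> bigO 7 (fun z => z ^ 2 * Psum G z -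
  (1 + 3 * Esum G 4 * z ^ 4 + 5 * Esum G 6 * z ^ 6)).
Proof.
  intros HG. eapply bigO_ext; [|apply (P_expansion G 4 HG)]. intros z _; cbv beta.
  unfold csum, Csum; cbn [seq map fold_right]. rewrite !gcoef_2. cbn [Nat.add]. simpl INR.
  rewrite !RtoC_plus.
  rewrite (E_odd G 3), (E_odd G 5); auto using odd3, odd5. ring.
Qed.

Lemma S3_exp7 G : summable_lattice G -> bigO 7 (fun z => z ^ 3 * Ssum G 3 z -
  (1 - 3 * Esum G 4 * z ^ 4 - 10 * Esum G 6 * z ^ 6)).
Proof.
  intros HG. eapply bigO_ext; [|apply (S_expansion G 3 3 HG); lia]. intros z _; cbv beta.
  unfold csum, Csum; cbn [seq map fold_right]. rewrite !gcoef_3. cbn [Nat.add]. simpl INR.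
  rewrite (E_odd G 3), (E_odd G 5); auto using odd3, odd5.
  replace ((1 + 1) * (1 + 2) / 2)%R with 3%R by field.
  replace ((1 + 1 + 1 + 1) * (1 + 1 + 1 + 2) / 2)%R with 10%R by field. ring.
Qed.

Lemma S4_exp5 G : summable_lattice G -> bigO 5 (fun z => z ^ 4 * Ssum G 4 z - (1 + Esum G 4 * z ^ 4)).
Proof.
  intros HG. eapply bigO_ext; [|apply (S_expansion G 4 0 HG); lia]. intros z _; cbv beta.
  unfold csum, Csum; cbn [seq map fold_right]. rewrite !gcoef_0. cbn [Nat.add]. ring.
Qed.

(** The constant is identified by its limit at the origin, approached along the ray through [z0],
    where [f] is known to be constant. *)
Lemma bigO_ray_const n (f : C -> C) (c z0 : C) : z0 <> 0 ->
  bigO (S n) (fun z => z ^ n * (f z - c)) ->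
  (forall t : R, (0 < t <= 1)%R -> f (t * z0) = f z0) -> f z0 = c.
Proof.
  intros Hz [K [d [HK [Hd H]]]] Hf.
  apply NNPP; intros Hn. pose proof (proj1 (Cmod_gt_0 z0) Hz) as Pz.
  assert (P : (0 < Cmod (f z0 - c))%R).
  { apply Cmod_gt_0. intros E; apply Hn, sub_eq_0; auto. }
  set (x := Rmin 1 (Rmin (d / Cmod z0) (Cmod (f z0 - c) / ((K + 1) * Cmod z0)))).
  assert (Hx : (0 < x)%R).
  { unfold x. repeat apply Rmin_glb_lt; try lra; apply Rdiv_lt_0_compat; try lra.
    apply Rmult_lt_0_compat; lra. }
  assert (Hx1 : (x / 2 < x)%R) by lra.
  apply Rmin_Rgt in Hx1 as [Hx1 Hx2]. apply Rmin_Rgt in Hx2 as [Hx2 Hx3].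
  apply Rgt_lt, Rlt_div_r in Hx2; [|lra].
  apply Rgt_lt, Rlt_div_r in Hx3; [|apply Rmult_lt_0_compat; lra].
  set (t := (x / 2)%R) in *. assert (Ht : (0 < t)%R) by (unfold t; lra).
  specialize (H (t * z0)). specialize (Hf t ltac:(lra)).
  rewrite Cmod_mult, Cmod_R, (Rabs_pos_eq t) in H by lra.
  assert (Hp : (0 < t * Cmod z0)%R) by (apply Rmult_lt_0_compat; auto).
  specialize (H ltac:(lra)).
  rewrite Hf, Cmod_mult, Cmod_pow, Cmod_mult, Cmod_R, (Rabs_pos_eq t) in H by lra.
  simpl pow in H.
  assert (B : (Cmod (f z0 - c) <= K * (t * Cmod z0))%R).
  { apply Rmult_le_reg_l with ((t * Cmod z0) ^ n)%R; [apply pow_lt; auto|]. lra. }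
  nra.
Qed.

Lemma ray_nonzero G z : summable_lattice G -> (forall t : R, (0 < t <= 1)%R -> ~ G (t * z)) ->
  z <> 0 /\ ~ G z.
Proof.
  intros HG H.
  assert (~ G z). { intros Hz. apply (H 1%R); [lra|]. rewrite Cmult_1_l; auto. }
  split; auto. intros ->. apply H0, HG.
Qed.

Lemma qderiv_0_ray G f z : (forall t : R, (0 < t <= 1)%R -> ~ G (t * z)) ->
  (forall t : R, (0 < t <= 1)%R -> ~ G (t * z) -> qderiv f (t * z) 0) ->
  forall t : R, (0 < t <= 1)%R -> f (t * z) = f z.
Proof.
  intros HG Hf t Ht.
  replace z with (t * z + (1 - t)%R * z) at 2 by (rewrite RtoC_minus; ring).
  apply qderiv_0_segment. intros s Hs.
  replace (t * z + s * ((1 - t)%R * z)) with ((t + s * (1 - t))%R * z)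
    by (rewrite RtoC_plus, RtoC_mult; ring).
  assert (0 < t + s * (1 - t) <= 1)%R by nra. auto.
Qed.

(** Since [P '' = 6 S4] and [g2 = 60 E4], this is the equation [P '' = 6 P ^ 2 - g2 / 2]. *)
Lemma ode2_ray G z : summable_lattice G -> (forall t : R, (0 < t <= 1)%R -> ~ G (t * z)) ->
  Ssum G 4 z = Psum G z ^ 2 - 5 * Esum G 4.
Proof.
  intros HG Hz. destruct (ray_nonzero G z HG Hz) as [Hz0 _].
  enough (E : ode2 G z = 5 * Esum G 4).
  { rewrite <- E. unfold ode2. ring. }
  apply (bigO_ray_const 4); auto.
  2: { apply qderiv_0_ray with G; auto. intros; apply ode2_qderiv; auto. }
  pose proof (P_exp7 G HG) as OP. pose proof (S4_exp5 G HG) as OS.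
  set (e4 := Esum G 4) in *. set (e6 := Esum G 6) in *.
  set (p := fun z => 1 + 3 * e4 * z ^ 4 + 5 * e6 * z ^ 6).
  set (r := fun z => z ^ 2 * Psum G z - (1 + 3 * e4 * z ^ 4 + 5 * e6 * z ^ 6)) in *.
  set (r' := fun z => z ^ 4 * Ssum G 4 z - (1 + e4 * z ^ 4)) in *.
  assert (Ob : bigO 0 p).
  { unfold p. apply bigO_plus; [apply bigO_plus|]; [apply bigO_const| |];
      apply bigO_scal, (bigO_le 0 _ _ (Nat.le_0_l _) (bigO_pow _)). }
  (* The square of the Taylor polynomial [p] is [1 + 6 e4 z ^ 4] up to terms of order 6; subtracting
     the [1 + e4 z ^ 4] of [S4] leaves the constant [5 e4]. *)
  apply bigO_ext with (fun z => (2 * p z + r z) * r z + (- (1)) * r' z +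
    z ^ 5 * (10 * e6 * z + 9 * e4 ^ 2 * z ^ 3 + 30 * e4 * e6 * z ^ 5 + 25 * e6 ^ 2 * z ^ 7)).
  { intros x _. unfold ode2, r, r', p. ring. }
  apply bigO_plus; [apply bigO_plus|].
  - apply bigO_0_mult; [|apply (bigO_le 5 7); auto; lia].
    apply bigO_plus; [apply bigO_scal; auto|]. apply (bigO_le 0 7); auto; lia.
  - apply bigO_scal; auto.
  - apply (bigO_mult 5 0); [apply bigO_pow|].
    repeat apply bigO_plus; try apply bigO_scal;
      try apply (bigO_le 0 _ _ (Nat.le_0_l _) (bigO_pow _)).
    apply bigO_ext with (fun x => x ^ 1); [intros; simpl; ring|].
    apply (bigO_le 0 _ _ (Nat.le_0_l _) (bigO_pow _)).
Qed.

(** With [P ' = - 2 S3] this is a quarter of [P ' ^ 2 = 4 P ^ 3 - g2 P - g3]. The derivative of the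
    function [Y] below is a multiple of [S4 - P ^ 2 + 5 E4], which vanishes by [ode2_ray]. *)
Lemma cubic_ray G z : summable_lattice G -> (forall t : R, (0 < t <= 1)%R -> ~ G (t * z)) ->
  Ssum G 3 z ^ 2 = Psum G z ^ 3 - 15 * Esum G 4 * Psum G z - 35 * Esum G 6.
Proof.
  intros HG Hz. destruct (ray_nonzero G z HG Hz) as [Hz0 _].
  set (Y := fun x => Ssum G 3 x * Ssum G 3 x + (- (1)) * (Psum G x * (Psum G x * Psum G x))
     + 15 * Esum G 4 * Psum G x).
  enough (E : Y z = - (35) * Esum G 6).
  { apply sub_eq_0. transitivity (Y z - (- (35) * Esum G 6)); [unfold Y; ring|].
    rewrite E; ring. }
  apply (bigO_ray_const 6); auto.
  2: { apply qderiv_0_ray with G; auto. intros t Ht Hn.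
    assert (E4 : Ssum G 4 (t * z) = Psum G (t * z) ^ 2 - 5 * Esum G 4).
    { apply ode2_ray; auto. intros s Hs. rewrite Cmult_assoc, <- RtoC_mult.
      apply Hz. nra. }
    pose proof (P_qderiv G (t * z) HG Hn) as DP.
    pose proof (S_qderiv G 3 (t * z) HG Hn (le_n 3)) as DS.
    pose proof (qderiv_plus _ _ _ _ _ (qderiv_plus _ _ _ _ _ (qderiv_mult _ _ _ _ _ DS DS)
      (qderiv_scal (- (1)) _ _ _ (qderiv_mult _ _ _ _ _ DP (qderiv_mult _ _ _ _ _ DP DP))))
      (qderiv_scal (15 * Esum G 4) _ _ _ DP)) as D.
    match type of D with qderiv _ _ ?l => replace (RtoC 0) with l; [exact D|] end.
    rewrite E4. replace (INR 3) with 3%R by (simpl; ring). ring. }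
  pose proof (P_exp7 G HG) as OP. pose proof (S3_exp7 G HG) as OS.
  set (e4 := Esum G 4) in *. set (e6 := Esum G 6) in *.
  set (p := fun z => 1 + 3 * e4 * z ^ 4 + 5 * e6 * z ^ 6).
  set (a := fun z => 1 - 3 * e4 * z ^ 4 - 10 * e6 * z ^ 6).
  set (r := fun z => z ^ 2 * Psum G z - (1 + 3 * e4 * z ^ 4 + 5 * e6 * z ^ 6)) in *.
  set (r' := fun z => z ^ 3 * Ssum G 3 z - (1 - 3 * e4 * z ^ 4 - 10 * e6 * z ^ 6)) in *.
  assert (Opow : forall n, bigO 0 (fun z => z ^ n)).
  { intros n. apply (bigO_le 0 _ _ (Nat.le_0_l _) (bigO_pow _)). }
  assert (Ob : bigO 0 p).
  { unfold p. repeat apply bigO_plus; try apply bigO_const; apply bigO_scal, Opow. }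
  assert (Oa : bigO 0 a).
  { unfold a. repeat apply bigO_plus; try apply bigO_const; apply bigO_opp, bigO_scal, Opow. }
  assert (Or : bigO 0 r) by (apply (bigO_le 0 7); auto; lia).
  assert (Or' : bigO 0 r') by (apply (bigO_le 0 7); auto; lia).
  (* [p = 1 + z ^ 4 q1], so the powers of [q1] from the second on come with at least [z ^ 8]. At
     order 6 the square of [a] contributes [- 20 e6] and the cube of [p] contributes [- 15 e6]:
     hence the constant 35. *)
  set (q1 := fun z => 3 * e4 * z ^ 0 + 5 * e6 * z ^ 2).
  assert (Oq : bigO 0 q1).
  { unfold q1. apply bigO_plus; apply bigO_scal, Opow. }
  apply bigO_ext with (fun z => (2 * a z + r' z) * r' z
    + (- (1) * (3 * (p z * p z) + 3 * (p z * r z) + r z * r z) + 15 * e4 * z ^ 4) * r z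
    + z ^ 7 * (z ^ 1 * (9 * e4 ^ 2 * z ^ 0 + 60 * e4 * e6 * z ^ 2 + 100 * e6 ^ 2 * z ^ 4
        + - (1) * (3 * (q1 z * q1 z)) + - (1) * (z ^ 4 * (q1 z * (q1 z * q1 z)))
        + 15 * e4 * q1 z))).
  { intros x _. unfold Y, r, r', p, a, q1. ring. }
  repeat apply bigO_plus.
  - apply bigO_0_mult; auto. apply bigO_plus; auto. apply bigO_scal; auto.
  - apply bigO_0_mult; auto. apply bigO_plus.
    + apply bigO_scal. repeat apply bigO_plus; try apply bigO_scal;
        apply (bigO_mult 0 0); auto.
    + apply bigO_scal; auto.
  - apply (bigO_mult 7 0); [apply bigO_pow|]. apply (bigO_mult 0 0); [apply Opow|].
    repeat apply bigO_plus; try (apply bigO_scal; auto; fail).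
    + apply bigO_scal, bigO_scal, (bigO_mult 0 0); auto.
    + apply bigO_scal, (bigO_mult 0 0); auto. apply (bigO_mult 0 0); auto.
      apply (bigO_mult 0 0); auto.
Qed.

(** * Half periods and sublattices of index 2 *)

Lemma complement_open G z : summable_lattice G -> ~ G z ->
  exists d, (0 < d)%R /\ forall h, (Cmod h < d)%R -> ~ G (z + h).
Proof.
  intros HG Hz. destruct (slat_dist G z HG) as [c [Hc H]].
  exists c. split; auto. intros h Hh HGh.
  specialize (H (z + h) HGh). pose proof (Cmod_ge_0 (z + h)).
  replace (z - (z + h)) with (- h) in H by ring. rewrite Cmod_opp in H.
  assert (z + h <> z) by (intros E; rewrite E in HGh; auto). specialize (H H1). nra.
Qed.

(** This is the derivative of [P * S3 = S5]. As [P '''' = 120 S6], it expresses the sum of sixth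
    inverse powers over a translate of the lattice by [P], as needed for [g3] of a sublattice. *)
Lemma S6_relation G z : summable_lattice G -> ~ G z ->
  5 * Ssum G 6 z = 2 * Ssum G 3 z ^ 2 + 3 * Psum G z * Ssum G 4 z.
Proof.
  intros HG Hz.
  pose proof (P_qderiv G z HG Hz) as DP.
  pose proof (S_qderiv G 3 z HG Hz ltac:(lia)) as D3.
  pose proof (S_qderiv G 5 z HG Hz ltac:(lia)) as D5.
  pose proof (qderiv_unique _ _ _ _ _ (qderiv_mult _ _ _ _ _ DP D3) D5) as E.
  replace (INR 3) with 3%R in E by (simpl; ring).
  replace (INR 5) with 5%R in E by (simpl; ring).
  apply sub_eq_0.
  transitivity (- (- (5) * Ssum G 6 z) - (2 * Ssum G 3 z ^ 2 + 3 * Psum G z * Ssum G 4 z)); [ring|].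
  rewrite <- E; [ring|].
  destruct (complement_open G z HG Hz) as [d [Hd H]]. exists d. split; auto.
  intros h Hh. apply P_S3; auto.
Qed.

Lemma S3_half G w : summable_lattice G -> G w -> Ssum G 3 (w / 2) = 0.
Proof.
  intros HG Hw.
  assert (E : Ssum G 3 (w / 2) = (- (1)) ^ 3 * Ssum G 3 (w / 2)).
  { rewrite <- S_opp by auto. rewrite <- (S_periodic G 3 (- (w / 2)) w) by auto.
    f_equal. field. }
  set (s := Ssum G 3 (w / 2)) in *.
  replace s with ((s - (- (1)) ^ 3 * s) / 2) by (simpl; field). rewrite <- E. field.
Qed.

(** The half-open segment from the origin to [w / 2] avoids [G]: exactly the condition under which
    the equations along rays hold at [w / 2]. *)
Definition primitive (G : C -> Prop) (w : C) : Prop :=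
  G w /\ forall t : R, (0 < t <= 1)%R -> ~ G (t * (w / 2)).

Lemma primitive_half G w : primitive G w -> ~ G (w / 2).
Proof.
  intros [_ H] Hn. apply (H 1%R); [lra|]. rewrite Cmult_1_l; auto.
Qed.

Lemma half_cubic G w : summable_lattice G -> primitive G w ->
  Psum G (w / 2) ^ 3 - 15 * Esum G 4 * Psum G (w / 2) - 35 * Esum G 6 = 0.
Proof.
  intros HG Hw. rewrite <- cubic_ray; auto; [|apply Hw].
  rewrite S3_half; auto; [ring|apply Hw].
Qed.

Lemma half_S4 G w : summable_lattice G -> primitive G w ->
  Ssum G 4 (w / 2) = Psum G (w / 2) ^ 2 - 5 * Esum G 4.
Proof. intros HG Hw. apply ode2_ray; auto. apply Hw. Qed.

Lemma half_S6 G w : summable_lattice G -> primitive G w ->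
  5 * Ssum G 6 (w / 2) = 3 * Psum G (w / 2) * (Psum G (w / 2) ^ 2 - 5 * Esum G 4).
Proof.
  intros HG Hw. rewrite S6_relation; auto; [|apply primitive_half; auto].
  rewrite S3_half, half_S4; auto; [ring|apply Hw].
Qed.

Lemma has_sum_scale (f : C -> C) (c : C) s : c <> 0 ->
  has_sum f s <-> has_sum (fun u => f (c * u)) s.
Proof.
  intros Hc. apply has_sum_reindex.
  - intros a b E. replace a with (/ c * (c * a)) by (field; auto). rewrite E. field; auto.
  - intros x _. exists (x / c). field; auto.
Qed.

(** The condition on [H] describes the union of [2 G] and [w + 2 G], which is disjoint because
    [w / 2] is not in [G]. The second part is summed through the substitution [v = w - 2 u]. *)
Lemma Esum_double G H w k : summable_lattice G -> G w -> ~ G (w / 2) -> (3 <= k)%nat ->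
  (forall v, H v <-> G (v / 2) \/ G ((v - w) / 2)) ->
  has_sum (fun u => chi H u * / u ^ k) (/ 2 ^ k * (Esum G k + Ssum G k (w / 2))).
Proof.
  intros HG Hw Hn Hk HH.
  assert (D2 : RtoC 2 <> 0) by (intros E; apply RtoC_inj in E; lra).
  assert (P2 : 2 ^ k <> 0) by (apply Cpow_nz; auto).
  assert (H1 : has_sum (fun v => chi G (v / 2) * / v ^ k) (/ 2 ^ k * Esum G k)).
  { apply (has_sum_scale _ 2); auto.
    eapply has_sum_ext; [|apply has_sum_scal, E_has_sum; auto].
    intros u; cbv beta. replace (2 * u / 2) with u by (field; auto).
    rewrite Cpow_mult_l, !Cinv_pow.
    destruct (classic (u = 0)) as [->|Hu].
    - rewrite <- !Cinv_pow. destruct k; [lia|]. simpl.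
      rewrite !Cmult_0_l, !Cmult_0_r, Cinv_0. ring.
    - rewrite <- !Cinv_pow. field. split; [apply Cpow_nz|]; auto. }
  assert (H2 : has_sum (fun v => chi G ((v - w) / 2) * / v ^ k) (/ 2 ^ k * Ssum G k (w / 2))).
  { apply (has_sum_reflect _ w), (has_sum_scale _ 2); auto.
    eapply has_sum_ext; [|apply has_sum_scal, (S_has_sum G k (w / 2)); auto].
    intros u; cbv beta. replace ((w - 2 * u - w) / 2) with (- u) by (field; auto).
    rewrite chi_opp by apply HG.
    replace (w - 2 * u) with (2 * (w / 2 - u)) by (field; auto).
    rewrite Cpow_mult_l.
    destruct (classic (G u)) as [Hu|Hu]; [|rewrite (chi_0 G u Hu); ring].
    field. split; auto. apply Cpow_nz. intros E. apply Hn.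
    rewrite (sub_eq_0 _ _ E); auto. }
  rewrite Cmult_plus_distr_l.
  eapply has_sum_ext; [|apply has_sum_plus; [apply H1|apply H2]].
  intros v; cbv beta.
  assert (NB : ~ (G (v / 2) /\ G ((v - w) / 2))).
  { intros [A B]. apply Hn. replace (w / 2) with (v / 2 - (v - w) / 2) by (field; auto).
    apply (proj1 HG); auto. }
  destruct (classic (G (v / 2))) as [A|A]; destruct (classic (G ((v - w) / 2))) as [B|B].
  - exfalso; auto.
  - rewrite (chi_1 _ _ A), (chi_0 _ _ B), (chi_1 H v) by (apply HH; auto). ring.
  - rewrite (chi_0 _ _ A), (chi_1 _ _ B), (chi_1 H v) by (apply HH; auto). ring.
  - rewrite (chi_0 _ _ A), (chi_0 _ _ B), (chi_0 H v) by (rewrite HH; tauto). ring.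
Qed.

(** * The sums of the definitions, and the discriminant of a sublattice *)

#[local] Instance finite_subsets_proper (A : C -> Prop) : ProperFilter' (finite_subsets A).
Proof.
  constructor.
  - intros [l0 [H0 H]]. destruct (nodup_em l0) as [l [Hl Il]].
    apply (H l Hl).
    + rewrite Forall_forall in *. intros x Hx. apply H0, Il; auto.
    + intros x Hx; apply Il; auto.
  - constructor.
    + exists nil. split; auto.
    + intros P Q [l0 [H0 HP]] [l1 [H1 HQ]]. exists (l0 ++ l1).
      split; [apply Forall_app; auto|].
      intros l Hl HA HI. split; [apply HP|apply HQ]; auto;
        intros x Hx; apply HI, in_or_app; auto.
    + intros P Q HPQ [l0 [H0 HP]]. exists l0. auto.
Qed.

(** [usum] picks a limit along the finite subsets of [A], while [has_sum] runs over the plane. The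
    points of [l0] outside [A] are appended to a given list at no cost, as [g] vanishes there. *)
Lemma utsum_has_sum (A : C -> Prop) (f g : C -> C) s :
  has_sum g s -> (forall u, A u -> g u = f u) -> (forall u, ~ A u -> g u = 0) ->
  usum A f = s.
Proof.
  intros H HA HN.
  apply (@iota_filterlim_locally C_AbsRing C_CompleteNormedModule _ (finite_subsets A) _
          (fun l => Csum (map f l)) s).
  intros P [eps HP].
  destruct (H eps (cond_pos eps)) as [l0 H0].
  set (p := fun x => if excluded_middle_informative (A x) then true else false).
  assert (Hp : forall x, p x = true <-> A x).
  { intros x; unfold p; destruct excluded_middle_informative; split; easy. }
  exists (filter p l0). split.
  { apply Forall_forall. intros x Hx. apply filter_In in Hx as [_ Hx]. apply Hp; auto. }
  intros l Hl HlA HI. rewrite Forall_forall in HlA.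
  apply HP. apply C_NormedModule_mixin_compat1.
  change (minus (Csum (map f l)) s) with (csum f l - s).
  set (n0 := nodup eq_em l0).
  replace (csum f l) with (csum g (lunion l (filter (fun x => negb (p x)) n0))).
  - apply H0.
    + apply lunion_NoDup; auto. apply NoDup_filter, NoDup_nodup.
    + intros x Hx. apply lunion_In. destruct (p x) eqn:E.
      * left. apply HI, filter_In; auto.
      * right. apply filter_In. split; [apply nodup_In; auto|rewrite E; auto].
  - unfold lunion. rewrite csum_app, (csum_zero g (filter _ _)).
    + rewrite Cplus_0_r. apply csum_ext_in. intros; apply HA; auto.
    + intros x Hx. apply filter_In in Hx as [Hx _]. apply filter_In in Hx as [_ Hx].
      apply HN. intros Hn. apply Hp in Hn. rewrite Hn in Hx; discriminate.
Qed.

Lemma g2_eq G s : has_sum (fun u => chi G u * / u ^ 4) s -> g2 G = 60 * s.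
Proof.
  intros H. apply (utsum_has_sum _ _ (fun u => 60 * (chi G u * / u ^ 4))).
  - apply has_sum_scal; auto.
  - intros u [Hu _]. rewrite chi_1 by auto. ring.
  - intros u Hu. destruct (classic (u = 0)) as [->|Hu0].
    + rewrite Cinv_pow, Cinv_0. ring.
    + rewrite chi_0; [ring|]. intros HG; apply Hu; split; auto.
Qed.

Lemma g3_eq G s : has_sum (fun u => chi G u * / u ^ 6) s -> g3 G = 140 * s.
Proof.
  intros H. apply (utsum_has_sum _ _ (fun u => 140 * (chi G u * / u ^ 6))).
  - apply has_sum_scal; auto.
  - intros u [Hu _]. rewrite chi_1 by auto. ring.
  - intros u Hu. destruct (classic (u = 0)) as [->|Hu0].
    + rewrite Cinv_pow, Cinv_0. ring.
    + rewrite chi_0; [ring|]. intros HG; apply Hu; split; auto.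
Qed.

Lemma wp_eq G z : summable_lattice G -> wp z G = Psum G z.
Proof.
  intros HG. pose proof (proj1 (proj1 HG)) as G0.
  assert (E : usum (nonzero G) (fun u => / (z - u) ^ 2 - / u ^ 2) = Psum G z - / z ^ 2).
  { apply (utsum_has_sum _ _ (fun u => chi G u * (/ (z - u) ^ 2 - / u ^ 2)
       - (if eq_em u (RtoC 0) then / z ^ 2 else 0))).
    - apply has_sum_minus; [apply P_has_sum; auto|].
      pose proof (has_sum_single (RtoC 0) (fun u => if eq_em u (RtoC 0) then / z ^ 2 else 0)) as H1.
      cbv beta in H1. destruct (eq_em (RtoC 0) (RtoC 0)) as [_|]; [|easy].
      apply H1. intros x Hx. destruct eq_em; easy.
    - intros u [Hu Hu0]. rewrite chi_1 by auto. destruct eq_em; [easy|]. ring.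
    - intros u Hu. destruct (eq_em u (RtoC 0)) as [->|Hu0].
      + rewrite chi_1 by auto. replace (z - 0) with z by ring.
        rewrite (Cinv_pow 0), Cinv_0. ring.
      + rewrite chi_0; [ring|]. intros HGu; apply Hu; split; auto. }
  unfold wp. rewrite E. ring.
Qed.

(** Divided differences: differences of two equations divided by [e1 - e2] and [e1 - e3] give two
    quadratic relations, and the difference of these divided by [e2 - e3] gives
    [e1 + e2 + e3 = 0]. *)
Lemma cubic_vieta (p q e1 e2 e3 : C) :
  e1 <> e2 -> e1 <> e3 -> e2 <> e3 ->
  e1 ^ 3 - p * e1 - q = 0 -> e2 ^ 3 - p * e2 - q = 0 -> e3 ^ 3 - p * e3 - q = 0 ->
  e1 + e2 + e3 = 0 /\ p = - (e1 * e2 + e1 * e3 + e2 * e3) /\ q = e1 * e2 * e3.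
Proof.
  intros N12 N13 N23 H1 H2 H3.
  assert (can : forall x y : C, x <> 0 -> x * y = 0 -> y = 0).
  { intros x y Hx Hxy. apply NNPP; intros Hy. apply (Cmult_neq_0 x y); auto. }
  assert (d12 : e1 - e2 <> 0) by (intros E; apply N12, sub_eq_0; auto).
  assert (d13 : e1 - e3 <> 0) by (intros E; apply N13, sub_eq_0; auto).
  assert (d23 : e2 - e3 <> 0) by (intros E; apply N23, sub_eq_0; auto).
  assert (A : e1 ^ 2 + e1 * e2 + e2 ^ 2 - p = 0).
  { apply (can (e1 - e2)); auto.
    transitivity ((e1 ^ 3 - p * e1 - q) - (e2 ^ 3 - p * e2 - q)); [ring|].
    rewrite H1, H2; ring. }
  assert (B : e1 ^ 2 + e1 * e3 + e3 ^ 2 - p = 0).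
  { apply (can (e1 - e3)); auto.
    transitivity ((e1 ^ 3 - p * e1 - q) - (e3 ^ 3 - p * e3 - q)); [ring|].
    rewrite H1, H3; ring. }
  assert (S0 : e1 + e2 + e3 = 0).
  { apply (can (e2 - e3)); auto.
    transitivity ((e1 ^ 2 + e1 * e2 + e2 ^ 2 - p) - (e1 ^ 2 + e1 * e3 + e3 ^ 2 - p)); [ring|].
    rewrite A, B; ring. }
  assert (E3 : e3 = - (e1 + e2)).
  { replace e3 with (e1 + e2 + e3 - (e1 + e2)) by ring. rewrite S0; ring. }
  assert (Ep : p = - (e1 * e2 + e1 * e3 + e2 * e3)).
  { apply sub_eq_0. rewrite E3.
    transitivity (- (e1 ^ 2 + e1 * e2 + e2 ^ 2 - p)); [ring|]. rewrite A; ring. }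
  repeat split; auto.
  apply sub_eq_0. transitivity (- (e1 ^ 3 - p * e1 - q) - (e1 ^ 2 + e1 * e2 + e2 ^ 2 - p) * 0).
  - rewrite Ep, E3. ring.
  - rewrite H1. ring.
Qed.

Lemma Delta_index2 G H w e1 e2 e3 : summable_lattice G -> primitive G w ->
  (forall v, H v <-> G (v / 2) \/ G ((v - w) / 2)) ->
  e1 = Psum G (w / 2) -> e1 + e2 + e3 = 0 ->
  15 * Esum G 4 = - (e1 * e2 + e1 * e3 + e2 * e3) -> 35 * Esum G 6 = e1 * e2 * e3 ->
  Delta H = (e2 - e3) ^ 4 * (e1 - e2) * (e1 - e3) / 16.
Proof.
  intros HG Hw HH E1 E0 E4 E6. pose proof (proj1 Hw) as HGw.
  pose proof (primitive_half G w Hw) as Hn.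
  pose proof (Esum_double G H w 4 HG HGw Hn ltac:(lia) HH) as H4.
  pose proof (Esum_double G H w 6 HG HGw Hn ltac:(lia) HH) as H6.
  unfold Delta. rewrite (g2_eq _ _ H4), (g3_eq _ _ H6).
  pose proof (half_S6 G w HG Hw) as F6. rewrite (half_S4 G w HG Hw). rewrite <- E1 in *.
  assert (F6' : Ssum G 6 (w / 2) = 3 * e1 * (e1 ^ 2 - 5 * Esum G 4) / 5).
  { rewrite <- F6. field. }
  rewrite F6'.
  replace (Esum G 4) with (- (e1 * e2 + e1 * e3 + e2 * e3) / 15) by (rewrite <- E4; field).
  replace (Esum G 6) with ((e1 * e2 * e3) / 35) by (rewrite <- E6; field).
  (* The formula is a homogeneous identity of degree 6 on the plane [e1 + e2 + e3 = 0]; eliminating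
     [e1] makes it an identity of rational expressions. *)
  replace e1 with (- (e2 + e3)).
  - field.
  - replace e1 with (e1 + e2 + e3 - (e2 + e3)) by ring. rewrite E0; ring.
Qed.

(** * Uniqueness for a linear system of two equations *)

Lemma is_derive_sq (f : R -> R) t l : is_derive f t l ->
  is_derive (fun s => f s ^ 2)%R t (2 * f t * l)%R.
Proof.
  intros Hf. apply is_derive_Reals in Hf. apply is_derive_Reals.
  replace (2 * f t * l)%R with ((INR 2 * f t ^ 1) * l)%R by (simpl; ring).
  apply (derivable_pt_lim_comp f (fun x => x ^ 2)%R); auto. apply derivable_pt_lim_pow.
Qed.

Lemma cderiv_bounded (f f' : R -> C) (T : R) : (0 <= T)%R ->
  (forall t, 0 <= t <= T -> cderiv f t (f' t))%R ->
  exists B, (0 <= B)%R /\ forall t, (0 <= t <= T)%R -> (Cmod (f t) <= B)%R.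
Proof.
  intros HT H.
  assert (Hc : forall t, (0 <= t <= T)%R ->
     continuity_pt (fun s => Re (f s) ^ 2 + Im (f s) ^ 2)%R t).
  { intros t Ht. destruct (H t Ht) as [H1 H2].
    apply continuity_pt_filterlim.
    apply (ex_derive_continuous (K := R_AbsRing) (V := R_NormedModule)
       (fun s => Re (f s) ^ 2 + Im (f s) ^ 2)%R t).
    exists (2 * Re (f t) * Re (f' t) + 2 * Im (f t) * Im (f' t))%R.
    apply @is_derive_plus; apply is_derive_sq; auto. }
  destruct (continuity_ab_maj (fun s => Re (f s) ^ 2 + Im (f s) ^ 2)%R 0 T HT Hc)
    as [x [Hx1 Hx2]].
  exists (Cmod (f x)). split; [apply Cmod_ge_0|].
  intros t Ht. specialize (Hx1 t Ht). cbv beta in Hx1. rewrite <- !Cmod2_alt in Hx1.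
  apply Rsqr_incr_0; try apply Cmod_ge_0. unfold Rsqr. simpl in Hx1. lra.
Qed.

(** The energy [E = |d| ^ 2 + |e| ^ 2] satisfies [E ' <= L E], because [2 |d| |e|] is at most [E].
    Hence [E t * exp (- L t)] does not increase, and it starts at 0. *)
Lemma gronwall2 (d e q : R -> C) (k : C) (T B : R) : (0 <= T)%R ->
  (forall t, 0 <= t <= T -> cderiv d t (k * e t))%R ->
  (forall t, 0 <= t <= T -> cderiv e t (q t * d t))%R ->
  (forall t, 0 <= t <= T -> Cmod (q t) <= B)%R ->
  d 0%R = 0 -> e 0%R = 0 -> d T = 0.
Proof.
  intros HT Hd He Hq d0 e0.
  set (L := (Cmod k + B)%R).
  set (E := fun t => ((Re (d t) ^ 2 + Im (d t) ^ 2) + (Re (e t) ^ 2 + Im (e t) ^ 2))%R).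
  set (E' := fun t => ((2 * Re (d t) * Re (k * e t) + 2 * Im (d t) * Im (k * e t)) +
     (2 * Re (e t) * Re (q t * d t) + 2 * Im (e t) * Im (q t * d t)))%R).
  assert (DE : forall t, (0 <= t <= T)%R -> is_derive E t (E' t)).
  { intros t Ht. destruct (Hd t Ht) as [h1 h2]. destruct (He t Ht) as [h3 h4].
    apply @is_derive_plus; apply @is_derive_plus; apply is_derive_sq; auto. }
  assert (BE : forall t, (0 <= t <= T)%R -> (E' t <= L * E t)%R).
  { intros t Ht. specialize (Hq t Ht).
    assert (dot : forall x y : C, (Re x * Re y + Im x * Im y <= Cmod x * Cmod y)%R).
    { intros x y. replace (Re x * Re y + Im x * Im y)%R with (Re (x * Cconj y)).
      - eapply Rle_trans; [apply Rle_abs|]. eapply Rle_trans; [apply re_le_Cmod|].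
        rewrite Cmod_mult, Cmod_conj. lra.
      - destruct x, y; simpl; ring. }
    pose proof (dot (d t) (k * e t)) as D1. pose proof (dot (e t) (q t * d t)) as D2.
    rewrite Cmod_mult in D1, D2.
    unfold E', E, L. rewrite <- !Cmod2_alt.
    pose proof (Cmod_ge_0 (d t)) as pd. pose proof (Cmod_ge_0 (e t)) as pe.
    pose proof (Cmod_ge_0 k) as pk.
    assert (AG : (2 * (Cmod (d t) * Cmod (e t)) <= Cmod (d t) ^ 2 + Cmod (e t) ^ 2)%R).
    { pose proof (pow2_ge_0 (Cmod (d t) - Cmod (e t))). lra. }
    assert (P0 : (0 <= Cmod (d t) * Cmod (e t))%R) by (apply Rmult_le_pos; auto).
    assert (A1 : (Cmod (d t) * (Cmod k * Cmod (e t)) = Cmod k * (Cmod (d t) * Cmod (e t)))%R) by ring.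
    assert (A2 : (Cmod (e t) * (Cmod (q t) * Cmod (d t)) <= B * (Cmod (d t) * Cmod (e t)))%R).
    { replace (Cmod (e t) * (Cmod (q t) * Cmod (d t)))%R with
        (Cmod (q t) * (Cmod (d t) * Cmod (e t)))%R by ring.
      apply Rmult_le_compat_r; auto. }
    assert (A3 : ((Cmod k + B) * (2 * (Cmod (d t) * Cmod (e t))) <=
       (Cmod k + B) * (Cmod (d t) ^ 2 + Cmod (e t) ^ 2))%R).
    { apply Rmult_le_compat_l; auto. pose proof (Cmod_ge_0 (q t)). lra. }
    lra. }
  set (F := fun t => (E t * exp (- L * t))%R).
  assert (DF : forall t, (0 <= t <= T)%R ->
     is_derive F t (E' t * exp (- L * t) + E t * (exp (- L * t) * - L))%R).
  { intros t Ht. apply is_derive_Reals. apply (derivable_pt_lim_mult E (fun s => exp (- L * s)) t).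
    - apply is_derive_Reals, DE; auto.
    - apply (derivable_pt_lim_comp (fun s => - L * s)%R exp).
      + pose proof (derivable_pt_lim_scal id (- L) t 1 (derivable_pt_lim_id t)) as Hs.
        rewrite Rmult_1_r in Hs. exact Hs.
      + apply derivable_pt_lim_exp. }
  assert (FT : (F T <= F 0)%R).
  { destruct (Req_dec T 0) as [->|HT0]; [lra|].
    destruct (MVT_gen F 0 T (fun t => (E' t * exp (- L * t) + E t * (exp (- L * t) * - L))%R))
      as [c [Hc E0]].
    - intros t Ht. rewrite Rmin_left, Rmax_right in Ht by lra. apply DF; lra.
    - intros t Ht. rewrite Rmin_left, Rmax_right in Ht by lra.
      apply continuity_pt_filterlim.
      apply (ex_derive_continuous (K := R_AbsRing) (V := R_NormedModule) F t).
      eexists; apply DF; lra.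
    - rewrite Rmin_left, Rmax_right in Hc by lra.
      specialize (BE c Hc). pose proof (exp_pos (- L * c)).
      assert ((E' c * exp (- L * c) + E c * (exp (- L * c) * - L)) <= 0)%R.
      { replace (E' c * exp (- L * c) + E c * (exp (- L * c) * - L))%R with
          ((E' c - L * E c) * exp (- L * c))%R by ring.
        assert (0 <= (L * E c - E' c) * exp (- L * c))%R by (apply Rmult_le_pos; lra). lra. }
      assert ((E' c * exp (- L * c) + E c * (exp (- L * c) * - L)) * (T - 0) <= 0)%R by nra.
      lra. }
  assert (F0 : F 0%R = 0%R).
  { unfold F, E. rewrite d0, e0. simpl. ring. }
  assert (ET : (E T <= 0)%R).
  { unfold F in FT at 1. rewrite F0 in FT. pose proof (exp_pos (- L * T)). nra. }
  unfold E in ET. rewrite <- !Cmod2_alt in ET.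
  apply Cmod_eq_0. pose proof (Cmod_ge_0 (d T)).
  pose proof (pow2_ge_0 (Cmod (e T))). nra.
Qed.

(** * The half-period values are distinct *)

Lemma basis_coords a b G (x y : R) : has_basis a b G -> G (x * a + y * b) ->
  exists m n : Z, x = IZR m /\ y = IZR n.
Proof.
  intros [Hd HG] Hz. apply HG in Hz as [m [n E]]. exists m, n.
  destruct (basis_lower a b Hd) as [c [Hc Hl]].
  specialize (Hl (x - IZR m)%R (y - IZR n)%R).
  replace ((x - IZR m)%R * a + (y - IZR n)%R * b) with (RtoC 0) in Hl.
  - rewrite Cmod_0 in Hl. pose proof (Rabs_pos (x - IZR m)). pose proof (Rabs_pos (y - IZR n)).
    assert (Rabs (x - IZR m) = 0 /\ Rabs (y - IZR n) = 0)%R as [H1 H2] by (split; nra).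
    apply Rabs_eq_0 in H1, H2. split; lra.
  - rewrite !RtoC_minus.
    replace ((x - IZR m) * a + (y - IZR n) * b) with
      (x * a + y * b - (IZR m * a + IZR n * b)) by ring. rewrite E. ring.
Qed.

Lemma not_int_half (x : R) (m : Z) : (0 < x < 1)%R -> x <> IZR m.
Proof.
  intros Hx E. rewrite E in Hx. destruct Hx as [H1 H2].
  apply lt_IZR in H1, H2. lia.
Qed.

Lemma basis_off_x a b G (x y : R) : has_basis a b G -> (0 < x < 1)%R -> ~ G (x * a + y * b).
Proof.
  intros HB Hx Hz. destruct (basis_coords a b G x y HB Hz) as [m [n [E _]]].
  apply (not_int_half x m); auto.
Qed.

Lemma basis_off_y a b G (x y : R) : has_basis a b G -> (0 < y < 1)%R -> ~ G (x * a + y * b).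
Proof.
  intros HB Hy Hz. destruct (basis_coords a b G x y HB Hz) as [m [n [_ E]]].
  apply (not_int_half y n); auto.
Qed.

Lemma basis_swap a b G : has_basis a b G -> has_basis b a G.
Proof.
  intros [Hd HG]. split.
  - replace (Im (a * Cconj b)) with (- Im (b * Cconj a))%R by (destruct a, b; simpl; ring).
    lra.
  - intros z. rewrite HG. split; intros [m [n ->]]; exists n, m; ring.
Qed.

Lemma basis_shear a b G (k : Z) : has_basis a b G -> has_basis a (b + IZR k * a) G.
Proof.
  intros [Hd HG]. split.
  - replace (Im ((b + IZR k * a) * Cconj a)) with (Im (b * Cconj a))
      by (destruct a, b; simpl; ring). auto.
  - intros z. rewrite HG. split; intros [m [n ->]].
    + exists (m - n * k)%Z, n. rewrite minus_IZR, mult_IZR, RtoC_minus, RtoC_mult. ring.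
    + exists (m + n * k)%Z, n. rewrite plus_IZR, mult_IZR, RtoC_plus, RtoC_mult. ring.
Qed.

Lemma basis_neg a b G : has_basis a b G -> has_basis a (- b) G.
Proof.
  intros [Hd HG]. split.
  - replace (Im (- b * Cconj a)) with (- Im (b * Cconj a))%R by (destruct a, b; simpl; ring).
    lra.
  - intros z. rewrite HG. split; intros [m [n ->]]; exists m, (- n)%Z;
      rewrite opp_IZR, RtoC_opp; ring.
Qed.

Lemma basis_plus a b G : has_basis a b G -> has_basis a (b + a) G.
Proof.
  intros H. apply (basis_shear a b G 1) in H.
  replace (b + 1 * a) with (b + a) in H by ring. auto.
Qed.

Lemma basis_in_l a b G : has_basis a b G -> G a.
Proof. intros [_ HG]. apply HG. exists 1%Z, 0%Z. ring. Qed.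

Lemma basis_in_r a b G : has_basis a b G -> G b.
Proof. intros H. apply (basis_in_l b a), basis_swap; auto. Qed.

Lemma basis_primitive_l a b G : has_basis a b G -> primitive G a.
Proof.
  intros HB. split; [apply (basis_in_l a b); auto|].
  intros t Ht. replace (t * (a / 2)) with ((t / 2)%R * a + 0%R * b).
  - apply basis_off_x; auto. lra.
  - unfold Rdiv. rewrite RtoC_mult, RtoC_inv by lra. unfold Cdiv. ring.
Qed.

Lemma basis_primitive_r a b G : has_basis a b G -> primitive G b.
Proof. intros H. apply (basis_primitive_l b a), basis_swap; auto. Qed.

Lemma P_pole G (B : R) : summable_lattice G ->
  exists d, (0 < d)%R /\ forall z, (0 < Cmod z < d)%R -> (B < Cmod (Psum G z))%R.
Proof.
  intros HG.
  assert (O : bigO 1 (fun z => z ^ 2 * Psum G z - 1)).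
  { eapply bigO_ext; [|apply bigO_plus; [apply (bigO_le 1 7 _ ltac:(lia) (P_exp7 G HG))|
      apply (bigO_plus 1)]].
    2: apply bigO_scal, (bigO_le 1 4 _ ltac:(lia) (bigO_pow 4)).
    2: apply bigO_scal, (bigO_le 1 6 _ ltac:(lia) (bigO_pow 6)).
    intros z _; cbv beta.
    instantiate (1 := 5 * Esum G 6). instantiate (1 := 3 * Esum G 4). ring. }
  destruct O as [K [d [HK [Hd H]]]].
  exists (Rmin d (Rmin (1 / (2 * (K + 1))) (1 / (2 * (Rabs B + 1))))).
  pose proof (Rabs_pos B). pose proof (Rle_abs B).
  split.
  { repeat apply Rmin_glb_lt; try lra; apply Rdiv_lt_0_compat; lra. }
  intros z [Hz1 Hz2].
  apply Rmin_Rgt in Hz2 as [Hz2 Hz3]. apply Rmin_Rgt in Hz3 as [Hz3 Hz4].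
  specialize (H z ltac:(lra)).
  apply Rgt_lt, Rlt_div_r in Hz3; [|lra]. apply Rgt_lt, Rlt_div_r in Hz4; [|lra].
  rewrite pow_1 in H.
  assert (A : (Cmod 1 <= Cmod (z ^ 2 * Psum G z) + Cmod (z ^ 2 * Psum G z - 1))%R).
  { replace (RtoC 1) with (z ^ 2 * Psum G z + - (z ^ 2 * Psum G z - 1)) at 1 by ring.
    eapply Rle_trans; [apply Cmod_triangle|]. rewrite Cmod_opp. lra. }
  rewrite Cmod_1, Cmod_mult, Cmod_pow in A.
  assert (A2 : (1 / 2 <= Cmod z ^ 2 * Cmod (Psum G z))%R) by nra.
  apply Rnot_le_lt; intros HB.
  pose proof (Cmod_ge_0 (Psum G z)).
  assert (Cmod z <= 1)%R by lra.
  assert (Cmod z ^ 2 <= Cmod z)%R by nra.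
  assert (Cmod z ^ 2 * Cmod (Psum G z) <= Cmod z * Rabs B)%R.
  { apply Rmult_le_compat; try nra. }
  nra.
Qed.

(* If [e1 = e2] then [P (a / 2 + z)] and [P (b / 2 + z)] solve the same second order
   equation with the same initial values, but only the first one has a pole at
   [z = a / 2]. *)
Lemma half_distinct a b G : has_basis a b G -> Psum G (a / 2) <> Psum G (b / 2).
Proof.
  intros HB E12. pose proof (basis_slat a b G HB) as HG.
  pose proof (basis_in_l a b G HB) as Ha. pose proof (basis_in_r a b G HB) as Hb.
  set (h := a / 2).
  set (p1 := fun s : R => Psum G (a / 2 + s * h)).
  set (p2 := fun s : R => Psum G (b / 2 + s * h)).
  set (q1 := fun s : R => Ssum G 3 (a / 2 + s * h)).
  set (q2 := fun s : R => Ssum G 3 (b / 2 + s * h)).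
  assert (A1 : forall s : R, a / 2 + s * h = ((1 + s) / 2)%R * a + 0%R * b).
  { intros s. unfold h, Rdiv. rewrite RtoC_mult, RtoC_inv, RtoC_plus by lra. unfold Cdiv. ring. }
  assert (A2 : forall s : R, b / 2 + s * h = (s / 2)%R * a + (1 / 2)%R * b).
  { intros s. unfold h, Rdiv. rewrite !RtoC_mult, RtoC_inv by lra. unfold Cdiv. ring. }
  assert (R1 : forall s : R, (0 <= s < 1)%R -> forall t : R, (0 < t <= 1)%R ->
     ~ G (t * (a / 2 + s * h))).
  { intros s Hs t Ht. rewrite A1.
    replace (t * (((1 + s) / 2)%R * a + 0%R * b)) with ((t * ((1 + s) / 2))%R * a + 0%R * b)
      by (rewrite RtoC_mult; ring).
    apply basis_off_x; auto. split; [apply Rmult_lt_0_compat; lra|nra]. }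
  assert (R2 : forall s : R, forall t : R, (0 < t <= 1)%R -> ~ G (t * (b / 2 + s * h))).
  { intros s t Ht. rewrite A2.
    replace (t * ((s / 2)%R * a + (1 / 2)%R * b)) with ((t * (s / 2))%R * a + (t * (1 / 2))%R * b)
      by (rewrite !RtoC_mult; ring).
    apply basis_off_y; auto. lra. }
  assert (N1 : forall s : R, (0 <= s < 1)%R -> ~ G (a / 2 + s * h)).
  { intros s Hs. apply (ray_nonzero G); auto. }
  assert (N2 : forall s : R, ~ G (b / 2 + s * h)).
  { intros s. apply (ray_nonzero G); auto. }
  assert (D1 : forall s, (0 <= s < 1)%R -> cderiv p1 s (h * (- (2) * q1 s))).
  { intros s Hs. apply qderiv_line, P_qderiv; auto. }
  assert (D2 : forall s, cderiv p2 s (h * (- (2) * q2 s))).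
  { intros s. apply qderiv_line, P_qderiv; auto. }
  assert (F1 : forall s, (0 <= s < 1)%R ->
     cderiv q1 s (h * (- INR 3 * (p1 s ^ 2 - 5 * Esum G 4)))).
  { intros s Hs. unfold p1. rewrite <- ode2_ray by auto. apply qderiv_line, S_qderiv; auto. }
  assert (F2 : forall s, cderiv q2 s (h * (- INR 3 * (p2 s ^ 2 - 5 * Esum G 4)))).
  { intros s. unfold p2. rewrite <- ode2_ray by auto. apply qderiv_line, S_qderiv; auto. }
  assert (cminus : forall f g t l m, cderiv f t l -> cderiv g t m ->
     cderiv (fun s => f s - g s) t (l - m)).
  { intros f g t l m [f1 f2] [g1 g2]. split.
    - apply (is_derive_ext (fun s => Re (f s) - Re (g s))%R); [reflexivity|].
      apply @is_derive_minus; auto.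
    - apply (is_derive_ext (fun s => Im (f s) - Im (g s))%R); [reflexivity|].
      apply @is_derive_minus; auto. }
  assert (EQ : forall T, (0 <= T < 1)%R -> p1 T = p2 T).
  { intros T HT.
    destruct (cderiv_bounded p1 (fun s => h * (- (2) * q1 s)) T) as [B1 [HB1 BB1]];
      [lra|intros; apply D1; lra|].
    destruct (cderiv_bounded p2 (fun s => h * (- (2) * q2 s)) T) as [B2 [HB2 BB2]];
      [lra|intros; apply D2; lra|].
    apply sub_eq_0.
    (* The difference of the two nonlinear equations is linear: [p1 ^ 2 - p2 ^ 2] is
       [(p1 + p2) (p1 - p2)] and the constant [5 E4] cancels. Both [p1] and [p2] are bounded on the
       segment, hence so is the coefficient. *)
    apply (gronwall2 (fun s => p1 s - p2 s) (fun s => q1 s - q2 s)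
      (fun s => - (3) * h * (p1 s + p2 s)) (- (2) * h) T (3 * Cmod h * (B1 + B2))%R).
    - lra.
    - intros t Ht. replace (- (2) * h * (q1 t - q2 t)) with
        (h * (- (2) * q1 t) - h * (- (2) * q2 t)) by ring.
      apply cminus; [apply D1; lra|apply D2].
    - intros t Ht. replace (- (3) * h * (p1 t + p2 t) * (p1 t - p2 t)) with
        (h * (- INR 3 * (p1 t ^ 2 - 5 * Esum G 4)) - h * (- INR 3 * (p2 t ^ 2 - 5 * Esum G 4))).
      + apply cminus; [apply F1; lra|apply F2].
      + replace (INR 3) with 3%R by (simpl; ring). ring.
    - intros t Ht. rewrite !Cmod_mult, Cmod_opp, Cmod_R, Rabs_pos_eq by lra.
      apply Rmult_le_compat_l; [pose proof (Cmod_ge_0 h); lra|].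
      eapply Rle_trans; [apply Cmod_triangle|]. specialize (BB1 t Ht). specialize (BB2 t Ht). lra.
    - unfold p1, p2. rewrite !Cmult_0_l, !Cplus_0_r, E12. ring.
    - unfold q1, q2. rewrite !Cmult_0_l, !Cplus_0_r, !S3_half by auto. ring. }
  destruct (cderiv_bounded p2 (fun s => h * (- (2) * q2 s)) 1) as [B2 [HB2 BB2]];
    [lra|intros; apply D2|].
  destruct (P_pole G B2 HG) as [d [Hd Hp]].
  assert (Hh : (0 < Cmod h)%R).
  { apply Cmod_gt_0. intros E0. apply (N1 0%R); [lra|]. unfold h in E0.
    rewrite Cmult_0_l, Cplus_0_r, E0. apply HG. }
  (* At parameter [1 - x] the first point is [a - x h], so close to the lattice point [a] that [P]
     exceeds there the bound [B2] of [p2]. *)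
  set (x := Rmin 1 (d / (2 * Cmod h))).
  assert (Hx : (0 < x)%R).
  { unfold x. apply Rmin_glb_lt; [lra|]. apply Rdiv_lt_0_compat; lra. }
  pose proof (Rmin_l 1 (d / (2 * Cmod h))) as X1. pose proof (Rmin_r 1 (d / (2 * Cmod h))) as X2.
  fold x in X1, X2.
  assert (X3 : (x * Cmod h < d)%R).
  { apply Rle_lt_trans with (d / (2 * Cmod h) * Cmod h)%R; [apply Rmult_le_compat_r; lra|].
    replace (d / (2 * Cmod h) * Cmod h)%R with (d / 2)%R by (field; lra). lra. }
  specialize (Hp (x * h)). rewrite Cmod_mult, Cmod_R, Rabs_pos_eq in Hp by lra.
  assert (X4 : (0 < x * Cmod h)%R) by (apply Rmult_lt_0_compat; auto).
  specialize (Hp ltac:(lra)).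
  specialize (EQ (1 - x)%R ltac:(lra)). specialize (BB2 (1 - x)%R ltac:(lra)).
  rewrite <- EQ in BB2. unfold p1 in BB2.
  replace (a / 2 + (1 - x)%R * h) with (- (x * h) + a) in BB2.
  - rewrite P_periodic, P_opp in BB2 by auto. lra.
  - rewrite RtoC_minus. unfold h. field.
Qed.

Lemma half_facts a b G : has_basis a b G ->
  let e1 := Psum G (a / 2) in let e2 := Psum G (b / 2) in
  let e3 := Psum G ((b + a) / 2) in
  (e1 <> e2 /\ e1 <> e3 /\ e2 <> e3) /\ e1 + e2 + e3 = 0 /\
  15 * Esum G 4 = - (e1 * e2 + e1 * e3 + e2 * e3) /\ 35 * Esum G 6 = e1 * e2 * e3.
Proof.
  intros HB e1 e2 e3. pose proof (basis_slat a b G HB) as HG.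
  assert (N12 : e1 <> e2) by (apply (half_distinct a b); auto).
  assert (N13 : e1 <> e3) by (apply (half_distinct a (b + a)), basis_plus; auto).
  assert (N23 : e2 <> e3).
  { unfold e3. rewrite Cplus_comm. apply (half_distinct b (a + b)), basis_plus, basis_swap; auto. }
  split; auto. apply cubic_vieta; auto; apply half_cubic; auto.
  - apply (basis_primitive_l a b); auto.
  - apply (basis_primitive_r a b); auto.
  - apply (basis_primitive_r a (b + a)), basis_plus; auto.
Qed.

(** * Power sums over the shortest vectors *)

(** Half-angle formula: for [c] of modulus 1, [(1 + c) ^ 2] is [c * Cmod (1 + c) ^ 2], so [1 + c]
    divided by its modulus is a square root of [c], unless [c = - 1]. *)
Lemma unit_sqrt (c : C) : Cmod c = 1%R -> exists s, Cmod s = 1%R /\ s ^ 2 = c.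
Proof.
  intros Hc. destruct (classic (1 + c = 0)) as [E|Hn].
  - exists Ci. split; [apply Cmod_Ci|].
    replace c with (1 + c - 1) by ring. rewrite E.
    unfold Ci, RtoC, Cpow, Cmult, Cminus, Cplus, Copp; simpl. f_equal; ring.
  - set (r := Cmod (1 + c)). assert (Hr : (0 < r)%R) by (apply Cmod_gt_0; auto).
    assert (Hr0 : RtoC r <> 0) by (intros E; apply RtoC_inj in E; lra).
    assert (Hcc : c * Cconj c = 1) by (rewrite <- Cmod2_conj, Hc; f_equal; ring).
    exists ((1 + c) / r). split.
    + rewrite Cmod_div, Cmod_R, Rabs_pos_eq by (auto; lra). fold r. field; lra.
    + assert (E : RtoC r ^ 2 = (1 + c) * Cconj (1 + c)).
      { rewrite <- RtoC_pow. apply Cmod2_conj. }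
      rewrite Cplus_conj in E. replace (Cconj 1) with (RtoC 1) in E
        by (unfold Cconj, RtoC; simpl; f_equal; ring).
      assert (E2 : c * RtoC r ^ 2 = (1 + c) ^ 2).
      { rewrite E. transitivity ((1 + c) * (c + c * Cconj c)); [ring|]. rewrite Hcc. ring. }
      unfold Cdiv. rewrite Cpow_mult_l, <- E2, <- Cinv_pow. field.
      auto.
Qed.

Definition tends0 (f : nat -> C) : Prop :=
  forall eps, (0 < eps)%R -> exists N, forall k, (N <= k)%nat -> (Cmod (f k) < eps)%R.

Lemma tends0_shift f y : tends0 f -> tends0 (fun k => f (S k) - y * f k).
Proof.
  intros H eps He. pose proof (Cmod_ge_0 y).
  destruct (H (eps / (Cmod y + 1))%R) as [N HN]; [apply Rdiv_lt_0_compat; lra|].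
  exists N. intros k Hk. pose proof (HN k Hk) as H1. pose proof (HN (S k) ltac:(lia)) as H2.
  apply Rlt_div_r in H1; [|lra]. apply Rlt_div_r in H2; [|lra].
  eapply Rle_lt_trans; [apply Cmod_triangle|]. rewrite Cmod_opp, Cmod_mult.
  pose proof (Cmod_ge_0 (f k)). pose proof (Cmod_ge_0 (f (S k))). nra.
Qed.

Definition power_sum (l : list (C * C)) (k : nat) : C :=
  csum (fun p => fst p * snd p ^ k) l.

(** A base may occur several times in the list, so only the total of its coefficients has a
    meaning. *)
Definition weight_at (l : list (C * C)) (y : C) : C :=
  csum (fun p => if eq_em (snd p) y then fst p else 0) l.

(* Applying [f k -> f (k + 1) - y f k] removes the base [y] and multiplies the
   coefficient of any other base [y0] by [y0 - y]. *)
Lemma power_sum_weight (y0 : C) : Cmod y0 = 1%R -> forall n l c0, length l = n ->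
  tends0 (fun k => c0 * y0 ^ k + power_sum l k) -> c0 + weight_at l y0 = 0.
Proof.
  intros Hy0. induction n; intros l c0 Hl H.
  - destruct l; [|discriminate]. unfold weight_at, csum; simpl. rewrite Cplus_0_r.
    apply NNPP; intros Hn. apply Cmod_gt_0 in Hn.
    destruct (H _ Hn) as [N HN]. specialize (HN N (le_n N)).
    unfold power_sum, csum in HN; simpl in HN.
    rewrite Cplus_0_r, Cmod_mult, Cmod_pow, Hy0, pow1 in HN. lra.
  - destruct l as [|[c y] l]; [discriminate|]. injection Hl as Hl.
    unfold weight_at, csum; simpl. fold (csum (fun p : C * C => if eq_em (snd p) y0 then fst p else 0) l).
    fold (weight_at l y0).
    destruct (eq_em y y0) as [->|Hne].
    + rewrite Cplus_assoc. apply IHn; auto.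
      intros eps He. destruct (H eps He) as [N HN]. exists N. intros k Hk.
      replace ((c0 + c) * y0 ^ k + power_sum l k) with
        (c0 * y0 ^ k + power_sum ((c, y0) :: l) k); auto.
      unfold power_sum, csum; simpl. ring.
    + rewrite Cplus_0_l.
      set (l' := map (fun p : C * C => (fst p * (snd p - y), snd p)) l).
      assert (E : c0 * (y0 - y) + weight_at l' y0 = 0).
      { apply IHn; [unfold l'; rewrite length_map; auto|].
        pose proof (tends0_shift _ y H) as HS.
        intros eps He. destruct (HS eps He) as [N HN]. exists N. intros k Hk.
        specialize (HN k Hk).
        match goal with |- (Cmod ?x < _)%R => match type of HN with (Cmod ?z < _)%R =>
          replace x with z; auto end end.
        assert (Ep : power_sum l' k = power_sum l (S k) - y * power_sum l k).
        { unfold l', power_sum. rewrite csum_map. unfold Cminus.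
          replace (- (y * csum (fun p => fst p * snd p ^ k) l)) with
            (- y * csum (fun p => fst p * snd p ^ k) l) by ring.
          rewrite <- csum_scal, <- csum_plus. apply csum_ext_in. intros p _. simpl. ring. }
        rewrite Ep. unfold power_sum, csum. simpl. ring. }
      assert (Ew : weight_at l' y0 = (y0 - y) * weight_at l y0).
      { unfold l', weight_at. rewrite csum_map, <- csum_scal. apply csum_ext_in.
        intros p _. simpl. destruct eq_em as [->|]; ring. }
      rewrite Ew in E.
      assert (Hd : y0 - y <> 0) by (intros E0; apply Hne, eq_sym, sub_eq_0; auto).
      apply NNPP; intros Hn. apply (Cmult_neq_0 (y0 - y) (c0 + weight_at l y0)); auto.
      rewrite <- E. ring.
Qed.

Lemma Re_csum_le {T : Type} (f : T -> C) l x : (forall y, (Re (f y) <= 0)%R) -> In x l ->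
  (Re (csum f l) <= Re (f x))%R.
Proof.
  intros Hf. induction l; [easy|]. unfold csum in *. simpl map. simpl Csum.
  assert (N : forall k, (Re (Csum (map f k)) <= 0)%R).
  { clear - Hf. induction k; simpl; [lra|]. specialize (Hf a). unfold Re in *; simpl. lra. }
  intros [<-|Hx].
  - specialize (N l). unfold Re in *; simpl. lra.
  - specialize (IHl Hx). specialize (Hf a). unfold Re in *; simpl. lra.
Qed.

(** The bases [x v] get weight 1 and their conjugates weight -1. If [Cconj (x a)] were not among the
    [x v], nothing could compensate its negative weight, whereas [power_sum_weight] says that the
    total is 0. *)
Lemma conj_base (l : list C) (x : C -> C) (a : C) : In a l -> Cmod (x a) = 1%R ->
  tends0 (fun k => csum (fun v => x v ^ k) l - Cconj (csum (fun v => x v ^ k) l)) ->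
  exists v, In v l /\ x v = Cconj (x a).
Proof.
  intros Ha Hx H. apply NNPP; intros Hn.
  set (L := map (fun v => (RtoC 1, x v)) l ++ map (fun v => (- RtoC 1, Cconj (x v))) l).
  assert (E : 0 + weight_at L (Cconj (x a)) = 0).
  { apply (power_sum_weight (Cconj (x a)) ltac:(rewrite Cmod_conj; auto) (length L)); auto.
    intros eps He. destruct (H eps He) as [N HN]. exists N. intros k Hk.
    specialize (HN k Hk). match goal with |- (Cmod ?x < _)%R => match type of HN with
      (Cmod ?z < _)%R => replace x with z; auto end end.
    unfold L, power_sum. rewrite csum_app, !csum_map. cbn [fst snd].
    replace (Cconj (csum (fun v => x v ^ k) l)) with (csum (fun v => Cconj (x v) ^ k) l).
    - replace (csum (fun v => - RtoC 1 * Cconj (x v) ^ k) l) with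
        (- (1) * csum (fun v => Cconj (x v) ^ k) l) by (rewrite <- csum_scal; auto).
      replace (csum (fun v => RtoC 1 * x v ^ k) l) with (csum (fun v => x v ^ k) l)
        by (apply csum_ext_in; intros; ring).
      ring.
    - clear. unfold csum. induction l; simpl.
      + unfold Cconj, RtoC; simpl. f_equal; ring.
      + rewrite IHl, Cplus_conj, Cpow_conj. auto. }
  rewrite Cplus_0_l in E. unfold weight_at, L in E.
  rewrite csum_app, !csum_map in E. cbn [fst snd] in E.
  rewrite csum_zero, Cplus_0_l in E.
  - pose proof (Re_csum_le (fun v => if eq_em (Cconj (x v)) (Cconj (x a)) then - RtoC 1 else 0)
      l a) as R. rewrite E in R. cbv beta in R.
    destruct (eq_em (Cconj (x a)) (Cconj (x a))) as [_|]; [|easy].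
    assert (Re 0 <= Re (- RtoC 1))%R as C; [|simpl in C; lra].
    apply R; auto. intros y. destruct eq_em; simpl; lra.
  - intros v Hv. destruct eq_em as [Ev|]; auto. exfalso; eauto.
Qed.

(** * Shortest vectors and the asymptotics of the sums *)

Lemma finite_list {T : Type} (P : T -> Prop) (N : nat) :
  (forall l, NoDup l -> List.Forall P l -> (length l <= N)%nat) ->
  exists l, NoDup l /\ forall x, In x l <-> P x.
Proof.
  intros H. apply NNPP; intros Hn.
  assert (A : forall k, exists l, NoDup l /\ List.Forall P l /\ length l = k).
  { induction k as [|k [l [Hl [HP HL]]]].
    - exists nil. repeat split; constructor.
    - destruct (classic (exists x, P x /\ ~ In x l)) as [[x [Hx Hx']]|Hno].
      + exists (x :: l). repeat split; [constructor; auto|constructor; auto|simpl; auto].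
      + exfalso. apply Hn. exists l. split; auto. intros x. split.
        * rewrite Forall_forall in HP. apply HP.
        * intros Hx. apply NNPP; intros Hx'. apply Hno. exists x; auto. }
  destruct (A (S N)) as [l [Hl [HP HL]]]. specialize (H l Hl HP). lia.
Qed.

(** Every point of [G] in the disk contributes at least [wt (RtoC r)] to sums that are bounded. *)
Lemma finite_disk G r : summable_lattice G -> exists l, NoDup l /\
  forall u, In u l <-> G u /\ (Cmod u <= r)%R.
Proof.
  intros HG. destruct (proj2 (proj2 HG)) as [Hp [M HM]].
  destruct (Rlt_dec r 0) as [Hr|Hr].
  { exists nil. split; [constructor|]. intros u; split; [easy|].
    intros [_ H]. pose proof (Cmod_ge_0 u). lra. }
  apply Rnot_lt_le in Hr.
  set (c := wt (RtoC r)). assert (Hc : (0 < c)%R) by apply wt_pos.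
  destruct (Z_of_nat_complete (Z.max 0 (up (M / c)))) as [N HN]; [lia|].
  apply (finite_list _ N).
  intros l Hl HP.
  assert (B : (c * INR (length l) <= rsum (fun u => chiR G u * wt u) l)%R).
  { clear Hl. induction HP as [|u l [Hu Hur] HP IH]; [simpl; lra|].
    cbn [rsum length]. rewrite S_INR, chiR_1 by auto.
    assert (c <= wt u)%R; [|lra].
    unfold c. change (w52 (1 + Cmod (RtoC r)) <= w52 (1 + Cmod u))%R.
    rewrite Cmod_R, Rabs_pos_eq by auto. apply w52_le. pose proof (Cmod_ge_0 u). lra. }
  specialize (HM l Hl).
  assert (INR (length l) <= M / c)%R by (apply Rle_div_r; lra).
  pose proof (archimed (M / c)) as [A1 _].
  apply INR_le. rewrite (INR_IZR_INZ N), <- HN.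
  eapply Rle_trans; [apply H|]. eapply Rle_trans; [left; apply A1|]. apply IZR_le. lia.
Qed.

Lemma has_sum_finite {T : Type} (f : T -> C) l : NoDup l ->
  (forall x, ~ In x l -> f x = 0) -> has_sum f (csum f l).
Proof.
  intros Hl Hf eps He. exists l. intros l' Hl' I.
  rewrite (csum_split f (mem l) l').
  rewrite (csum_zero f (filter (fun x => negb (mem l x)) l')).
  - rewrite (csum_same f (filter (mem l) l') l); auto.
    + replace (csum f l + 0 - csum f l) with (RtoC 0) by ring. rewrite Cmod_0; auto.
    + apply NoDup_filter; auto.
    + intros x. rewrite filter_In, mem_true. split; [tauto|auto].
  - intros x Hx. apply filter_In in Hx as [_ Hx]. apply Hf. intros Hn.
    apply mem_true in Hn. rewrite Hn in Hx. discriminate.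
Qed.

Definition shortest (G : C -> Prop) (v : C) : Prop :=
  G v /\ v <> 0 /\ forall u, G u -> u <> 0 -> (Cmod v <= Cmod u)%R.

Lemma pow_ratio_small (r eps : R) : (0 <= r < 1)%R -> (0 < eps)%R ->
  exists N, forall k, (N <= k)%nat -> (r ^ k < eps)%R.
Proof.
  intros Hr He. destruct (pow_lt_1_zero r ltac:(rewrite Rabs_pos_eq; lra) eps He) as [N HN].
  exists N. intros k Hk. specialize (HN k Hk). rewrite Rabs_pos_eq in HN; auto.
  apply pow_le; lra.
Qed.

(** After scaling, vectors of length [Cmod lam] give terms of modulus 1, and longer ones give terms
    tending to 0. Only the length of [lam] is prescribed; its direction is left free for a later
    rotation. *)
Lemma Esum_asymptotic G (lam : C) l : summable_lattice G -> lam <> 0 ->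
  (forall u, G u -> u <> 0 -> (Cmod lam <= Cmod u)%R) ->
  NoDup l -> (forall u, In u l <-> G u /\ Cmod u = Cmod lam) ->
  tends0 (fun k => Esum G (2 * k) * lam ^ (2 * k) - csum (fun v => ((lam / v) ^ 2) ^ k) l).
Proof.
  intros HG Hl0 Hmin Hl Il eps He.
  pose proof (proj1 (Cmod_gt_0 lam) Hl0) as Pl.
  (* The shift by 2 keeps the exponent at least 4, where the series converges absolutely and the
     terms with [/ u ^ 4] can serve as a majorant for all [k]. *)
  set (f := fun (k : nat) u => chi G u * (lam / u) ^ (2 * (k + 2)) *
              (if excluded_middle_informative (Cmod u = Cmod lam) then 0 else 1)).
  assert (Hs : forall k, has_sum (f k) (Esum G (2 * (k + 2)) * lam ^ (2 * (k + 2))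
     - csum (fun v => ((lam / v) ^ 2) ^ (k + 2)) l)).
  { intros k. set (n := (2 * (k + 2))%nat).
    assert (A : has_sum (fun u => chi G u * (lam / u) ^ n) (Esum G n * lam ^ n)).
    { rewrite Cmult_comm. eapply has_sum_ext; [|apply has_sum_scal, (E_has_sum G n); auto].
      - intros u; cbv beta. unfold Cdiv. rewrite Cpow_mult_l, Cinv_pow. ring.
      - unfold n; lia. }
    set (fs := fun u => chi G u * (lam / u) ^ n *
       (if excluded_middle_informative (Cmod u = Cmod lam) then 1 else 0)).
    assert (B : has_sum fs (csum fs l)).
    { apply has_sum_finite; auto. intros x Hx. unfold fs.
      destruct (classic (G x)) as [HGx|HGx].
      - destruct excluded_middle_informative; [|ring]. exfalso; apply Hx, Il; auto.
      - rewrite chi_0 by auto. ring. }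
    assert (E : csum fs l = csum (fun v => ((lam / v) ^ 2) ^ (k + 2)) l).
    { apply csum_ext_in. intros v Hv. apply Il in Hv as [Hv1 Hv2]. unfold fs.
      rewrite chi_1 by auto. destruct excluded_middle_informative; [|easy].
      unfold n. rewrite Cpow_mult_r. ring. }
    rewrite <- E. eapply has_sum_ext; [|apply has_sum_minus; [exact A|exact B]].
    intros u. unfold f, fs. fold n. destruct excluded_middle_informative; ring. }
  assert (D : eventually (fun k => Cmod ((Esum G (2 * (k + 2)) * lam ^ (2 * (k + 2))
     - csum (fun v => ((lam / v) ^ 2) ^ (k + 2))%C l) - 0) < eps)%R).
  { pose proof (E_abs G 4 HG ltac:(lia)) as S4.
    apply (dominated_sum eventually f (fun _ => 0)
      (fun u => Cmod lam ^ 4 * Cmod (chi G u * / u ^ 4))%R _ 0); auto.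
    - apply summable_scal; auto. apply pow_le; lra.
    - exists 0%nat. intros k _ u. unfold f. rewrite !Cmod_mult, Cmod_chi.
      pose proof (chiR_bounds G u).
      assert (0 <= Cmod lam ^ 4 * (chiR G u * Cmod (/ u ^ 4)))%R.
      { apply Rmult_le_pos; [apply pow_le; lra|]. apply Rmult_le_pos; [lra|apply Cmod_ge_0]. }
      destruct excluded_middle_informative; [rewrite Cmod_0, Rmult_0_r; auto|].
      rewrite Cmod_1, Rmult_1_r.
      destruct (classic (G u)) as [Hu|Hu]; [|rewrite chiR_0 by auto; rewrite chiR_0 in H0 by auto; lra].
      destruct (classic (u = 0)) as [->|Hu0].
      { unfold Cdiv. rewrite Cinv_0, Cmult_0_r, Cmod_pow, Cmod_0, pow_i by lia. rewrite Rmult_0_r. auto. }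
      replace (Cmod lam ^ 4 * (chiR G u * Cmod (/ u ^ 4)))%R with
        (chiR G u * Cmod (lam / u) ^ 4)%R.
      + apply Rmult_le_compat_l; [lra|]. rewrite Cmod_pow.
        specialize (Hmin u Hu Hu0). pose proof (proj1 (Cmod_gt_0 u) Hu0).
        rewrite Cmod_div by auto.
        assert (0 <= Cmod lam / Cmod u <= 1)%R.
        { split; [apply Rlt_le, Rdiv_lt_0_compat; lra|]. apply Rle_div_l; lra. }
        replace (2 * (k + 2))%nat with (2 * k + 4)%nat by lia. rewrite pow_add.
        rewrite <- (Rmult_1_l ((Cmod lam / Cmod u) ^ 4)) at 2.
        apply Rmult_le_compat_r; [apply pow_le; lra|].
        rewrite <- (pow1 (2 * k)). apply pow_incr; lra.
      + unfold Cdiv. rewrite Cmod_mult, Rpow_mult_distr, (Cinv_pow u), Cmod_pow. ring.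
    - intros u. rewrite Cmod_0. apply Rmult_le_pos; [apply pow_le; lra|apply Cmod_ge_0].
    - intros u e Hpe. unfold f.
      assert (Z : forall k, (0 = 0)%R -> chi G u = 0 \/ u = 0 \/ Cmod u = Cmod lam ->
        (Cmod (chi G u * (lam / u) ^ (2 * (k + 2)) *
          (if excluded_middle_informative (Cmod u = Cmod lam) then 0 else 1) - 0) < e)%R).
      { intros k _ HZ.
        match goal with |- (Cmod ?x < _)%R => replace x with (RtoC 0); [rewrite Cmod_0; auto|] end.
        destruct HZ as [->|[->|HZ]].
        - ring.
        - unfold Cdiv. rewrite Cinv_0, Cmult_0_r.
          replace (2 * (k + 2))%nat with (S (2 * k + 3)) by lia. rewrite Cpow_S. ring.
        - destruct excluded_middle_informative; [ring|easy]. }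
      destruct (classic (G u)) as [Hu|Hu].
      2: { exists 0%nat; intros; apply Z; auto. left; apply chi_0; auto. }
      destruct (classic (u = 0)) as [Hu0|Hu0].
      { exists 0%nat; intros; apply Z; auto. }
      destruct (classic (Cmod u = Cmod lam)) as [Hul|Hul].
      { exists 0%nat; intros; apply Z; auto. }
      specialize (Hmin u Hu Hu0).
      destruct (pow_ratio_small (Cmod lam / Cmod u) e) as [N HN]; auto.
      { split; [apply Rlt_le, Rdiv_lt_0_compat; lra|]. apply Rlt_div_l; lra. }
      exists N. intros k Hk.
      match goal with |- (Cmod (?x - _) < _)%R => replace (x - 0) with x by ring end.
      rewrite !Cmod_mult, Cmod_chi, chiR_1, Cmod_pow, Cmod_div by auto.
      destruct excluded_middle_informative; [easy|]. rewrite Cmod_1.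
      specialize (HN (2 * (k + 2))%nat ltac:(lia)). lra.
    - apply has_sum_zero. }
  destruct D as [N HN]. exists (N + 2)%nat. intros k Hk.
  specialize (HN (k - 2)%nat ltac:(lia)). replace (k - 2 + 2)%nat with k in HN by lia.
  match type of HN with (Cmod (?x - _) < _)%R => replace (x - 0) with x in HN by ring end.
  auto.
Qed.

(** * Reality of the lattice sums *)

Lemma Im_plus x y : Im (x + y) = (Im x + Im y)%R. Proof. reflexivity. Qed.
Lemma Im_minus x y : Im (x - y) = (Im x - Im y)%R. Proof. reflexivity. Qed.
Lemma Im_mult x y : Im (x * y) = (Re x * Im y + Im x * Re y)%R. Proof. reflexivity. Qed.
Lemma Im_scal (r : R) x : Im (r * x) = (r * Im x)%R.
Proof. destruct x; simpl; ring. Qed.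
Lemma Im_RtoC (r : R) : Im (RtoC r) = 0%R. Proof. reflexivity. Qed.

Lemma Im_csum_real {T : Type} (f : T -> C) l :
  (forall x, In x l -> Im (f x) = 0%R) -> Im (csum f l) = 0%R.
Proof.
  induction l; intros H; [reflexivity|]. unfold csum in *; simpl map; simpl Csum.
  rewrite Im_plus, IHl, H; [ring|left; auto|]. intros; apply H; right; auto.
Qed.

Lemma csum_seq1_S (f : nat -> C) N : csum f (seq 1 (S N)) = csum f (seq 1 N) + f (S N).
Proof. rewrite seq_S, csum_app. unfold csum at 2. simpl. ring. Qed.

Lemma small_ray_off G (z : C) : summable_lattice G -> exists d, (0 < d)%R /\
  forall s : R, (0 < s < d)%R -> z <> 0 -> forall t : R, (0 < t <= 1)%R -> ~ G (t * (s * z)).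
Proof.
  intros HG. destruct (proj1 (proj2 HG)) as [d [Hd H]]. pose proof (Cmod_ge_0 z).
  exists (d / (Cmod z + 1))%R. split; [apply Rdiv_lt_0_compat; lra|].
  intros s [Hs1 Hs2] Hz t Ht Hn. apply Rlt_div_r in Hs2; [|lra].
  pose proof (proj1 (Cmod_gt_0 z) Hz).
  assert (Hne : t * (s * z) <> 0).
  { repeat apply Cmult_neq_0; auto; intros E; apply RtoC_inj in E; lra. }
  specialize (H _ Hn Hne). rewrite !Cmod_mult, !Cmod_R, !Rabs_pos_eq in H by lra.
  assert (t * (s * Cmod z) <= 1 * (s * Cmod z))%R.
  { apply Rmult_le_compat_r; [|lra]. apply Rmult_le_pos; lra. }
  nra.
Qed.

(** The two numbers are the coefficients with which [E_M] enters [S4] and, linearly, [P ^ 2]. Their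
    difference is 0 at [M = 6], which reflects that [E6] is a free parameter of the equation for
    [P '']; beyond 6 it is positive. *)
Lemma gcoef_gap (M : nat) : (7 <= M)%nat -> (gcoef 4 (M - 4) - 2 * gcoef 2 (M - 2) > 0)%R.
Proof.
  intros H. rewrite gcoef_4, gcoef_2, !minus_INR by lia.
  assert (Hm : (7 <= INR M)%R) by (apply (le_INR 7) in H; simpl in H; lra).
  replace (INR 4) with 4%R by (simpl; ring). replace (INR 2) with 2%R by (simpl; ring).
  set (m := INR M) in *.
  replace ((m - 4 + 1) * (m - 4 + 2) * (m - 4 + 3) / 6 - 2 * (m - 2 + 1))%R with
    ((m - 1) * ((m - 2) * (m - 3) - 12) / 6)%R by field.
  assert (0 < (m - 1) * ((m - 2) * (m - 3) - 12))%R by (apply Rmult_lt_0_compat; nra). lra.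
Qed.

(** [A] and [B] stand for [z ^ 2 P] and [z ^ 4 S4] on a ray. Since [A] tends to 1, the relation
    between the imaginary parts gives [c2 g = 2 c1 g] at order [M], while [c2] exceeds [2 c1]. *)
Lemma real_coefficient (c1 c2 g K1 K2 K3 d : R) (M : nat) (A B : R -> C) :
  (0 < d <= 1)%R -> (0 <= K1)%R -> (0 <= K2)%R -> (0 <= K3)%R ->
  (forall s, (0 < s < d)%R -> Im (B s) = (2 * Re (A s) * Im (A s))%R) ->
  (forall s, (0 < s < d)%R -> (Rabs (Im (A s) - c1 * g * s ^ M) <= K1 * s ^ S M)%R) ->
  (forall s, (0 < s < d)%R -> (Rabs (Im (B s) - c2 * g * s ^ M) <= K2 * s ^ S M)%R) ->
  (forall s, (0 < s < d)%R -> (Rabs (Re (A s) - 1) <= K3 * s)%R) ->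
  (c2 - 2 * c1 > 0)%R -> g = 0%R.
Proof.
  intros Hd HK1 HK2 HK3 HE HA HB HR Hc.
  set (L := (K2 + 2 * (1 + K3) * K1 + 2 * K3 * Rabs (c1 * g))%R).
  pose proof (Rabs_pos (c1 * g)).
  assert (HL : (0 <= L)%R).
  { unfold L. assert (0 <= (1 + K3) * K1)%R by (apply Rmult_le_pos; lra).
    assert (0 <= K3 * Rabs (c1 * g))%R by (apply Rmult_le_pos; lra). lra. }
  assert (HS : forall s, (0 < s < d)%R -> ((c2 - 2 * c1) * Rabs g <= L * s)%R).
  { intros s Hs. specialize (HE s Hs). specialize (HA s Hs). specialize (HB s Hs).
    specialize (HR s Hs).
    assert (Ps : (0 < s ^ M)%R) by (apply pow_lt; lra).
    apply Rmult_le_reg_r with (s ^ M)%R; auto.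
    assert (E : ((c2 - 2 * c1) * g * s ^ M = - (Im (B s) - c2 * g * s ^ M)
       + 2 * Re (A s) * (Im (A s) - c1 * g * s ^ M) + 2 * (Re (A s) - 1) * (c1 * g) * s ^ M)%R).
    { rewrite HE. ring. }
    assert (E2 : ((c2 - 2 * c1) * Rabs g * s ^ M = Rabs ((c2 - 2 * c1) * g * s ^ M))%R).
    { rewrite !Rabs_mult, (Rabs_pos_eq (c2 - 2 * c1)), (Rabs_pos_eq (s ^ M)) by lra. ring. }
    rewrite E2, E.
    eapply Rle_trans; [apply Rabs_triang|].
    eapply Rle_trans; [apply Rplus_le_compat_r, Rabs_triang|].
    rewrite Rabs_Ropp.
    assert (B1 : (Rabs (2 * Re (A s) * (Im (A s) - c1 * g * s ^ M)) <=
        2 * (1 + K3) * (K1 * s ^ S M))%R).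
    { rewrite Rabs_mult, Rabs_mult, (Rabs_pos_eq 2) by lra.
      assert (Rabs (Re (A s)) <= 1 + K3)%R.
      { replace (Re (A s)) with (1 + (Re (A s) - 1))%R by ring.
        eapply Rle_trans; [apply Rabs_triang|]. rewrite Rabs_R1. nra. }
      pose proof (Rabs_pos (Re (A s))). pose proof (Rabs_pos (Im (A s) - c1 * g * s ^ M)).
      apply Rmult_le_compat; try lra. }
    assert (B2 : (Rabs (2 * (Re (A s) - 1) * (c1 * g) * s ^ M) <=
        2 * K3 * Rabs (c1 * g) * s ^ S M)%R).
    { rewrite !(Rabs_mult _ (s ^ M)), (Rabs_pos_eq (s ^ M)) by lra.
      rewrite (Rabs_mult _ (c1 * g)), (Rabs_mult 2), (Rabs_pos_eq 2) by lra.
      replace (2 * K3 * Rabs (c1 * g) * s ^ S M)%R with ((2 * (K3 * s) * Rabs (c1 * g)) * s ^ M)%R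
        by (simpl; ring).
      apply Rmult_le_compat_r; [lra|]. apply Rmult_le_compat_r; lra. }
    replace (L * s * s ^ M)%R with (L * s ^ S M)%R by (simpl; ring). unfold L.
    lra. }
  apply NNPP; intros Hg. pose proof (Rabs_pos_lt g Hg) as Pg.
  set (a := ((c2 - 2 * c1) * Rabs g)%R) in *.
  assert (Ha : (0 < a)%R) by (apply Rmult_lt_0_compat; lra).
  set (s := (Rmin d (a / (L + 1)) / 2)%R).
  assert (Hm : (0 < Rmin d (a / (L + 1)))%R).
  { apply Rmin_glb_lt; [lra|]. apply Rdiv_lt_0_compat; lra. }
  pose proof (Rmin_l d (a / (L + 1))). pose proof (Rmin_r d (a / (L + 1))).
  assert (Hs : (0 < s < d)%R) by (unfold s; lra).
  specialize (HS s Hs).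
  assert (s < a / (L + 1))%R by (unfold s; lra).
  apply Rlt_div_r in H2; [|lra]. nra.
Qed.

Lemma bigO_line n f (lam : C) : bigO n f -> exists K d, (0 <= K)%R /\ (0 < d <= 1)%R /\
  forall s : R, (0 < s < d)%R -> (Cmod (f (s * lam)%C) <= K * s ^ n)%R \/ lam = 0.
Proof.
  intros [K [d [HK [Hd H]]]]. pose proof (Cmod_ge_0 lam) as H0.
  exists (K * Cmod lam ^ n)%R, (d / (Cmod lam + 1))%R.
  repeat split.
  - apply Rmult_le_pos; auto. apply pow_le; auto.
  - apply Rdiv_lt_0_compat; lra.
  - apply Rle_div_l; lra.
  - intros s [Hs1 Hs2]. apply Rlt_div_r in Hs2; [|lra].
    destruct (classic (lam = 0)) as [|Hn]; auto. left.
    pose proof (proj1 (Cmod_gt_0 lam) Hn).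
    specialize (H (s * lam)). rewrite Cmod_mult, Cmod_R, Rabs_pos_eq in H by lra.
    assert (0 < s * Cmod lam)%R by (apply Rmult_lt_0_compat; auto).
    specialize (H ltac:(nra)). rewrite Rpow_mult_distr in H. lra.
Qed.

(* Comparing imaginary parts in [S4 = P ^ 2 - 5 E4] along the ray through [lam]:
   the coefficient of order [M] enters linearly once the lower ones are real. *)
Lemma Esum_real_step G (lam : C) M : summable_lattice G -> lam <> 0 -> (7 <= M)%nat ->
  (forall n, (3 <= n < M)%nat -> Im (Esum G n * lam ^ n) = 0%R) ->
  Im (Esum G M * lam ^ M) = 0%R.
Proof.
  intros HG Hl HM HI. set (g := Im (Esum G M * lam ^ M)).
  assert (Epow : forall (s : R) n, (s * lam) ^ n = RtoC (s ^ n) * lam ^ n).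
  { intros s n. rewrite Cpow_mult_l, RtoC_pow. auto. }
  destruct (bigO_line _ _ lam (P_expansion G (M - 2) HG)) as [K1 [d1 [HK1 [Hd1 B1]]]].
  destruct (bigO_line _ _ lam (S_expansion G 4 (M - 4) HG ltac:(lia))) as [K2 [d2 [HK2 [Hd2 B2]]]].
  destruct (bigO_line _ _ lam (P_exp7 G HG)) as [K3 [d3 [HK3 [Hd3 B3]]]].
  destruct (small_ray_off G lam HG) as [d4 [Hd4 B4]].
  set (d := Rmin (Rmin d1 d2) (Rmin d3 d4)).
  assert (Hd0 : (0 < d)%R) by (unfold d; repeat apply Rmin_glb_lt; lra).
  assert (Hd : (d <= d1 /\ d <= d2 /\ d <= d3 /\ d <= d4)%R).
  { unfold d. pose proof (Rmin_l (Rmin d1 d2) (Rmin d3 d4)).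
    pose proof (Rmin_r (Rmin d1 d2) (Rmin d3 d4)).
    pose proof (Rmin_l d1 d2). pose proof (Rmin_r d1 d2).
    pose proof (Rmin_l d3 d4). pose proof (Rmin_r d3 d4). lra. }
  set (A := fun s : R => (s * lam) ^ 2 * Psum G (s * lam)).
  set (B := fun s : R => (s * lam) ^ 4 * Ssum G 4 (s * lam)).
  set (q := Cmod (3 * Esum G 4 * lam ^ 4)). set (q' := Cmod (5 * Esum G 6 * lam ^ 6)).
  assert (HImle : forall x y r, (Cmod (x - y) <= r)%R -> (Rabs (Im x - Im y) <= r)%R).
  { intros x y r H. rewrite <- Im_minus. eapply Rle_trans; [apply im_le_Cmod|auto]. }
  apply (real_coefficient (gcoef 2 (M - 2)) (gcoef 4 (M - 4)) g K1 K2 (K3 + q + q') d M A B).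
  - lra.
  - auto.
  - auto.
  - pose proof (Cmod_ge_0 (3 * Esum G 4 * lam ^ 4)) as Q1.
    pose proof (Cmod_ge_0 (5 * Esum G 6 * lam ^ 6)) as Q2. unfold q, q'. lra.
  - intros s Hs.
    (* The term with [5 E4] is real on the ray by the hypothesis [HI], because 4 is less than [M];
       it disappears from the imaginary part. *)
    assert (E : B s = A s * A s - RtoC (5 * s ^ 4) * (Esum G 4 * lam ^ 4)).
    { unfold A, B. rewrite ode2_ray; auto.
      - rewrite RtoC_mult, RtoC_pow. ring.
      - apply B4; auto. lra. }
    rewrite E, Im_minus, Im_scal, HI, Im_mult by lia. ring.
  - intros s Hs. destruct (B1 s ltac:(lra)) as [H|]; [|easy].
    replace (M - 2 + 3)%nat with (S M) in H by lia. apply HImle in H.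
    fold (A s) in H.
    match type of H with (Rabs (_ - ?c) <= _)%R =>
      replace c with (gcoef 2 (M - 2) * g * s ^ M)%R in H; [auto|] end.
    rewrite Im_plus, Im_RtoC, Rplus_0_l.
    destruct (M - 2)%nat as [|m] eqn:Em; [lia|].
    rewrite csum_seq1_S, Im_plus, Im_csum_real.
    + replace (S m + 2)%nat with M by lia. rewrite Epow.
      replace (gcoef 2 (S m) * Esum G M * (RtoC (s ^ M) * lam ^ M)) with
        (RtoC (gcoef 2 (S m) * s ^ M) * (Esum G M * lam ^ M)) by (rewrite RtoC_mult; ring).
      rewrite Im_scal. unfold g. ring.
    + intros n Hn. apply in_seq in Hn. rewrite Epow.
      replace (gcoef 2 n * Esum G (n + 2) * (RtoC (s ^ (n + 2)) * lam ^ (n + 2))) with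
        (RtoC (gcoef 2 n * s ^ (n + 2)) * (Esum G (n + 2) * lam ^ (n + 2)))
        by (rewrite RtoC_mult; ring).
      rewrite Im_scal, HI by lia. ring.
  - intros s Hs. destruct (B2 s ltac:(lra)) as [H|]; [|easy].
    replace (S (M - 4) + 4)%nat with (S M) in H by lia. apply HImle in H.
    fold (B s) in H.
    match type of H with (Rabs (_ - ?c) <= _)%R =>
      replace c with (gcoef 4 (M - 4) * g * s ^ M)%R in H; [auto|] end.
    rewrite Im_plus, Im_RtoC, Rplus_0_l.
    rewrite csum_seq_S, Im_plus, Im_csum_real.
    + replace (M - 4 + 4)%nat with M by lia. rewrite Epow.
      replace ((- (1)) ^ 4 * gcoef 4 (M - 4) * Esum G M * (RtoC (s ^ M) * lam ^ M)) with
        (RtoC (gcoef 4 (M - 4) * s ^ M) * (Esum G M * lam ^ M)) by (rewrite RtoC_mult; ring).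
      rewrite Im_scal. unfold g. ring.
    + intros n Hn. apply in_seq in Hn. rewrite Epow.
      replace ((- (1)) ^ 4 * gcoef 4 n * Esum G (n + 4) * (RtoC (s ^ (n + 4)) * lam ^ (n + 4))) with
        (RtoC (gcoef 4 n * s ^ (n + 4)) * (Esum G (n + 4) * lam ^ (n + 4)))
        by (rewrite RtoC_mult; ring).
      rewrite Im_scal, HI by lia. ring.
  - intros s Hs. destruct (B3 s ltac:(lra)) as [H|]; [|easy]. fold (A s) in H.
    rewrite !Epow in H.
    replace (Re (A s) - 1)%R with (Re (A s - 1)) by reflexivity.
    eapply Rle_trans; [apply re_le_Cmod|].
    set (x := 3 * Esum G 4 * (RtoC (s ^ 4) * lam ^ 4)) in H.
    set (y := 5 * Esum G 6 * (RtoC (s ^ 6) * lam ^ 6)) in H.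
    replace (A s - 1) with ((A s - (1 + x + y)) + (x + y)) by ring.
    assert (Hx : (Cmod x <= q * s)%R); [|assert (Hy : (Cmod y <= q' * s)%R)].
    + replace x with (RtoC (s ^ 4) * (3 * Esum G 4 * lam ^ 4)) by (unfold x; ring).
      rewrite Cmod_mult. fold q. rewrite Cmod_R, Rabs_pos_eq by (apply pow_le; lra).
      rewrite Rmult_comm. apply Rmult_le_compat_l; [apply Cmod_ge_0|].
      assert (s ^ 3 <= 1)%R by (rewrite <- (pow1 3); apply pow_incr; lra).
      replace (s ^ 4)%R with (s * s ^ 3)%R by ring. nra.
    + replace y with (RtoC (s ^ 6) * (5 * Esum G 6 * lam ^ 6)) by (unfold y; ring).
      rewrite Cmod_mult. fold q'. rewrite Cmod_R, Rabs_pos_eq by (apply pow_le; lra).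
      rewrite Rmult_comm. apply Rmult_le_compat_l; [apply Cmod_ge_0|].
      assert (s ^ 5 <= 1)%R by (rewrite <- (pow1 5); apply pow_incr; lra).
      replace (s ^ 6)%R with (s * s ^ 5)%R by ring. nra.
    + eapply Rle_trans; [apply Cmod_triangle|].
      eapply Rle_trans; [apply Rplus_le_compat_l, Cmod_triangle|].
      assert (K3 * s ^ 7 <= K3 * s)%R.
      { apply Rmult_le_compat_l; auto.
        assert (s ^ 6 <= 1)%R by (rewrite <- (pow1 6); apply pow_incr; lra).
        replace (s ^ 7)%R with (s * s ^ 6)%R by ring. nra. }
      lra.
  - apply gcoef_gap; auto.
Qed.

Lemma Esum_real G (lam : C) : summable_lattice G -> lam <> 0 ->
  Im (Esum G 4 * lam ^ 4) = 0%R -> Im (Esum G 6 * lam ^ 6) = 0%R ->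
  forall n, (3 <= n)%nat -> Im (Esum G n * lam ^ n) = 0%R.
Proof.
  intros HG Hl H4 H6 n. induction n as [n IH] using lt_wf_ind. intros Hn.
  destruct (le_lt_dec 7 n) as [H7|H7].
  - apply Esum_real_step; auto. intros m Hm. apply IH; lia.
  - assert (n = 3 \/ n = 4 \/ n = 5 \/ n = 6)%nat as [->|[->|[->| ->]]] by lia; auto.
    + rewrite E_odd by auto using odd3. rewrite Cmult_0_l; auto.
    + rewrite E_odd by (auto using odd5; lia). rewrite Cmult_0_l; auto.
Qed.

(** * The equality case *)

Lemma pow2_lower n : (INR (S n) * INR (S (S n)) <= 4 * 2 ^ n)%R.
Proof.
  induction n as [|[|n] IH]; [simpl; lra|simpl; lra|].
  rewrite !S_INR in *. simpl in *. pose proof (pos_INR n). nra.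
Qed.

Lemma gbound_half_small (eps : R) : (0 < eps)%R -> exists N, (gbound 2 N * (1 / 2) ^ N < eps)%R.
Proof.
  (* [gbound 2 N] equals [2 N + 6], and by [pow2_lower] the quotient [(2 N + 6) / 2 ^ N] is at most
     [24 / (N + 2)]. *)
  intros He. destruct (Z_of_nat_complete (Z.max 0 (up (24 / eps)))) as [N HN]; [lia|].
  exists N. cbn [gbound]. rewrite gcoef_1, gcoef_2.
  pose proof (pow2_lower N) as HP. rewrite !S_INR in HP.
  pose proof (archimed (24 / eps)) as [A _].
  assert (HN2 : (24 / eps < INR N)%R).
  { rewrite INR_IZR_INZ, <- HN. eapply Rlt_le_trans; [apply A|]. apply IZR_le. lia. }
  assert (P2 : (0 < 2 ^ N)%R) by (apply pow_lt; lra).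
  replace ((1 / 2) ^ N)%R with (/ 2 ^ N)%R.
  2: { unfold Rdiv. rewrite Rmult_1_l, pow_inv; auto. }
  apply Rmult_lt_reg_r with (2 ^ N)%R; auto.
  rewrite Rmult_assoc, Rinv_l, Rmult_1_r by lra.
  apply Rlt_div_l in HN2; [|lra]. pose proof (pos_INR N). nra.
Qed.

Lemma Cconj_RtoC (r : R) : Cconj r = r.
Proof. unfold Cconj, RtoC; simpl. f_equal; ring. Qed.

Lemma real_conj (x : C) : Im x = 0%R -> Cconj x = x.
Proof. destruct x as [a b]; simpl; intros ->. unfold Cconj; simpl. f_equal; ring. Qed.

Lemma Cconj_csum {T : Type} (f : T -> C) l :
  Cconj (csum f l) = csum (fun x => Cconj (f x)) l.
Proof.
  unfold csum. induction l; simpl; [apply Cconj_RtoC|]. rewrite Cplus_conj, IHl; auto.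
Qed.

(** Half of a shortest vector lies exactly on the circle of radius [rho / 2], the boundary of the
    region covered by [taylor]; the expansion converges there at the rate [1 / 2]. *)
Lemma half_remainder G (v : C) N M : summable_lattice G -> shortest G v ->
  bounded_sums (fun u => chiR G u * Cmod (/ u ^ 3))%R M ->
  (Cmod (Psum G (v / 2) - / (v / 2) ^ 2 -
    csum (fun n => (- (1)) ^ 2 * gcoef 2 n * (v / 2) ^ n * Esum G (n + 2))%C (seq 1 N))
   <= gbound 2 N * (1 / 2) ^ N * (Cmod v / 2 * M))%R.
Proof.
  intros HG [Hv [Hv0 Hmin]] HM. pose proof (proj1 (Cmod_gt_0 v) Hv0) as Pv.
  assert (E2 : Cmod (v / 2) = (Cmod v / 2)%R).
  { rewrite Cmod_div, Cmod_R, Rabs_pos_eq; auto; [lra|]. intros E; apply RtoC_inj in E; lra. }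
  pose proof (taylor G 0 1 N (Psum G (v / 2)) (v / 2) (Cmod v) M HG ltac:(lia) ltac:(lia)
    Pv Hmin HM ltac:(lra) (P_pre_expansion G (v / 2) HG)) as T.
  replace (S N - 1)%nat with N in T by lia. rewrite E2 in T.
  eapply Rle_trans; [apply T|]. right.
  rewrite Nat.add_0_r. simpl pow.
  replace ((Cmod v / 2) ^ N)%R with ((1 / 2) ^ N * Cmod v ^ N)%R
    by (rewrite <- Rpow_mult_distr; f_equal; field).
  rewrite pow_inv. field. apply pow_nonzero. lra.
Qed.

(** With [y = (lam / v) ^ 2], the expansion of [lam ^ 2 * P (v / 2)] is a series in [y] and its
    inverse with real coefficients, namely multiples of the [Esum G n * lam ^ n]. Conjugating [y]
    therefore conjugates the value. *)
Lemma half_value_conj G (lam v1 v2 : C) : summable_lattice G -> lam <> 0 ->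
  (forall n, (3 <= n)%nat -> Im (Esum G n * lam ^ n) = 0%R) ->
  shortest G v1 -> shortest G v2 ->
  (lam / v2) ^ 2 = Cconj ((lam / v1) ^ 2) ->
  lam ^ 2 * Psum G (v2 / 2) = Cconj (lam ^ 2 * Psum G (v1 / 2)).
Proof.
  intros HG Hl HI H1 H2 Hx.
  destruct (taylor_data G HG) as [rho [M [_ [_ [HM0 HM]]]]].
  apply sub_eq_0. apply NNPP; intros Hn. apply Cmod_gt_0 in Hn.
  set (D := Cmod (lam ^ 2 * Psum G (v2 / 2) - Cconj (lam ^ 2 * Psum G (v1 / 2)))) in *.
  set (L := (Cmod lam ^ 2 * (Cmod v2 / 2 * M + Cmod v1 / 2 * M))%R).
  assert (HL : (0 <= L)%R).
  { pose proof (Cmod_ge_0 v1). pose proof (Cmod_ge_0 v2). unfold L.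
    apply Rmult_le_pos; [apply pow_le, Cmod_ge_0|].
    assert (0 <= Cmod v2 * M)%R by (apply Rmult_le_pos; auto).
    assert (0 <= Cmod v1 * M)%R by (apply Rmult_le_pos; auto). lra. }
  destruct (gbound_half_small (D / (L + 1))) as [N HN]; [apply Rdiv_lt_0_compat; lra|].
  pose proof (half_remainder G v1 N M HG H1 HM) as T1.
  pose proof (half_remainder G v2 N M HG H2 HM) as T2.
  set (A := fun v => / (v / 2) ^ 2 +
    csum (fun n => (- (1)) ^ 2 * gcoef 2 n * (v / 2) ^ n * Esum G (n + 2)) (seq 1 N)).
  assert (nz2 : RtoC 2 <> 0) by (intros E; apply RtoC_inj in E; lra).
  assert (nz4 : RtoC 4 <> 0) by (intros E; apply RtoC_inj in E; lra).
  (* Only even indices [n = 2 j] survive, and then [(v / 2 / lam) ^ n] is a power of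
     [(v / 2 / lam) ^ 2], the inverse of [4 (lam / v) ^ 2]. *)
  assert (EA : forall v : C, v <> 0 -> lam ^ 2 * A v = 4 * (lam / v) ^ 2 +
    csum (fun n => gcoef 2 n * (Esum G (n + 2) * lam ^ (n + 2)) *
      (/ (4 * (lam / v) ^ 2)) ^ (Nat.div2 n)) (seq 1 N)).
  { intros v Hv. unfold A. rewrite Cmult_plus_distr_l. f_equal; [field; auto|].
    rewrite <- csum_scal. apply csum_ext_in. intros n Hin. apply in_seq in Hin.
    destruct (Nat.Even_or_Odd n) as [[j ->]|[j ->]].
    - rewrite Nat.div2_double.
      replace (/ (4 * (lam / v) ^ 2)) with ((v / 2 / lam) ^ 2) by (field; auto).
      rewrite <- Cpow_mult_r, Cpow_add_r.
      unfold Cdiv at 2. rewrite (Cpow_mult_l (v / 2)), <- (Cinv_pow lam). field.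
      apply Cpow_nz; auto.
    - rewrite E_odd; [ring|auto|lia|exists (j + 1)%nat; lia]. }
  assert (EC : lam ^ 2 * A v2 = Cconj (lam ^ 2 * A v1)).
  { rewrite !EA by (apply H1 || apply H2). rewrite Hx, Cplus_conj, Cmult_conj, Cconj_RtoC. f_equal.
    rewrite Cconj_csum. apply csum_ext_in. intros n Hin. apply in_seq in Hin.
    rewrite Cmult_conj, (Cpow_conj (/ (4 * (lam / v1) ^ 2))), Cinv_conj.
    - f_equal; [|f_equal; rewrite Cmult_conj, Cconj_RtoC; auto].
      rewrite Cmult_conj, Cconj_RtoC. f_equal. symmetry. apply real_conj, HI. lia.
    - apply Cmult_neq_0; auto. apply Cpow_nz. unfold Cdiv.
      intros E. apply (Cmult_neq_0 lam (/ v1)); auto.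
      intros E'. assert (v1 * / v1 = 1) as E1 by (apply Cinv_r; apply H1).
      rewrite E', Cmult_0_r in E1. apply C1_nz; auto. }
  assert (B : (D <= gbound 2 N * (1 / 2) ^ N * L)%R).
  { unfold D. replace (lam ^ 2 * Psum G (v2 / 2) - Cconj (lam ^ 2 * Psum G (v1 / 2))) with
      (lam ^ 2 * (Psum G (v2 / 2) - A v2) + - Cconj (lam ^ 2 * (Psum G (v1 / 2) - A v1))).
    - eapply Rle_trans; [apply Cmod_triangle|]. rewrite Cmod_opp, Cmod_conj, !Cmod_mult, Cmod_pow.
      replace (Psum G (v1 / 2) - A v1) with (Psum G (v1 / 2) - / (v1 / 2) ^ 2 -
        csum (fun n => (- (1)) ^ 2 * gcoef 2 n * (v1 / 2) ^ n * Esum G (n + 2)) (seq 1 N))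
        by (unfold A; ring).
      replace (Psum G (v2 / 2) - A v2) with (Psum G (v2 / 2) - / (v2 / 2) ^ 2 -
        csum (fun n => (- (1)) ^ 2 * gcoef 2 n * (v2 / 2) ^ n * Esum G (n + 2)) (seq 1 N))
        by (unfold A; ring).
      unfold L. pose proof (pow_le (Cmod lam) 2 (Cmod_ge_0 lam)) as Pl.
      apply (Rmult_le_compat_l _ _ _ Pl) in T1. apply (Rmult_le_compat_l _ _ _ Pl) in T2. lra.
    - replace (lam ^ 2 * (Psum G (v1 / 2) - A v1)) with
        (lam ^ 2 * Psum G (v1 / 2) - lam ^ 2 * A v1) by ring.
      rewrite Cminus_conj, <- EC. ring. }
  assert (0 <= gbound 2 N * (1 / 2) ^ N)%R.
  { apply Rmult_le_pos; [apply gbound_pos|apply pow_le; lra]. }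
  apply Rlt_div_r in HN; [|lra]. nra.
Qed.

Lemma half_class a b G v : has_basis a b G -> G v ->
  (exists u, G u /\ v = 2 * u) \/ (exists u, G u /\ v = a + 2 * u) \/
  (exists u, G u /\ v = b + 2 * u) \/ (exists u, G u /\ v = b + a + 2 * u).
Proof.
  intros [_ HG] Hv. apply HG in Hv as [m [n ->]].
  assert (HU : forall i j : Z, G (IZR i * a + IZR j * b)) by (intros; apply HG; eauto).
  destruct (Z.Even_or_Odd m) as [[i ->]|[i ->]]; destruct (Z.Even_or_Odd n) as [[j ->]|[j ->]].
  - left. exists (IZR i * a + IZR j * b). split; auto. rewrite !mult_IZR, !RtoC_mult. ring.
  - right; right; left. exists (IZR i * a + IZR j * b). split; auto.
    rewrite plus_IZR, !mult_IZR, RtoC_plus, !RtoC_mult. ring.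
  - right; left. exists (IZR i * a + IZR j * b). split; auto.
    rewrite plus_IZR, !mult_IZR, RtoC_plus, !RtoC_mult. ring.
  - right; right; right. exists (IZR i * a + IZR j * b). split; auto.
    rewrite !plus_IZR, !mult_IZR, !RtoC_plus, !RtoC_mult. ring.
Qed.

Lemma P_class G w u : summable_lattice G -> G u -> Psum G ((w + 2 * u) / 2) = Psum G (w / 2).
Proof.
  intros HG Hu. rewrite <- (P_periodic G (w / 2) u) by auto. f_equal. field.
Qed.

Lemma shortest_not_double G v u : shortest G v -> G u -> v <> 2 * u.
Proof.
  intros [Hv [Hv0 Hmin]] Hu E.
  assert (Hu0 : u <> 0) by (intros ->; apply Hv0; rewrite E; ring).
  specialize (Hmin u Hu Hu0). pose proof (proj1 (Cmod_gt_0 u) Hu0).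
  rewrite E, Cmod_mult, Cmod_R, Rabs_pos_eq in Hmin; lra.
Qed.

(* Equality forces, after a rotation [lam] making [e1] and [e2] conjugate, all
   the sums [Esum G n * lam ^ n] to be real; their asymptotics make the set of the
   shortest vectors invariant under the reflection, which maps [e1] to [e2]. *)
Lemma equality_case a b G : has_basis a b G -> shortest G a ->
  Cmod (Psum G (b / 2) - Psum G ((b + a) / 2)) =
  Cmod (Psum G (a / 2) - Psum G ((b + a) / 2)) ->
  exists v u, shortest G v /\ G u /\ v = b + 2 * u.
Proof.
  intros HB Ha Heq. pose proof (basis_slat a b G HB) as HG.
  destruct (half_facts a b G HB) as [[N12 [N13 N23]] [E0 [E4 E6]]].
  set (e1 := Psum G (a / 2)) in *. set (e2 := Psum G (b / 2)) in *.
  set (e3 := Psum G ((b + a) / 2)) in *.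
  assert (E3 : e3 = - (e1 + e2)).
  { replace e3 with (e1 + e2 + e3 - (e1 + e2)) by ring. rewrite E0; ring. }
  assert (Hm : (Cmod e1 ^ 2 = Cmod e2 ^ 2)%R).
  (* With [e3 = - (e1 + e2)] the hypothesis reads [|e1 + 2 e2| = |2 e1 + e2|]; expanding the squares
     leaves [|e1| = |e2|]. *)
  { assert (Hsq : (Cmod (e2 - e3) ^ 2 = Cmod (e1 - e3) ^ 2)%R) by (rewrite Heq; auto).
    rewrite E3 in Hsq. rewrite !Cmod2_alt in *. destruct e1, e2; simpl in *. nra. }
  assert (Hm1 : Cmod e1 = Cmod e2).
  { pose proof (Cmod_ge_0 e1). pose proof (Cmod_ge_0 e2). nra. }
  assert (He2 : e2 <> 0).
  { intros E. apply N12. rewrite E in *. rewrite Cmod_0 in Hm1. apply Cmod_eq_0 in Hm1. auto. }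
  assert (P2 : (0 < Cmod e2)%R) by (apply Cmod_gt_0; auto).
  (* The rotation multiplies the values by [nu ^ 2]. That [nu ^ 2 e2] be the conjugate of
     [nu ^ 2 e1] means [nu ^ 4 = Cconj e1 / e2], whence two successive square roots. *)
  destruct (unit_sqrt (Cconj e1 / e2)) as [s [Hs1 Hs2]].
  { rewrite Cmod_div, Cmod_conj, Hm1 by auto. field. lra. }
  destruct (unit_sqrt s Hs1) as [nu [Hnu1 Hnu2]].
  destruct Ha as [HGa [Ha0 Hmin]]. pose proof (proj1 (Cmod_gt_0 a) Ha0) as Pa.
  set (lam := Cmod a * nu).
  assert (Hlm : Cmod lam = Cmod a).
  { unfold lam. rewrite Cmod_mult, Cmod_R, Hnu1, Rabs_pos_eq by lra. ring. }
  assert (Hl0 : lam <> 0) by (apply Cmod_gt_0; lra).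
  assert (Hcn : nu * Cconj nu = 1) by (rewrite <- Cmod2_conj, Hnu1; f_equal; ring).
  assert (Hlam : lam ^ 2 * e2 = Cconj (lam ^ 2 * e1)).
  { unfold lam. rewrite Cmult_conj, Cpow_conj, Cmult_conj, Cconj_RtoC.
    assert (Ec : Cconj e1 = nu ^ 4 * e2).
    { replace (nu ^ 4) with ((nu ^ 2) ^ 2) by ring. rewrite Hnu2, Hs2. field; auto. }
    rewrite Ec. transitivity ((Cmod a * nu) ^ 2 * e2 * ((nu * Cconj nu) ^ 2)); [|ring].
    rewrite Hcn. ring. }
  set (f1 := lam ^ 2 * e1) in *. set (f2 := lam ^ 2 * e2) in *.
  assert (F4 : 15 * (Esum G 4 * lam ^ 4) = (f1 + f2) * (f1 + f2) - f1 * f2).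
  { transitivity (15 * Esum G 4 * lam ^ 4); [ring|]. rewrite E4, E3. unfold f1, f2. ring. }
  assert (F6 : 35 * (Esum G 6 * lam ^ 6) = - (f1 * f2 * (f1 + f2))).
  { transitivity (35 * Esum G 6 * lam ^ 6); [ring|]. rewrite E6, E3. unfold f1, f2. ring. }
  assert (I4 : Im (Esum G 4 * lam ^ 4) = 0%R).
  { apply (f_equal Im) in F4. rewrite Im_scal, Hlam in F4.
    assert (Z : Im ((f1 + Cconj f1) * (f1 + Cconj f1) - f1 * Cconj f1) = 0%R)
      by (destruct f1; simpl; ring). lra. }
  assert (I6 : Im (Esum G 6 * lam ^ 6) = 0%R).
  { apply (f_equal Im) in F6. rewrite Im_scal, Hlam in F6.
    assert (Z : Im (- (f1 * Cconj f1 * (f1 + Cconj f1))) = 0%R)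
      by (destruct f1; simpl; ring). lra. }
  pose proof (Esum_real G lam HG Hl0 I4 I6) as HI.
  destruct (finite_disk G (Cmod a) HG) as [l0 [Hl0d Il0]].
  destruct (finite_list (fun u => G u /\ Cmod u = Cmod lam) (length l0)) as [l [Hld Il]].
  { intros k Hk HP. apply NoDup_incl_length; auto. intros x Hx.
    rewrite List.Forall_forall in HP. destruct (HP x Hx) as [HP1 HP2].
    apply Il0. split; auto. lra. }
  pose proof (Esum_asymptotic G lam l HG Hl0 ltac:(rewrite Hlm; auto) Hld Il) as Has.
  destruct (conj_base l (fun v => (lam / v) ^ 2) a) as [v [Hv Hvx]].
  - apply Il. split; auto.
  - rewrite Cmod_pow, Cmod_div, Hlm by auto. replace (Cmod a / Cmod a)%R with 1%R by (field; lra). ring.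
  - intros eps He. destruct (Has (eps / 2)%R ltac:(lra)) as [N HN].
    exists (N + 2)%nat. intros k Hk. specialize (HN k ltac:(lia)).
    set (S := csum (fun v => ((lam / v) ^ 2) ^ k) l) in *.
    set (g := Esum G (2 * k) * lam ^ (2 * k)) in *.
    assert (Hg : Cconj g = g) by (apply real_conj, HI; lia).
    replace (S - Cconj S) with (- (g - S) + Cconj (g - S)).
    + eapply Rle_lt_trans; [apply Cmod_triangle|]. rewrite Cmod_opp, Cmod_conj. lra.
    + rewrite Cminus_conj, Hg. ring.
  - apply Il in Hv as [HGv Hvm].
    assert (Hv0 : v <> 0) by (apply Cmod_gt_0; lra).
    assert (Shv : shortest G v).
    { repeat split; auto. rewrite Hvm, Hlm; auto. }
    assert (Sha : shortest G a) by (repeat split; auto).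
    pose proof (half_value_conj G lam a v HG Hl0 HI Sha Shv Hvx) as HP.
    fold e1 in HP. fold f1 in HP. rewrite <- Hlam in HP. unfold f2 in HP.
    assert (Ev : Psum G (v / 2) = e2).
    { transitivity (/ lam ^ 2 * (lam ^ 2 * Psum G (v / 2))); [field; auto|].
      rewrite HP. field; auto. }
    (* A shortest vector is not in [2 G], and the distinct values of [P] rule out the classes of [a]
       and [b + a]. *)
    destruct (half_class a b G v HB HGv) as [[u [Hu E]]|[[u [Hu E]]|[[u [Hu E]]|[u [Hu E]]]]].
    + exfalso. apply (shortest_not_double G v u); auto.
    + exfalso. apply N12. rewrite <- Ev, E, P_class; auto.
    + exists v, u. auto.
    + exfalso. apply N23. rewrite <- Ev, E, P_class; auto.
Qed.

(** * Moving the lattice *)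

Definition lat (a b : C) : C -> Prop :=
  fun z => exists m n : Z, z = IZR m * a + IZR n * b.

Lemma lat_basis a b : Im (b * Cconj a) <> 0%R -> has_basis a b (lat a b).
Proof. intros H; split; auto. intros z; reflexivity. Qed.

(* [Rabs t] makes the family continuous on the whole line, as [IVT] demands. *)
Definition up_shift (a b : C) (t : R) : C := b + Rabs t * (Ci * a).

Lemma Im_up_shift a b t :
  Im (up_shift a b t * Cconj a) = (Im (b * Cconj a) + Rabs t * Cmod a ^ 2)%R.
Proof. unfold up_shift. rewrite Cmod2_alt. destruct a, b; simpl. ring. Qed.

Lemma up_shift_comb a b t (x y : R) :
  x * a + y * up_shift a b t = (x * a + y * b) + (y * Rabs t)%R * (Ci * a).
Proof. unfold up_shift. rewrite RtoC_mult. ring. Qed.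

Lemma Cmod_up_shift a b t (x y : R) :
  (Cmod (x * a + y * up_shift a b t) ^ 2 = Cmod (x * a + y * b) ^ 2
    + 2 * y ^ 2 * Rabs t * Im (b * Cconj a) + (y * Rabs t) ^ 2 * Cmod a ^ 2)%R.
Proof. rewrite up_shift_comb, !Cmod2_alt. destruct a, b; simpl. ring. Qed.

(** [Ci * a] is orthogonal to [a] and points to the side of [b], so the shift enlarges the component
    of [x a + y b] orthogonal to [a] and keeps the other one. *)
Lemma up_shift_mono a b t (x y : R) : (0 < Im (b * Cconj a))%R ->
  (Cmod (x * a + y * b) <= Cmod (x * a + y * up_shift a b t))%R.
Proof.
  intros HD. apply Rsqr_incr_0; try apply Cmod_ge_0.
  pose proof (Cmod_up_shift a b t x y) as E. pose proof (Rabs_pos t).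
  assert (0 <= y ^ 2 * Rabs t * Im (b * Cconj a))%R.
  { apply Rmult_le_pos; [apply Rmult_le_pos; [apply pow2_ge_0|auto]|lra]. }
  assert (0 <= (y * Rabs t) ^ 2 * Cmod a ^ 2)%R by (apply Rmult_le_pos; apply pow2_ge_0).
  rewrite !Rsqr_pow2. lra.
Qed.

Lemma up_shift_strict a b t (x y : R) : (0 < Im (b * Cconj a))%R -> y <> 0%R -> t <> 0%R ->
  (Cmod (x * a + y * b) < Cmod (x * a + y * up_shift a b t))%R.
Proof.
  intros HD Hy Ht. apply Rsqr_incrst_0; try apply Cmod_ge_0.
  pose proof (Cmod_up_shift a b t x y) as E. pose proof (Rabs_pos_lt t Ht).
  assert (0 < y ^ 2)%R by (rewrite <- Rsqr_pow2; apply Rsqr_pos_lt; auto).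
  assert (0 < y ^ 2 * Rabs t * Im (b * Cconj a))%R.
  { apply Rmult_lt_0_compat; [apply Rmult_lt_0_compat|]; auto. }
  assert (0 <= (y * Rabs t) ^ 2 * Cmod a ^ 2)%R by (apply Rmult_le_pos; apply pow2_ge_0).
  rewrite !Rsqr_pow2. lra.
Qed.

Lemma up_shift_far a b t (x y : R) : (0 < Im (b * Cconj a))%R ->
  (Rabs y * Rabs t * Cmod a <= Cmod (x * a + y * up_shift a b t))%R.
Proof.
  intros HD. apply Rsqr_incr_0; try apply Cmod_ge_0.
  - pose proof (Cmod_up_shift a b t x y) as E. pose proof (Rabs_pos t).
    assert (0 <= y ^ 2 * Rabs t * Im (b * Cconj a))%R.
    { apply Rmult_le_pos; [apply Rmult_le_pos; [apply pow2_ge_0|auto]|lra]. }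
    pose proof (pow2_ge_0 (Cmod (x * a + y * b))).
    assert (E2 : ((Rabs y * Rabs t * Cmod a) ^ 2 = (y * Rabs t) ^ 2 * Cmod a ^ 2)%R)
      by (rewrite !Rpow_mult_distr, (pow2_abs y); ring).
    rewrite !Rsqr_pow2, E2. lra.
  - apply Rmult_le_pos; [apply Rmult_le_pos; apply Rabs_pos|apply Cmod_ge_0].
Qed.

Lemma up_shift_basis a b t : (0 < Im (b * Cconj a))%R ->
  has_basis a (up_shift a b t) (lat a (up_shift a b t)).
Proof.
  intros H. apply lat_basis. rewrite Im_up_shift.
  pose proof (Rabs_pos t). pose proof (pow2_ge_0 (Cmod a)).
  assert (0 <= Rabs t * Cmod a ^ 2)%R by (apply Rmult_le_pos; auto). lra.
Qed.

(** * Series over pairs of integers, uniformly in the moving lattice *)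

Lemma basis_pairs a b (f : C -> C) G s : has_basis a b G -> (forall u, ~ G u -> f u = 0) ->
  has_sum f s -> has_sum (fun p : Z * Z => f (IZR (fst p) * a + IZR (snd p) * b)) s.
Proof.
  intros HB Hf. apply has_sum_reindex.
  - intros [m n] [m' n'] E. cbn [fst snd] in E.
    destruct HB as [Hd HG]. destruct (basis_lower a b Hd) as [c [Hc Hl]].
    specialize (Hl (IZR m - IZR m')%R (IZR n - IZR n')%R).
    replace ((IZR m - IZR m')%R * a + (IZR n - IZR n')%R * b) with (RtoC 0) in Hl.
    + rewrite Cmod_0 in Hl. rewrite <- !minus_IZR in Hl.
      pose proof (Rabs_pos (IZR (m - m'))). pose proof (Rabs_pos (IZR (n - n'))).
      assert (Rabs (IZR (m - m')) = 0 /\ Rabs (IZR (n - n')) = 0)%R as [H1 H2] by (split; nra).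
      apply Rabs_eq_0, (eq_IZR _ 0) in H1. apply Rabs_eq_0, (eq_IZR _ 0) in H2.
      f_equal; lia.
    + rewrite !RtoC_minus. apply sub_eq_0.
      transitivity (IZR m' * a + IZR n' * b - (IZR m * a + IZR n * b)); [ring|]. rewrite E. ring.
  - intros x Hx. assert (Gx : G x) by (apply NNPP; intros Hn; apply Hx, Hf; auto).
    apply HB in Gx as [m [n ->]]. exists (m, n). auto.
Qed.

(** Coordinates with respect to the basis give all the lattices of the family the common index set
    [Z * Z], as dominated convergence requires. *)
Definition pt (a b : C) (x y : R) (p : Z * Z) : C :=
  (x - IZR (fst p))%R * a + (y - IZR (snd p))%R * b.

(** For [x1 = y1 = 0] this is the term of [Psum] itself; two half periods give the term of a
    difference of two values of [P], from which [/ u ^ 2] has cancelled. *)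
Definition pdiff (a b : C) (x0 y0 x1 y1 : R) (p : Z * Z) : C :=
  / pt a b x0 y0 p ^ 2 - / pt a b x1 y1 p ^ 2.

Lemma P_pairs a b G (x y : R) : has_basis a b G ->
  has_sum (pdiff a b x y 0 0) (Psum G (x * a + y * b)).
Proof.
  intros HB. pose proof (basis_slat a b G HB) as HG.
  eapply has_sum_ext; [|eapply (basis_pairs a b _ G _ HB); [|apply P_has_sum; auto]].
  - intros [m n]. unfold pdiff, pt. cbn [fst snd].
    rewrite chi_1, Cmult_1_l by (apply HB; eauto). rewrite !RtoC_minus.
    replace ((0 - IZR m) * a + (0 - IZR n) * b) with (- (IZR m * a + IZR n * b)) by ring.
    rewrite Cinv_sq_opp.
    replace (x * a + y * b - (IZR m * a + IZR n * b)) with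
      ((x - IZR m) * a + (y - IZR n) * b) by ring. auto.
  - intros u Hu. cbv beta. rewrite chi_0 by auto. ring.
Qed.

Lemma pt_0_off a b G (x y : R) p : has_basis a b G -> G (pt a b x y p) -> 
  exists m n : Z, x = IZR m /\ y = IZR n.
Proof.
  intros HB H. destruct (basis_coords a b G _ _ HB H) as [m [n [E1 E2]]].
  exists (m + fst p)%Z, (n + snd p)%Z. rewrite !plus_IZR. split; lra.
Qed.

(** The coordinates of the origin and of the three half periods; the origin accounts for the
    subtracted terms [/ u ^ 2] of [Psum]. *)
Definition base_ok (x y : R) : Prop :=
  (x = 0 /\ y = 0)%R \/ (x = 1 / 2 /\ y = 0)%R \/ (x = 0 /\ y = 1 / 2)%R
  \/ (x = 1 / 2 /\ y = 1 / 2)%R.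

Lemma base_ok_nonzero a b x y p : Im (b * Cconj a) <> 0%R -> base_ok x y ->
  pt a b x y p = 0 -> (x = 0 /\ y = 0)%R /\ p = (0%Z, 0%Z).
Proof.
  intros HD Hok E. pose proof (lat_basis a b HD) as HB.
  assert (HL : lat a b (pt a b x y p)).
  { rewrite E. exists 0%Z, 0%Z. ring. }
  destruct (pt_0_off a b _ x y p HB HL) as [m [n [Ex Ey]]].
  assert (N : forall k : Z, (1 / 2)%R <> IZR k) by (intros k; apply not_int_half; lra).
  destruct Hok as [[-> ->]|[[-> ->]|[[-> ->]|[-> ->]]]].
  - split; auto. destruct p as [i j]. unfold pt in E. cbn [fst snd] in E.
    destruct (basis_lower a b HD) as [c [Hc Hl]].
    specialize (Hl (0 - IZR i)%R (0 - IZR j)%R). rewrite E, Cmod_0 in Hl.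
    pose proof (Rabs_pos (0 - IZR i)). pose proof (Rabs_pos (0 - IZR j)).
    assert (Rabs (0 - IZR i) = 0 /\ Rabs (0 - IZR j) = 0)%R as [H1 H2] by (split; nra).
    apply Rabs_eq_0 in H1, H2. f_equal; apply eq_IZR; lra.
  - exfalso; apply (N m); auto.
  - exfalso; apply (N n); auto.
  - exfalso; apply (N m); auto.
Qed.

Lemma inv_sq_mono (x y : C) : x <> 0 -> (Cmod x <= Cmod y)%R ->
  (Cmod (/ y ^ 2) <= Cmod (/ x ^ 2))%R.
Proof.
  intros Hx H. pose proof (proj1 (Cmod_gt_0 x) Hx).
  rewrite !Cinv_pow, !Cmod_pow. apply pow_incr. split; [apply Cmod_ge_0|].
  rewrite (Cmod_inv x) by auto. apply Cmod_inv_le; auto.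
Qed.

Lemma pt_lower a b x y : Im (b * Cconj a) <> 0%R ->
  exists c, (0 < c)%R /\ forall p, pt a b x y p <> 0 ->
    (c * (1 + Cmod (pt a b 0 0 p)) <= Cmod (pt a b x y p))%R.
Proof.
  intros HD. pose proof (lat_basis a b HD) as HB. pose proof (basis_slat a b _ HB) as HG.
  destruct (slat_dist _ (x * a + y * b) HG) as [c [Hc H]]. exists c. split; auto.
  intros p Hp. specialize (H (- pt a b 0 0 p)).
  rewrite Cmod_opp in H.
  replace (x * a + y * b - - pt a b 0 0 p) with (pt a b x y p) in H
    by (unfold pt; rewrite !RtoC_minus; ring).
  apply H.
  - exists (fst p), (snd p). unfold pt. rewrite !RtoC_minus. ring.
  - intros E. apply Hp. replace (pt a b x y p) with (x * a + y * b - - pt a b 0 0 p)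
      by (unfold pt; rewrite !RtoC_minus; ring). rewrite E. ring.
Qed.

(** By [up_shift_mono] every denominator is at least as large as in the initial lattice, so [g1] and
    [g2] do not depend on [t]. The distance of the two base points may grow with [t] and is kept as
    a factor; the index [(0, 0)], where a denominator may vanish, is left to [g2]. *)
Lemma pdiff_dominated a b x0 y0 x1 y1 : (0 < Im (b * Cconj a))%R ->
  base_ok x0 y0 -> base_ok x1 y1 ->
  exists g1 g2 : Z * Z -> R, summable g1 /\ summable g2 /\ forall t p,
    (Cmod (pdiff a (up_shift a b t) x0 y0 x1 y1 p) <=
     Cmod ((x0 - x1)%R * a + (y0 - y1)%R * up_shift a b t) * g1 p + g2 p)%R.
Proof.
  intros HD H0 H1. assert (HD' : Im (b * Cconj a) <> 0%R) by lra.
  pose proof (lat_basis a b HD') as HB. pose proof (basis_slat a b _ HB) as HG.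
  destruct (pt_lower a b x0 y0 HD') as [c0 [Hc0 L0]].
  destruct (pt_lower a b x1 y1 HD') as [c1 [Hc1 L1]].
  set (c := Rmin c0 c1). assert (Hc : (0 < c)%R) by (apply Rmin_glb_lt; auto).
  set (z0 := fun q : Z * Z => Cmod (/ pt a b x0 y0 q ^ 2)).
  set (z1 := fun q : Z * Z => Cmod (/ pt a b x1 y1 q ^ 2)).
  exists (fun p => 2 * / c ^ 3 * wt (pt a b 0 0 p))%R,
    (fun p => if eq_em p (0%Z, 0%Z) then (z0 (0%Z, 0%Z) + z1 (0%Z, 0%Z))%R else 0%R).
  assert (Pc : (0 < / c ^ 3)%R) by (apply Rinv_0_lt_compat, pow_lt; auto).
  assert (Pz : (0 <= z0 (0%Z, 0%Z) + z1 (0%Z, 0%Z))%R).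
  { unfold z0, z1. pose proof (Cmod_ge_0 (/ pt a b x0 y0 (0%Z, 0%Z) ^ 2)).
    pose proof (Cmod_ge_0 (/ pt a b x1 y1 (0%Z, 0%Z) ^ 2)). lra. }
  split; [|split].
  - apply summable_scal; [lra|].
    pose proof (proj2 (proj2 HG)) as HS.
    apply summable_le with (fun p : Z * Z => chiR (lat a b) (pt a b 0 0 p) * wt (pt a b 0 0 p))%R.
    + intros p. pose proof (wt_pos (pt a b 0 0 p)).
      rewrite chiR_1; [lra|]. exists (- fst p)%Z, (- snd p)%Z. unfold pt.
      rewrite !opp_IZR, !RtoC_minus, !RtoC_opp. ring.
    + apply (summable_inj (fun p => pt a b 0 0 p) (fun u => chiR (lat a b) u * wt u)%R); auto.
      intros p q E.
      assert (E0 : pt a b 0 0 ((fst p - fst q)%Z, (snd p - snd q)%Z) = 0).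
      { transitivity (pt a b 0 0 p - pt a b 0 0 q).
        - unfold pt. cbn [fst snd]. rewrite !minus_IZR, !RtoC_minus. ring.
        - rewrite E. ring. }
      apply base_ok_nonzero in E0 as [_ E0]; [|auto|left; auto].
      injection E0 as Ea Eb. destruct p, q; cbn [fst snd] in *. f_equal; lia.
  - apply summable_point; auto.
  - intros t p. set (X := pt a (up_shift a b t) x0 y0 p). set (Y := pt a (up_shift a b t) x1 y1 p).
    assert (MX : (Cmod (pt a b x0 y0 p) <= Cmod X)%R) by (apply up_shift_mono; auto).
    assert (MY : (Cmod (pt a b x1 y1 p) <= Cmod Y)%R) by (apply up_shift_mono; auto).
    pose proof (wt_pos (pt a b 0 0 p)) as Pw.
    pose proof (Cmod_ge_0 ((x0 - x1)%R * a + (y0 - y1)%R * up_shift a b t)) as Pd.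
    assert (Pd2 : (0 <= Cmod ((x0 - x1)%R * a + (y0 - y1)%R * up_shift a b t)
       * (2 * / c ^ 3 * wt (pt a b 0 0 p)))%R).
    { apply Rmult_le_pos; auto. apply Rmult_le_pos; lra. }
    unfold pdiff. fold X Y.
    assert (Z : forall x y, base_ok x y ->
       (Cmod (/ pt a (up_shift a b t) x y p ^ 2) <= Cmod (/ pt a b x y p ^ 2))%R).
    { intros x y Hok. destruct (classic (pt a b x y p = 0)) as [E|E].
      - destruct (base_ok_nonzero a b x y p HD' Hok E) as [[-> ->] ->].
        unfold pt. cbn [fst snd]. rewrite Rminus_0_r, !Cmult_0_l, Cplus_0_l. lra.
      - apply inv_sq_mono; auto. apply up_shift_mono; auto. }
    destruct (eq_em p (0%Z, 0%Z)) as [->|Hp].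
    + eapply Rle_trans; [apply Cmod_triangle|]. rewrite Cmod_opp.
      pose proof (Z x0 y0 H0) as Z0. pose proof (Z x1 y1 H1) as Z1. fold X in Z0. fold Y in Z1.
      fold (z0 (0%Z, 0%Z)) in Z0. fold (z1 (0%Z, 0%Z)) in Z1. lra.
    + rewrite Rplus_0_r.
      assert (N0 : pt a b x0 y0 p <> 0).
      { intros E. apply Hp, (base_ok_nonzero a b x0 y0 p HD' H0 E). }
      assert (N1 : pt a b x1 y1 p <> 0).
      { intros E. apply Hp, (base_ok_nonzero a b x1 y1 p HD' H1 E). }
      specialize (L0 p N0). specialize (L1 p N1).
      pose proof (Cmod_ge_0 (pt a b 0 0 p)).
      assert (C0 : (c * (1 + Cmod (pt a b 0 0 p)) <= c0 * (1 + Cmod (pt a b 0 0 p)))%R)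
        by (apply Rmult_le_compat_r; [lra|apply Rmin_l]).
      assert (C1 : (c * (1 + Cmod (pt a b 0 0 p)) <= c1 * (1 + Cmod (pt a b 0 0 p)))%R)
        by (apply Rmult_le_compat_r; [lra|apply Rmin_r]).
      assert (NX : X <> 0).
      { apply Cmod_gt_0. apply Cmod_gt_0 in N0. lra. }
      assert (NY : - Y <> 0).
      { apply Cmod_gt_0. rewrite Cmod_opp. apply Cmod_gt_0 in N1. lra. }
      rewrite <- (Cinv_sq_opp Y).
      replace ((x0 - x1)%R * a + (y0 - y1)%R * up_shift a b t) with (X + - Y)
        by (unfold X, Y, pt; rewrite !RtoC_minus; ring).
      rewrite <- !Rmult_assoc. rewrite (Rmult_assoc _ 2).
      apply inv_sq_diff_wt; auto; [lra|]. rewrite Cmod_opp. lra.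
Qed.

Lemma pdiff_continuous a b x0 y0 x1 y1 p : (0 < Im (b * Cconj a))%R ->
  base_ok x0 y0 -> base_ok x1 y1 ->
  exists L, (0 <= L)%R /\ forall s t,
    (Cmod (pdiff a (up_shift a b s) x0 y0 x1 y1 p - pdiff a (up_shift a b t) x0 y0 x1 y1 p)
     <= L * Rabs (s - t))%R.
Proof.
  intros HD H0 H1. assert (HD' : Im (b * Cconj a) <> 0%R) by lra.
  assert (K : forall x y, base_ok x y -> exists L, (0 <= L)%R /\ forall s t,
    (Cmod (/ pt a (up_shift a b s) x y p ^ 2 - / pt a (up_shift a b t) x y p ^ 2)
     <= L * Rabs (s - t))%R).
  { intros x y Hok. destruct (classic (pt a b x y p = 0)) as [E|E].
    - destruct (base_ok_nonzero a b x y p HD' Hok E) as [[-> ->] ->].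
      exists 0%R. split; [lra|]. intros s t. unfold pt. cbn [fst snd].
      rewrite Rminus_0_r, !Cmult_0_l, Cplus_0_l.
      match goal with |- (Cmod (?u - ?u) <= _)%R => replace (u - u) with (RtoC 0) by ring end.
      rewrite Cmod_0. lra.
    - set (r := Cmod (pt a b x y p)). assert (Hr : (0 < r)%R) by (apply Cmod_gt_0; auto).
      set (k := Rabs (y - IZR (snd p))).
      exists (k * Cmod a * (2 * / r ^ 3))%R.
      assert (P3 : (0 < / r ^ 3)%R) by (apply Rinv_0_lt_compat, pow_lt; auto).
      pose proof (Rabs_pos (y - IZR (snd p))) as Pk. fold k in Pk.
      pose proof (Cmod_ge_0 a) as Pa.
      split; [apply Rmult_le_pos; [apply Rmult_le_pos; auto|lra]|].
      intros s t. set (X := pt a (up_shift a b s) x y p). set (Y := pt a (up_shift a b t) x y p).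
      assert (MX : (r <= Cmod X)%R) by (apply up_shift_mono; auto).
      assert (MY : (r <= Cmod Y)%R) by (apply up_shift_mono; auto).
      assert (NX : X <> 0) by (apply Cmod_gt_0; lra).
      assert (NY : - Y <> 0) by (apply Cmod_gt_0; rewrite Cmod_opp; lra).
      rewrite <- (Cinv_sq_opp Y), inv_sq_diff, Cmod_mult by auto.
      assert (D : (Cmod (X + - Y) <= k * Cmod a * Rabs (s - t))%R).
      { replace (X + - Y) with (((y - IZR (snd p)) * (Rabs s - Rabs t))%R * (Ci * a))
          by (unfold X, Y, pt, up_shift; rewrite RtoC_mult, !RtoC_minus; ring).
        rewrite !Cmod_mult, Cmod_Ci, Cmod_R, Rabs_mult, Rmult_1_l. fold k.
        pose proof (Rabs_triang_inv2 s t). pose proof (Rabs_pos (Rabs s - Rabs t)).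
        replace (k * Rabs (Rabs s - Rabs t) * Cmod a)%R with
          (k * Cmod a * Rabs (Rabs s - Rabs t))%R by ring.
        apply Rmult_le_compat_l; auto. apply Rmult_le_pos; auto. }
      assert (I : forall u v : C, u <> 0 -> v <> 0 -> (r <= Cmod u)%R -> (r <= Cmod v)%R ->
         (Cmod (/ (u ^ 2 * v)) <= / r ^ 3)%R).
      { intros u v Hu Hv Bu Bv. apply Cmod_inv_le; [apply pow_lt; auto|]. intros _.
        rewrite Cmod_mult, Cmod_pow. replace (r ^ 3)%R with (r ^ 2 * r)%R by ring.
        apply Rmult_le_compat; [apply pow_le; lra|lra|apply pow_incr; lra|lra]. }
      assert (B : (Cmod (/ (X ^ 2 * - Y) - / (X * (- Y) ^ 2)) <= 2 * / r ^ 3)%R).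
      { eapply Rle_trans; [apply Cmod_triangle|]. rewrite Cmod_opp.
        assert (MY' : (r <= Cmod (- Y))%R) by (rewrite Cmod_opp; auto).
        pose proof (I X (- Y) NX NY MX MY') as I1.
        pose proof (I (- Y) X NY NX MY' MX) as I2.
        rewrite (Cmult_comm ((- Y) ^ 2)) in I2. lra. }
      replace (k * Cmod a * (2 * / r ^ 3) * Rabs (s - t))%R with
        ((k * Cmod a * Rabs (s - t)) * (2 * / r ^ 3))%R by ring.
      apply Rmult_le_compat; auto; apply Cmod_ge_0. }
  destruct (K x0 y0 H0) as [L0 [P0 K0]]. destruct (K x1 y1 H1) as [L1 [P1 K1]].
  exists (L0 + L1)%R. split; [lra|]. intros s t. specialize (K0 s t). specialize (K1 s t).
  unfold pdiff.
  match goal with |- (Cmod (?A - ?B - (?A' - ?B')) <= _)%R =>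
    replace (A - B - (A' - B')) with ((A - A') + - (B - B')) by ring end.
  eapply Rle_trans; [apply Cmod_triangle|]. rewrite Cmod_opp. lra.
Qed.

Lemma pdiff_sum_continuous a b x0 y0 x1 y1 (s : R -> C) : (0 < Im (b * Cconj a))%R ->
  base_ok x0 y0 -> base_ok x1 y1 ->
  (forall t, has_sum (pdiff a (up_shift a b t) x0 y0 x1 y1) (s t)) ->
  forall t0 eps, (0 < eps)%R -> locally t0 (fun t => (Cmod (s t - s t0) < eps)%R).
Proof.
  intros HD H0 H1 Hs t0 eps He.
  destruct (pdiff_dominated a b x0 y0 x1 y1 HD H0 H1) as [g1 [g2 [S1' [S2' HB]]]].
  set (Z := (Cmod a + (Cmod b + (Rabs t0 + 1) * Cmod a))%R).
  assert (HZ : forall t, (Rabs (t - t0) < 1)%R ->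
     (Cmod ((x0 - x1)%R * a + (y0 - y1)%R * up_shift a b t) <= Z)%R).
  { intros t Ht. assert (C1 : (Rabs (x0 - x1) <= 1 /\ Rabs (y0 - y1) <= 1)%R).
    { destruct H0 as [[-> ->]|[[-> ->]|[[-> ->]|[-> ->]]]];
      destruct H1 as [[-> ->]|[[-> ->]|[[-> ->]|[-> ->]]]];
      unfold Rabs; split; destruct Rcase_abs; lra. }
    pose proof (Cmod_ge_0 a) as Pa. pose proof (Cmod_ge_0 b) as Pb.
    pose proof (Cmod_ge_0 (up_shift a b t)) as Pu.
    assert (Cmod (up_shift a b t) <= Cmod b + (Rabs t0 + 1) * Cmod a)%R.
    { unfold up_shift. eapply Rle_trans; [apply Cmod_triangle|].
      rewrite !Cmod_mult, Cmod_Ci, Cmod_R, Rabs_Rabsolu, Rmult_1_l.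
      assert (Rabs t <= Rabs t0 + 1)%R.
      { replace t with (t0 + (t - t0))%R by ring.
        eapply Rle_trans; [apply Rabs_triang|]. lra. }
      pose proof (Rmult_le_compat_r _ _ _ Pa H). lra. }
    eapply Rle_trans; [apply Cmod_triangle|]. rewrite !Cmod_mult, !Cmod_R. unfold Z.
    pose proof (Rabs_pos (x0 - x1)). pose proof (Rabs_pos (y0 - y1)). nra. }
  assert (PZ : (0 <= Z)%R).
  { specialize (HZ t0). rewrite Rminus_diag, Rabs_R0 in HZ.
    eapply Rle_trans; [apply Cmod_ge_0|apply HZ; lra]. }
  apply (dominated_sum (locally t0) (fun t => pdiff a (up_shift a b t) x0 y0 x1 y1)
    (pdiff a (up_shift a b t0) x0 y0 x1 y1) (fun p => Z * g1 p + g2 p)%R s (s t0)); auto.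
  - apply summable_plus; auto. apply summable_scal; auto.
  - exists (mkposreal 1 Rlt_0_1). intros t Ht p. change (Rabs (t - t0) < 1)%R in Ht.
    eapply Rle_trans; [apply HB|]. apply Rplus_le_compat_r, Rmult_le_compat_r; auto. apply S1'.
  - intros p. eapply Rle_trans; [apply HB|]. apply Rplus_le_compat_r, Rmult_le_compat_r.
    + apply S1'.
    + apply HZ. rewrite Rminus_diag, Rabs_R0. lra.
  - intros p e Hpe. destruct (pdiff_continuous a b x0 y0 x1 y1 p HD H0 H1) as [L [HL HC]].
    assert (Pd : (0 < e / (L + 1))%R) by (apply Rdiv_lt_0_compat; lra).
    exists (mkposreal _ Pd). intros t Ht. change (Rabs (t - t0) < e / (L + 1))%R in Ht.
    specialize (HC t t0). apply Rlt_div_r in Ht; [|lra].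
    pose proof (Rabs_pos (t - t0)). nra.
Qed.

(** With the same [y] at both base points their distance is fixed, so one majorant works for all
    [t]. In the row [snd p = y] the terms do not involve the moving period; in every other row the
    denominators tend to infinity. *)
Lemma pdiff_sum_limit a b x0 x1 y (s : R -> C) (f0 : Z * Z -> C) s0 :
  (0 < Im (b * Cconj a))%R -> base_ok x0 y -> base_ok x1 y ->
  (forall t, has_sum (pdiff a (up_shift a b t) x0 y x1 y) (s t)) ->
  (forall p, y <> IZR (snd p) -> f0 p = 0) ->
  (forall p, y = IZR (snd p) -> f0 p = pdiff a b x0 y x1 y p) ->
  has_sum f0 s0 ->
  forall eps, (0 < eps)%R -> Rbar_locally p_infty (fun t => (Cmod (s t - s0) < eps)%R).
Proof.
  intros HD H0 H1 Hs Z0 Z1 Hs0 eps He.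
  assert (Pa : (0 < Cmod a)%R).
  { apply Cmod_gt_0. intros ->. destruct b; simpl in HD; lra. }
  destruct (pdiff_dominated a b x0 y x1 y HD H0 H1) as [g1 [g2 [S1' [S2' HB]]]].
  assert (EZ : forall t, Cmod ((x0 - x1)%R * a + (y - y)%R * up_shift a b t) =
     Cmod ((x0 - x1)%R * a)).
  { intros t. rewrite Rminus_diag, Cmult_0_l, Cplus_0_r. auto. }
  set (Z := Cmod ((x0 - x1)%R * a)) in *.
  assert (PZ : (0 <= Z)%R) by apply Cmod_ge_0.
  assert (HF0 : forall t p, y = IZR (snd p) ->
     pdiff a (up_shift a b t) x0 y x1 y p = f0 p).
  { intros t p E. rewrite Z1 by auto. unfold pdiff, pt.
    rewrite <- E, Rminus_diag, !Cmult_0_l. auto. }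
  apply (dominated_sum (Rbar_locally p_infty) (fun t => pdiff a (up_shift a b t) x0 y x1 y)
    f0 (fun p => Z * g1 p + g2 p)%R s s0); auto.
  - apply summable_plus; auto. apply summable_scal; auto.
  - exists 0%R. intros t _ p. rewrite <- (EZ t). apply HB.
  - intros p. destruct (Req_dec y (IZR (snd p))) as [E|E].
    + rewrite <- (HF0 0%R p E). rewrite <- (EZ 0%R). apply HB.
    + rewrite Z0, Cmod_0 by auto. apply Rplus_le_le_0_compat; [|apply S2'].
      apply Rmult_le_pos; auto. apply S1'.
  - intros p e Hpe. destruct (Req_dec y (IZR (snd p))) as [E|E].
    { exists 0%R. intros t _. rewrite HF0 by auto.
      replace (f0 p - f0 p) with (RtoC 0) by ring. rewrite Cmod_0; auto. }
    rewrite Z0 by auto.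
    set (k := Rabs (y - IZR (snd p))). assert (Pk : (0 < k)%R) by (apply Rabs_pos_lt; lra).
    set (r := (4 / e + 1)%R). assert (P4 : (0 < 4 / e)%R) by (apply Rdiv_lt_0_compat; lra).
    exists (r / (k * Cmod a))%R. intros t Ht.
    assert (Pka : (0 < k * Cmod a)%R) by (apply Rmult_lt_0_compat; auto).
    assert (Pt : (0 < t)%R).
    { eapply Rlt_trans; [|apply Ht]. apply Rdiv_lt_0_compat; auto. unfold r; lra. }
    apply Rlt_div_l in Ht; [|auto].
    assert (F : forall x, (Cmod (/ pt a (up_shift a b t) x y p ^ 2) <= e / 4)%R).
    { intros x. pose proof (up_shift_far a b t (x - IZR (fst p)) (y - IZR (snd p)) HD) as F.
      fold (pt a (up_shift a b t) x y p) in F. fold k in F.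
      rewrite (Rabs_pos_eq t) in F by lra.
      set (X := pt a (up_shift a b t) x y p) in *.
      assert (BX : (r <= Cmod X)%R) by lra.
      replace (e / 4)%R with (/ (4 / e))%R by (field; lra).
      apply Cmod_inv_le; auto. intros _. rewrite Cmod_pow. unfold r in BX. nra. }
    unfold pdiff.
    unfold Cminus at 1. rewrite Copp_0, Cplus_0_r.
    eapply Rle_lt_trans; [apply Cmod_triangle|]. rewrite Cmod_opp.
    pose proof (F x0). pose proof (F x1). lra.
Qed.

(** * Comparison of the edges *)

Lemma has_sum_Re_ge {T : Type} (f : T -> C) s x0 :
  has_sum f s -> (forall x, (0 <= Re (f x))%R) -> (Re (f x0) <= Re s)%R.
Proof.
  intros H Hf. apply Rnot_lt_le; intros Hn.
  destruct (H (Re (f x0) - Re s)%R ltac:(lra)) as [l0 H0].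
  destruct (nodup_em (x0 :: l0)) as [l [Hl Il]].
  specialize (H0 l Hl ltac:(intros x Hx; apply Il; right; auto)).
  pose proof (Re_csum_le (fun x => - f x) l x0) as R1.
  assert (R2 : Re (csum (fun x => - f x) l) = (- Re (csum f l))%R).
  { replace (csum (fun x => - f x) l) with (- (1) * csum f l).
    - destruct (csum f l); simpl; ring.
    - rewrite <- csum_scal. apply csum_ext_in. intros; ring. }
  assert (R3 : forall y, Re (- f y) = (- Re (f y))%R) by (intros y; reflexivity).
  rewrite R2, R3 in R1.
  specialize (R1 ltac:(intros y; rewrite R3; specialize (Hf y); lra)
    ltac:(apply Il; left; auto)).
  pose proof (re_le_Cmod (csum f l - s)) as B. pose proof (Rle_abs (Re (csum f l - s))).
  assert (Re (csum f l - s) = Re (csum f l) - Re s)%R by reflexivity. lra.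
Qed.

Lemma Psum_ext G H z : summable_lattice G -> (forall x, G x <-> H x) -> Psum H z = Psum G z.
Proof.
  intros HG E. apply tsum_has_sum. eapply has_sum_ext; [|apply (P_has_sum G z HG)].
  intros u; cbv beta. rewrite (chi_iff G H u u); auto.
Qed.

Lemma lat_iff a b G : has_basis a b G -> forall z, lat a b z <-> G z.
Proof. intros [_ HG] z. rewrite HG. reflexivity. Qed.

Lemma pdiff_minus a b x0 y0 x1 y1 s0 s1 :
  has_sum (pdiff a b x0 y0 0 0) s0 -> has_sum (pdiff a b x1 y1 0 0) s1 ->
  has_sum (pdiff a b x0 y0 x1 y1) (s0 - s1).
Proof.
  intros H0 H1. eapply has_sum_ext; [|apply (has_sum_minus _ _ _ _ H0 H1)].
  intros p. unfold pdiff. ring.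
Qed.

(** Convexity of the inverse square on either side of 0: [r - 1 / 2] and [r + 1 / 2] have the same
    sign, and their mean is [r]. *)
Lemma convex_term (r : R) : (1 <= r ^ 2)%R ->
  (0 <= (/ (1 / 2 - r) ^ 2 - / r ^ 2) + (/ (1 / 2 + r) ^ 2 - / r ^ 2))%R.
Proof.
  intros Hr.
  assert (N1 : (1 / 2 - r <> 0)%R) by (intros E; assert (r = 1 / 2)%R by lra; subst; lra).
  assert (N2 : (1 / 2 + r <> 0)%R) by (intros E; assert (r = - (1 / 2))%R by lra; subst; lra).
  assert (N3 : (r <> 0)%R) by (intros ->; lra).
  replace ((/ (1 / 2 - r) ^ 2 - / r ^ 2) + (/ (1 / 2 + r) ^ 2 - / r ^ 2))%R with
    ((3 / 2 * r ^ 2 - 1 / 8) * / ((1 / 2 - r) * (1 / 2 + r) * r) ^ 2)%R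
    by (field; repeat split; auto; intros E; (apply N1; lra) || (apply N2; lra)).
  apply Rmult_le_pos; [lra|]. left. apply Rinv_0_lt_compat.
  rewrite <- Rsqr_pow2. apply Rsqr_pos_lt. repeat apply Rmult_integral_contrapositive_currified; auto.
Qed.

(* The limit of [e1] as [b] goes to infinity; it is [L / a ^ 2] with [L >= 4], by
   pairing the indices [m] and [- m]. *)
Lemma degenerate_limit a b : (0 < Im (b * Cconj a))%R ->
  exists s0 : C, s0 <> 0 /\
  has_sum (fun p : Z * Z => if Z.eq_dec (snd p) 0 then pdiff a b (1 / 2) 0 0 0 p else 0) s0.
Proof.
  intros HD. set (f0 := fun p : Z * Z => if Z.eq_dec (snd p) 0 then pdiff a b (1 / 2) 0 0 0 p else 0).
  assert (Ha : a <> 0) by (intros ->; destruct b; simpl in HD; lra).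
  assert (A : abs_summable f0).
  { destruct (pdiff_dominated a b (1 / 2) 0 0 0 HD) as [g1 [g2 [S1' [S2' HB]]]];
      [right; left; auto|left; auto|].
    set (Z := Cmod ((1 / 2 - 0)%R * a + (0 - 0)%R * up_shift a b 0)) in *.
    apply abs_summable_le with (fun p => Z * g1 p + g2 p)%R.
    - intros p. specialize (HB 0%R p). fold Z in HB.
      replace (up_shift a b 0) with b in HB
        by (unfold up_shift; rewrite Rabs_R0; ring).
      unfold f0. destruct Z.eq_dec; auto. rewrite Cmod_0.
      eapply Rle_trans; [apply Cmod_ge_0|apply HB].
    - apply summable_plus; auto. apply summable_scal; auto. apply Cmod_ge_0. }
  exists (tsum f0). pose proof (abs_summable_has_sum f0 A) as Hs. split; auto.
  intros E. rewrite E in Hs.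
  set (F := fun p : Z * Z => a ^ 2 * f0 p + a ^ 2 * f0 ((- fst p)%Z, snd p)).
  assert (HF : has_sum F 0).
  { replace (RtoC 0) with (a ^ 2 * 0 + a ^ 2 * 0) by ring.
    apply has_sum_plus; apply has_sum_scal; auto.
    apply (has_sum_reindex (fun p : Z * Z => ((- fst p)%Z, snd p)) f0); auto.
    - intros [m n] [m' n'] H. injection H as H1 H2. f_equal; lia.
    - intros [m n] _. exists ((- m)%Z, n). simpl. f_equal. lia. }
  assert (V : forall m : Z, (m <> 0)%Z -> a ^ 2 * f0 (m, 0%Z) =
     RtoC (/ (1 / 2 - IZR m) ^ 2 - / (IZR m) ^ 2)).
  { intros m Hm. unfold f0, pdiff, pt. cbn [fst snd]. destruct (Z.eq_dec 0 0) as [_|]; [|easy].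
    assert (N1 : (1 / 2 - IZR m <> 0)%R).
    { intros E1. apply (not_int_half (1 / 2) m); lra. }
    assert (N2 : (IZR m <> 0)%R) by (apply eq_IZR_contrapositive; auto).
    assert (Q1 : RtoC (1 / 2 - IZR m) <> 0) by (intros Q; apply RtoC_inj in Q; auto).
    assert (Q2 : RtoC (IZR m) <> 0) by (intros Q; apply RtoC_inj in Q; auto).
    assert (N3 : ((1 / 2 - IZR m) ^ 2 <> 0)%R) by (apply pow_nonzero; auto).
    assert (N4 : (IZR m ^ 2 <> 0)%R) by (apply pow_nonzero; auto).
    rewrite Rminus_diag, !Cmult_0_l, !Cplus_0_r.
    rewrite (RtoC_minus (/ (1 / 2 - IZR m) ^ 2)), !RtoC_inv, !RtoC_pow by auto.
    replace (RtoC (0 - IZR m)) with (- RtoC (IZR m)) by (rewrite RtoC_minus; ring).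
    field. repeat split; auto. }
  (* At the index 0 the second inverse is [/ 0 = 0], so only [/ (a / 2) ^ 2] remains. As opposite
     indices together contribute nonnegative amounts, nothing can offset this term. *)
  assert (V0 : a ^ 2 * f0 (0%Z, 0%Z) = RtoC 4).
  { unfold f0, pdiff, pt. cbn [fst snd]. destruct (Z.eq_dec 0 0) as [_|]; [|easy].
    rewrite !Rminus_0_r, !Cmult_0_l, !Cplus_0_r, (Cinv_pow 0 2), Cinv_0.
    rewrite RtoC_div by lra. field. auto. }
  assert (R0 : (Re (F (0%Z, 0%Z)) <= Re 0)%R).
  { apply (has_sum_Re_ge F 0 (0%Z, 0%Z) HF). intros [m n]. unfold F. cbn [fst snd].
    destruct (Z.eq_dec n 0) as [->|Hn].
    - destruct (Z.eq_dec m 0) as [->|Hm].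
      + change (- 0)%Z with 0%Z. rewrite V0. simpl. lra.
      + rewrite !V by lia. rewrite opp_IZR, <- RtoC_plus.
        pose proof (convex_term (IZR m)) as Cv. unfold Re, RtoC, fst.
        replace (1 / 2 - - IZR m)%R with (1 / 2 + IZR m)%R by ring.
        replace ((- IZR m) ^ 2)%R with (IZR m ^ 2)%R by ring.
        apply Cv. replace (IZR m ^ 2)%R with (IZR (m * m)) by (rewrite mult_IZR; ring).
        apply IZR_le. nia.
    - unfold f0. cbn [snd]. destruct Z.eq_dec; [easy|]. simpl. lra. }
  unfold F in R0. cbn [fst snd] in R0. change (- 0)%Z with 0%Z in R0. rewrite V0 in R0.
  simpl in R0. lra.
Qed.

Lemma half_x a b : (1 / 2)%R * a + 0%R * b = a / 2.
Proof. rewrite RtoC_div by lra. field. Qed.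
Lemma half_y a b : 0%R * a + (1 / 2)%R * b = b / 2.
Proof. rewrite RtoC_div by lra. field. Qed.
Lemma half_xy a b : (1 / 2)%R * a + (1 / 2)%R * b = (b + a) / 2.
Proof. rewrite RtoC_div by lra. field. Qed.

Lemma up_shift_shortest a b t : (0 < Im (b * Cconj a))%R -> shortest (lat a b) a ->
  shortest (lat a (up_shift a b t)) a.
Proof.
  intros HD [_ [Ha Hmin]]. repeat split; auto.
  - exists 1%Z, 0%Z. ring.
  - intros u [m [n ->]] Hu.
    eapply Rle_trans; [|apply up_shift_mono; auto]. apply Hmin.
    + exists m, n. auto.
    + intros E. apply Hu.
      assert (HD' : Im (b * Cconj a) <> 0%R) by lra.
      destruct (basis_lower a b HD') as [c [Hc Hl]]. specialize (Hl (IZR m) (IZR n)).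
      rewrite E, Cmod_0 in Hl. pose proof (Rabs_pos (IZR m)). pose proof (Rabs_pos (IZR n)).
      assert (Rabs (IZR m) = 0 /\ Rabs (IZR n) = 0)%R as [H1 H2] by (split; nra).
      apply Rabs_eq_0 in H1, H2. rewrite H1, H2. ring.
Qed.

Lemma opposite_edges_path a b : (0 < Im (b * Cconj a))%R -> shortest (lat a b) a ->
  (Cmod (Psum (lat a b) (b / 2) - Psum (lat a b) ((b + a) / 2)) <=
   Cmod (Psum (lat a b) (a / 2) - Psum (lat a b) ((b + a) / 2)))%R.
Proof.
  intros HD Hsh.
  set (B := up_shift a b). set (L := fun t => lat a (B t)).
  set (e1 := fun t => Psum (L t) (a / 2)). set (e2 := fun t => Psum (L t) (B t / 2)).
  set (e3 := fun t => Psum (L t) ((B t + a) / 2)).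
  assert (HB : forall t, has_basis a (B t) (L t)) by (intros t; apply up_shift_basis; auto).
  assert (ok0 : base_ok 0 0) by (left; auto).
  assert (okx : base_ok (1 / 2) 0) by (right; left; auto).
  assert (oky : base_ok 0 (1 / 2)) by (right; right; left; auto).
  assert (okxy : base_ok (1 / 2) (1 / 2)) by (right; right; right; auto).
  assert (H1 : forall t, has_sum (pdiff a (B t) (1 / 2) 0 0 0) (e1 t)).
  { intros t. unfold e1. rewrite <- (half_x a (B t)). apply P_pairs; auto. }
  assert (H2 : forall t, has_sum (pdiff a (B t) 0 (1 / 2) 0 0) (e2 t)).
  { intros t. unfold e2. rewrite <- (half_y a (B t)). apply P_pairs; auto. }
  assert (H3 : forall t, has_sum (pdiff a (B t) (1 / 2) (1 / 2) 0 0) (e3 t)).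
  { intros t. unfold e3. rewrite <- half_xy. apply P_pairs; auto. }
  assert (C13 := pdiff_sum_continuous a b (1 / 2) 0 (1 / 2) (1 / 2) (fun t => e1 t - e3 t) HD
    okx okxy (fun t => pdiff_minus _ _ _ _ _ _ _ _ (H1 t) (H3 t))).
  assert (C23 := pdiff_sum_continuous a b 0 (1 / 2) (1 / 2) (1 / 2) (fun t => e2 t - e3 t) HD
    oky okxy (fun t => pdiff_minus _ _ _ _ _ _ _ _ (H2 t) (H3 t))).
  set (D := fun t => (Cmod (e1 t - e3 t) - Cmod (e2 t - e3 t))%R).
  assert (tri : forall x y : C, (Rabs (Cmod x - Cmod y) <= Cmod (x - y))%R).
  { intros x y. apply Rabs_le. split.
    - assert (Cmod y <= Cmod x + Cmod (x - y))%R; [|lra].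
      replace y with (x + - (x - y)) at 1 by ring.
      eapply Rle_trans; [apply Cmod_triangle|]. rewrite Cmod_opp. lra.
    - assert (Cmod x <= Cmod y + Cmod (x - y))%R; [|lra].
      replace x with (y + (x - y)) at 1 by ring. apply Cmod_triangle. }
  assert (CD : continuity D).
  { intros t0 eps He.
    destruct (filter_and (F := locally t0) _ _ (C13 t0 (eps / 2)%R ltac:(lra)) (C23 t0 (eps / 2)%R ltac:(lra)))
      as [d Hd].
    exists d. split; [apply cond_pos|]. intros t [_ Ht]. specialize (Hd t Ht) as [D1 D2].
    simpl. unfold Rdist, D.
    pose proof (tri (e1 t - e3 t) (e1 t0 - e3 t0)). pose proof (tri (e2 t - e3 t) (e2 t0 - e3 t0)).
    replace (Cmod (e1 t - e3 t) - Cmod (e2 t - e3 t) - (Cmod (e1 t0 - e3 t0) - Cmod (e2 t0 - e3 t0)))%R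
      with ((Cmod (e1 t - e3 t) - Cmod (e1 t0 - e3 t0)) + - (Cmod (e2 t - e3 t) - Cmod (e2 t0 - e3 t0)))%R
      by ring.
    eapply Rle_lt_trans; [apply Rabs_triang|]. rewrite Rabs_Ropp. lra. }
  assert (ND : forall t, t <> 0%R -> D t <> 0%R).
  { intros t Ht E. unfold D in E.
    pose proof (up_shift_shortest a b t HD Hsh) as Hst. fold B in Hst. fold (L t) in Hst.
    destruct (equality_case a (B t) (L t) (HB t) Hst) as [v [u [Hv [Hu Ev]]]].
    { fold (e1 t) (e2 t) (e3 t). lra. }
    (* The coefficient [1 + 2 j] of [B t] is odd, hence nonzero, so the corresponding vector of the
       unshifted lattice is strictly shorter than [v], and therefore than [a]. *)
    destruct Hu as [i [j Eu]].
    assert (Ev2 : v = (2 * IZR i)%R * a + (1 + 2 * IZR j)%R * B t).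
    { rewrite Ev, Eu. rewrite RtoC_plus, !RtoC_mult. ring. }
    assert (Hj : (1 + 2 * IZR j <> 0)%R).
    { rewrite <- mult_IZR, <- plus_IZR. apply eq_IZR_contrapositive. lia. }
    pose proof (up_shift_strict a b t (2 * IZR i) (1 + 2 * IZR j) HD Hj Ht) as Lt.
    fold (B t) in Lt. rewrite <- Ev2 in Lt.
    destruct Hv as [_ [_ Hv]]. destruct Hst as [La [La0 _]]. specialize (Hv a La La0).
    assert (Cmod a <= Cmod ((2 * IZR i)%R * a + (1 + 2 * IZR j)%R * b))%R; [|lra].
    apply Hsh.
    - exists (2 * i)%Z, (1 + 2 * j)%Z. rewrite plus_IZR, !mult_IZR. auto.
    - intros E0. assert (HD' : Im (b * Cconj a) <> 0%R) by lra.
      destruct (basis_lower a b HD') as [c [Hc Hl]].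
      specialize (Hl (2 * IZR i)%R (1 + 2 * IZR j)%R). rewrite E0, Cmod_0 in Hl.
      pose proof (Rabs_pos (2 * IZR i)). pose proof (Rabs_pos_lt _ Hj). nra. }
  assert (PD : exists T, (0 < T)%R /\ (0 < D T)%R).
  { destruct (degenerate_limit a b HD) as [s0 [Hs0 Hsum]].
    assert (P0 : (0 < Cmod s0)%R) by (apply Cmod_gt_0; auto).
    assert (Q1 := pdiff_sum_limit a b (1 / 2) 0 0 e1
      (fun p : Z * Z => if Z.eq_dec (snd p) 0 then pdiff a b (1 / 2) 0 0 0 p else 0)
      s0 HD okx ok0 H1).
    assert (Q1' : forall eps, (0 < eps)%R ->
       Rbar_locally p_infty (fun t => (Cmod (e1 t - s0) < eps)%R)).
    { apply Q1; auto.
      - intros p Hp. destruct Z.eq_dec as [E|]; auto. rewrite E in Hp. easy.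
      - intros p Hp. destruct Z.eq_dec as [E|Hn]; auto. exfalso; apply Hn.
        apply eq_IZR; auto. }
    assert (Q2 := pdiff_sum_limit a b 0 (1 / 2) (1 / 2) (fun t => e2 t - e3 t) (fun _ => 0) 0 HD
      oky okxy (fun t => pdiff_minus _ _ _ _ _ _ _ _ (H2 t) (H3 t))).
    assert (Q2' : forall eps, (0 < eps)%R ->
       Rbar_locally p_infty (fun t => (Cmod (e2 t - e3 t - 0) < eps)%R)).
    { apply Q2; auto.
      - intros p Hp. exfalso. apply (not_int_half (1 / 2) (snd p)); lra.
      - apply has_sum_zero. }
    destruct (filter_and (F := Rbar_locally p_infty) _ _ (Q1' (Cmod s0 / 2)%R ltac:(lra)) (Q2' (Cmod s0 / 4)%R ltac:(lra)))
      as [M HM].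
    pose proof (Rabs_pos M). pose proof (Rle_abs M).
    exists (Rabs M + 1)%R. split; [lra|]. set (T := (Rabs M + 1)%R).
    destruct (HM T ltac:(unfold T; lra)) as [M1 M2].
    destruct (half_facts a (B T) (L T) (HB T)) as [_ [E0 _]].
    fold (e1 T) (e2 T) (e3 T) in E0.
    unfold Cminus in M2 at 1. rewrite Copp_0, Cplus_0_r in M2.
    pose proof (tri (e1 T) s0) as T1. apply Rabs_le_between in T1.
    (* Because [e1 + e2 + e3 = 0], a small [e2 - e3] puts [e1 - e3] near [3 e1 / 2]. The choices
       [Cmod s0 / 2] and [Cmod s0 / 4] keep [Cmod (e1 T)] above [Cmod (e2 T - e3 T)]. *)
    assert (E13 : 2 * (e1 T - e3 T) = 3 * e1 T + (e2 T - e3 T)).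
    { apply sub_eq_0. transitivity (- (e1 T + e2 T + e3 T)); [ring|]. rewrite E0. ring. }
    assert (B1 : (3 * Cmod (e1 T) <= 2 * Cmod (e1 T - e3 T) + Cmod (e2 T - e3 T))%R).
    { replace (3 * Cmod (e1 T))%R with (Cmod (3 * e1 T))
        by (rewrite Cmod_mult, Cmod_R, Rabs_pos_eq; lra).
      replace (2 * Cmod (e1 T - e3 T))%R with (Cmod (2 * (e1 T - e3 T)))
        by (rewrite Cmod_mult, Cmod_R, Rabs_pos_eq; lra).
      replace (3 * e1 T) with (2 * (e1 T - e3 T) + - (e2 T - e3 T)) by (rewrite E13; ring).
      eapply Rle_trans; [apply Cmod_triangle|]. rewrite Cmod_opp. lra. }
    unfold D. lra. }
  destruct PD as [T [HT HDT]].
  assert (B0 : B 0%R = b) by (unfold B, up_shift; rewrite Rabs_R0; ring).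
  assert (D0 : (0 <= D 0)%R).
  { apply Rnot_lt_le; intros Hn. destruct (IVT D 0 T CD HT Hn HDT) as [z [Hz Ez]].
    apply (ND z); auto. intros ->. lra. }
  unfold D, e1, e2, e3, L in D0. rewrite B0 in D0. lra.
Qed.

Lemma shortest_iff G H v : (forall x, G x <-> H x) -> shortest G v -> shortest H v.
Proof.
  intros E [Hv [Hv0 Hm]]. repeat split; auto; [apply E; auto|].
  intros u Hu; apply Hm, E; auto.
Qed.

Lemma opposite_edges a b G : has_basis a b G -> shortest G a ->
  (Cmod (Psum G (b / 2) - Psum G ((b + a) / 2)) <=
   Cmod (Psum G (a / 2) - Psum G ((b + a) / 2)))%R.
Proof.
  intros HB Ha. pose proof (basis_slat a b G HB) as HG.
  assert (pos : forall b', has_basis a b' G -> (0 < Im (b' * Cconj a))%R ->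
    (Cmod (Psum G (b' / 2) - Psum G ((b' + a) / 2)) <=
     Cmod (Psum G (a / 2) - Psum G ((b' + a) / 2)))%R).
  { intros b' HB' HD. assert (E : forall x, G x <-> lat a b' x)
      by (intros x; symmetry; apply (lat_iff a b'); auto).
    pose proof (opposite_edges_path a b' HD (shortest_iff _ _ _ E Ha)) as H.
    rewrite !(Psum_ext G (lat a b')) in H by auto. auto. }
  destruct (Rtotal_order 0 (Im (b * Cconj a))) as [H|[H|H]].
  - apply pos; auto.
  - exfalso. apply HB. auto.
  - assert (HN : (0 < Im (- b * Cconj a))%R).
    { replace (Im (- b * Cconj a)) with (- Im (b * Cconj a))%R by (destruct a, b; simpl; ring). lra. }
    (* Negative orientation: passing from [b] to [- b] changes none of the half-period values, since
       [P] is even and periodic. *)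
    pose proof (pos (- b) (basis_neg _ _ _ HB) HN) as P.
    replace (- b / 2) with (- (b / 2)) in P by field.
    replace ((- b + a) / 2) with ((b + a) / 2 + - b) in P by field.
    rewrite P_opp, P_periodic in P; auto.
    apply sub_opp; [apply HG|apply (basis_in_r a b); auto].
Qed.

(** * Lattices and their subgroups of index 2 *)

Lemma discrete_gap G : is_subgroup G -> is_discrete G ->
  exists d, (0 < d)%R /\ forall u, G u -> u <> 0 -> (d <= Cmod u)%R.
Proof.
  intros HS HD. destruct (HD 0 (proj1 HS)) as [d Hd]. exists d.
  split; [apply cond_pos|]. intros u Hu Hu0. apply Rnot_lt_le; intros Hn. apply Hu0.
  apply Hd; auto. apply C_NormedModule_mixin_compat1.
  change (Cmod (u - 0) < d)%R. replace (u - 0) with u by ring. auto.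
Qed.

Lemma NoDup_map_on {A B : Type} (f : A -> B) l : NoDup l ->
  (forall x y, In x l -> In y l -> f x = f y -> x = y) -> NoDup (map f l).
Proof.
  induction 1 as [|x l Hx Hl IH]; intros Hf; simpl; constructor.
  - intros Hn. apply in_map_iff in Hn as [y [E Hy]]. apply Hx.
    rewrite <- (Hf y x); auto; [right|left]; auto.
  - apply IH. intros; apply Hf; auto; right; auto.
Qed.

Definition zrange (K : nat) : list Z := map (fun n => Z.of_nat n - Z.of_nat K)%Z (seq 0 (2 * K + 1)).

Lemma zrange_In K m : (Z.abs m <= Z.of_nat K)%Z -> In m (zrange K).
Proof.
  intros H. apply in_map_iff. exists (Z.to_nat (m + Z.of_nat K)). split; [lia|].
  apply in_seq. lia.
Qed.

(** Pigeonhole with square cells of side [d / 2]: two points of the same cell are less than [d]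
    apart. It prepares the choice of a basis, from which the summability behind [finite_disk] is
    derived. *)
Lemma discrete_finite G r : is_subgroup G -> is_discrete G ->
  exists l, NoDup l /\ forall u, In u l <-> G u /\ (Cmod u <= r)%R.
Proof.
  intros HS HD. destruct (discrete_gap G HS HD) as [d [Hd Hsep]].
  set (k := fun u : C => (up (Re u / (d / 2)), up (Im u / (d / 2)))).
  set (K := Z.to_nat (up (Rabs r / (d / 2)) + 1)).
  apply (finite_list _ (length (list_prod (zrange K) (zrange K)))).
  intros l Hl HP. rewrite List.Forall_forall in HP.
  assert (cell : forall x y, up (x / (d / 2)) = up (y / (d / 2)) -> (Rabs (x - y) <= d / 2)%R).
  { intros x y E. pose proof (archimed (x / (d / 2))). pose proof (archimed (y / (d / 2))).
    rewrite E in *.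
    assert (Rabs (x / (d / 2) - y / (d / 2)) <= 1)%R by (apply Rabs_le; lra).
    replace (x - y)%R with ((x / (d / 2) - y / (d / 2)) * (d / 2))%R by (field; lra).
    rewrite Rabs_mult, (Rabs_pos_eq (d / 2)) by lra. nra. }
  assert (rng : forall x, (Rabs x <= Rabs r)%R -> (Z.abs (up (x / (d / 2))) <= Z.of_nat K)%Z).
  { intros x Hx. pose proof (archimed (x / (d / 2))) as [A1 A2].
    pose proof (archimed (Rabs r / (d / 2))) as [B1 B2].
    assert (Hq : (Rabs (x / (d / 2)) <= Rabs r / (d / 2))%R).
    { unfold Rdiv at 1. rewrite Rabs_mult, (Rabs_pos_eq (/ (d / 2))).
      - apply Rmult_le_compat_r; auto. left; apply Rinv_0_lt_compat; lra.
      - left; apply Rinv_0_lt_compat; lra. }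
    apply Rabs_le_between in Hq.
    assert (C1 : (IZR (up (x / (d / 2))) < IZR (up (Rabs r / (d / 2)) + 1))%R)
      by (rewrite plus_IZR; lra).
    assert (C2 : (IZR (- up (Rabs r / (d / 2)) - 1) < IZR (up (x / (d / 2))))%R)
      by (rewrite minus_IZR, opp_IZR; lra).
    apply lt_IZR in C1, C2. unfold K. lia. }
  rewrite <- (length_map k l). apply NoDup_incl_length.
  - apply NoDup_map_on; auto. intros x y Hx Hy E. apply NNPP; intros Hn.
    injection E as E1 E2. apply cell in E1, E2.
    destruct (HP x Hx) as [Gx _]. destruct (HP y Hy) as [Gy _].
    assert (Hxy : x - y <> 0) by (intros E; apply Hn, sub_eq_0; auto).
    specialize (Hsep (x - y) (proj2 HS x y Gx Gy) Hxy).
    pose proof (Cmod2_alt (x - y)) as Q.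
    replace (Re (x - y)) with (Re x - Re y)%R in Q by reflexivity.
    replace (Im (x - y)) with (Im x - Im y)%R in Q by reflexivity.
    rewrite <- (pow2_abs (Re x - Re y)), <- (pow2_abs (Im x - Im y)) in Q.
    pose proof (Rabs_pos (Re x - Re y)). pose proof (Rabs_pos (Im x - Im y)).
    assert (Rabs (Re x - Re y) ^ 2 <= (d / 2) ^ 2)%R by (apply pow_incr; lra).
    assert (Rabs (Im x - Im y) ^ 2 <= (d / 2) ^ 2)%R by (apply pow_incr; lra).
    assert (d ^ 2 <= Cmod (x - y) ^ 2)%R by (apply pow_incr; lra).
    assert (0 < d ^ 2)%R by (apply pow_lt; auto). lra.
  - intros p Hp. apply in_map_iff in Hp as [u [<- Hu]]. destruct (HP u Hu) as [_ Hur].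
    pose proof (Rle_abs r). pose proof (re_le_Cmod u). pose proof (im_le_Cmod u).
    apply in_prod; apply zrange_In, rng; lra.
Qed.

Lemma list_min (l : list C) : l <> nil ->
  exists x, In x l /\ forall y, In y l -> (Cmod x <= Cmod y)%R.
Proof.
  induction l as [|a l IH]; [easy|]. intros _. destruct l as [|b l].
  - exists a. split; [left; auto|]. intros y [<-|[]]. lra.
  - destruct IH as [x [Hx Hm]]; [discriminate|].
    destruct (Rle_dec (Cmod a) (Cmod x)) as [H|H].
    + exists a. split; [left; auto|]. intros y [<-|Hy]; [lra|]. specialize (Hm y Hy). lra.
    + exists x. split; [right; auto|]. intros y [<-|Hy]; [lra|]. apply Hm; auto.
Qed.

Lemma discrete_min G (A : C -> Prop) x0 : is_subgroup G -> is_discrete G ->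
  (forall u, A u -> G u) -> A x0 ->
  exists x, A x /\ forall y, A y -> (Cmod x <= Cmod y)%R.
Proof.
  intros HS HD HA H0.
  destruct (discrete_finite G (Cmod x0) HS HD) as [l [Hl Il]].
  set (p := fun x => if excluded_middle_informative (A x) then true else false).
  assert (Hp : forall x, p x = true <-> A x).
  { intros x; unfold p; destruct excluded_middle_informative; split; easy. }
  destruct (list_min (filter p l)) as [x [Hx Hm]].
  { intros E. assert (In x0 (filter p l)) as Hin.
    { apply filter_In. split; [apply Il; split; auto; lra|apply Hp; auto]. }
    rewrite E in Hin. destruct Hin. }
  apply filter_In in Hx as [Hx1 Hx2]. exists x. split; [apply Hp; auto|].
  intros y Hy. destruct (Rle_dec (Cmod y) (Cmod x0)) as [H|H].
  - apply Hm, filter_In. split; [apply Il; split; auto|apply Hp; auto].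
  - apply Il in Hx1. lra.
Qed.

Lemma nearest_int (x : R) : exists m : Z, (Rabs (x - IZR m) <= 1 / 2)%R.
Proof.
  exists (up (x - 1 / 2)). pose proof (archimed (x - 1 / 2)). apply Rabs_le. lra.
Qed.

Lemma sub_int_mult G a (m : Z) : is_subgroup G -> G a -> G (IZR m * a).
Proof.
  intros HS Ha.
  assert (N : forall n : nat, G (IZR (Z.of_nat n) * a)).
  { induction n.
    - simpl. rewrite Cmult_0_l. apply HS.
    - rewrite Nat2Z.inj_succ, succ_IZR, RtoC_plus, Cmult_plus_distr_r, Cmult_1_l.
      apply sub_plus; auto. }
  destruct (Z_le_dec 0 m) as [H|H].
  - rewrite <- (Z2Nat.id m H). auto.
  - replace (IZR m * a) with (- (IZR (Z.of_nat (Z.to_nat (- m))) * a)).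
    + apply sub_opp; auto.
    + rewrite Z2Nat.id by lia. rewrite opp_IZR, RtoC_opp. ring.
Qed.

Lemma Z_comb_2 (m n : Z) (x y : C) :
  Z_comb (m :: n :: nil) (x :: y :: nil) = IZR m * x + IZR n * y.
Proof. unfold Z_comb; simpl. ring. Qed.

Lemma lattice_two G : is_lattice G -> exists x y, G x /\ G y /\
  forall m n : Z, IZR m * x + IZR n * y = 0 -> (m = 0 /\ n = 0)%Z.
Proof.
  intros [_ [_ [[ws [Hlen [HG Hi]]] _]]].
  destruct ws as [|x [|y [|z ws]]]; try discriminate.
  inversion HG as [|? ? Hx HG' E1 ]; subst. inversion HG' as [|? ? Hy HG'' E2]; subst.
  exists x, y. repeat split; auto.
  - specialize (Hi (m :: n :: nil) eq_refl). rewrite Z_comb_2 in Hi. specialize (Hi H).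
    inversion Hi; auto.
  - specialize (Hi (m :: n :: nil) eq_refl). rewrite Z_comb_2 in Hi. specialize (Hi H).
    inversion Hi as [|? ? ? H2]; subst. inversion H2; auto.
Qed.

Lemma shortest_exists G : is_lattice G -> exists a, shortest G a.
Proof.
  intros HL. destruct (lattice_two G HL) as [x [y [Hx [Hy Hi]]]].
  destruct HL as [HS [HD _]].
  destruct (discrete_min G (fun u => G u /\ u <> 0) x HS HD) as [a [[Ha Ha0] Hm]].
  - tauto.
  - split; auto. intros ->. destruct (Hi 1%Z 0%Z); [ring|lia].
  - exists a. repeat split; auto.
Qed.

Lemma solve_coords (a b z : C) : Im (b * Cconj a) <> 0%R ->
  exists x y : R, z = x * a + y * b.
Proof.
  intros HD. set (D := Im (b * Cconj a)) in *.
  exists (- Im (z * Cconj b) / D)%R, (Im (z * Cconj a) / D)%R.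
  unfold D in *. destruct a as [a1 a2], b as [b1 b2], z as [z1 z2].
  unfold Cconj, Cmult, Cplus, RtoC, Im in *; simpl in *.
  f_equal; field; intros E; apply HD; lra.
Qed.

(** Lagrange reduction: [b] is a shortest vector outside [Z a]. Reducing both coordinates of a
    lattice vector to absolute value at most 1 / 2 leaves a vector shorter than [b], hence a
    multiple of [a]. *)
Lemma shortest_basis G a : is_lattice G -> shortest G a -> exists b, has_basis a b G.
Proof.
  intros HL [Ha [Ha0 Hmin]]. destruct (lattice_two G HL) as [x [y [Hx [Hy Hi]]]].
  destruct HL as [HS [HD _]]. pose proof (proj1 (Cmod_gt_0 a) Ha0) as Pa.
  set (A := fun u => G u /\ ~ exists m : Z, u = IZR m * a).
  assert (HA : exists u, A u).
  { apply NNPP; intros Hn.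
    assert (M : forall u, G u -> exists m : Z, u = IZR m * a).
    { intros u Hu. apply NNPP; intros Hm. apply Hn. exists u. split; auto. }
    destruct (M x Hx) as [m Em]. destruct (M y Hy) as [n En].
    destruct (Hi n (- m)%Z) as [E1 E2].
    { rewrite Em, En, opp_IZR, RtoC_opp. ring. }
    assert (m = 0%Z) by lia. subst m.
    destruct (Hi 1%Z 0%Z); [rewrite Em; ring|lia]. }
  destruct HA as [u0 Hu0].
  destruct (discrete_min G A u0 HS HD (fun u H => proj1 H) Hu0) as [b [[Hb Hbm] Hbmin]].
  assert (small : forall u, G u -> (Cmod u < Cmod a)%R -> u = 0).
  { intros u Hu Hlt. apply NNPP; intros Hn. specialize (Hmin u Hu Hn). lra. }
  assert (Hdet : Im (b * Cconj a) <> 0%R).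
  (* If the determinant vanished, [b] would be a real multiple of [a], and subtracting the nearest
     integer multiple would leave a vector shorter than [a], that is, 0. *)
  { intros E. set (t := (Re (b * Cconj a) / Cmod a ^ 2)%R).
    assert (Pa2 : (Cmod a ^ 2 <> 0)%R) by (apply pow_nonzero; lra).
    assert (Eb : b = t * a).
    { assert (Ec : b * (a * Cconj a) = t * a * (a * Cconj a)).
      { transitivity (a * (b * Cconj a)); [ring|].
        transitivity (a * (t * Cmod a ^ 2)).
        - f_equal. rewrite <- RtoC_pow, <- RtoC_mult. unfold t.
          replace (Re (b * Cconj a) / Cmod a ^ 2 * Cmod a ^ 2)%R with (Re (b * Cconj a))
            by (field; apply Rgt_not_eq; auto).
          destruct (b * Cconj a) as [r i]. simpl in E |- *. subst i. reflexivity.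
        - rewrite <- RtoC_pow, Cmod2_conj. ring. }
      rewrite <- Cmod2_conj in Ec.
      assert (Q : RtoC (Cmod a ^ 2) <> 0) by (intros Q; apply RtoC_inj in Q; auto).
      transitivity (b * RtoC (Cmod a ^ 2) / RtoC (Cmod a ^ 2)); [field; auto|].
      rewrite Ec. field. auto. }
    destruct (nearest_int t) as [m Hm].
    apply Hbm. exists m. apply sub_eq_0, small.
    - apply HS; auto. apply sub_int_mult; auto.
    - rewrite Eb. replace (t * a - IZR m * a) with ((t - IZR m)%R * a)
        by (rewrite RtoC_minus; ring).
      rewrite Cmod_mult, Cmod_R. nra. }
  exists b. split; auto. intros z. split.
  2: { intros [m [n ->]]. apply sub_plus; auto; apply sub_int_mult; auto. }
  intros Hz. destruct (solve_coords a b z Hdet) as [s [t Ez]].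
  destruct (nearest_int s) as [m Hm]. destruct (nearest_int t) as [n Hn].
  set (r := z - (IZR m * a + IZR n * b)).
  assert (Hr : G r).
  { apply HS; auto. apply sub_plus; auto; apply sub_int_mult; auto. }
  assert (Er : r = (s - IZR m)%R * a + (t - IZR n)%R * b).
  { unfold r. rewrite Ez, !RtoC_minus. ring. }
  assert (Hlt : (Cmod r < Cmod b)%R).
  { set (p := (s - IZR m)%R) in *. set (q := (t - IZR n)%R) in *.
    pose proof (Cmod_ge_0 b) as Pb.
    assert (Hb0 : b <> 0) by (intros ->; apply Hbm; exists 0%Z; ring).
    pose proof (Hmin b Hb Hb0) as Hab.
    set (c := Re (b * Cconj a)).
    (* Cauchy-Schwarz is strict because the determinant is not 0; this makes [|r| ^ 2] strictly less
       than [(1 / 4 + 1 / 4 + 1 / 2) |b| ^ 2]. *)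
    assert (Hc : (Rabs c < Cmod a * Cmod b)%R).
    { apply Rsqr_incrst_0; [|apply Rabs_pos|nra].
      rewrite !Rsqr_pow2, pow2_abs.
      assert (E : ((Cmod a * Cmod b) ^ 2 = c ^ 2 + Im (b * Cconj a) ^ 2)%R).
      { rewrite Rpow_mult_distr, !Cmod2_alt. unfold c. destruct a, b; simpl. ring. }
      assert (0 < Im (b * Cconj a) ^ 2)%R by (rewrite <- Rsqr_pow2; apply Rsqr_pos_lt; auto).
      lra. }
    assert (E : (Cmod r ^ 2 = p ^ 2 * Cmod a ^ 2 + q ^ 2 * Cmod b ^ 2 + 2 * (p * q) * c)%R).
    { rewrite Er, !Cmod2_alt. unfold c. destruct a, b; simpl. ring. }
    assert (p2 : (p ^ 2 <= 1 / 4)%R) by (rewrite <- pow2_abs; pose proof (Rabs_pos p); nra).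
    assert (q2 : (q ^ 2 <= 1 / 4)%R) by (rewrite <- pow2_abs; pose proof (Rabs_pos q); nra).
    assert (pq : (2 * (p * q) * c <= 1 / 2 * Rabs c)%R).
    { eapply Rle_trans; [apply Rle_abs|]. rewrite !Rabs_mult, (Rabs_pos_eq 2) by lra.
      apply Rmult_le_compat_r; [apply Rabs_pos|].
      pose proof (Rabs_pos p). pose proof (Rabs_pos q). nra. }
    apply Rsqr_incrst_0; try apply Cmod_ge_0; auto. rewrite !Rsqr_pow2, E.
    assert (a2 : (Cmod a ^ 2 <= Cmod b ^ 2)%R) by (apply pow_incr; lra).
    assert (ab : (Cmod a * Cmod b <= Cmod b ^ 2)%R) by nra.
    pose proof (pow2_ge_0 (Cmod a)). pose proof (pow2_ge_0 (Cmod b)).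
    assert (p ^ 2 * Cmod a ^ 2 <= 1 / 4 * Cmod b ^ 2)%R
      by (apply Rmult_le_compat; auto; apply pow2_ge_0).
    assert (q ^ 2 * Cmod b ^ 2 <= 1 / 4 * Cmod b ^ 2)%R
      by (apply Rmult_le_compat_r; auto).
    lra. }
  destruct (classic (exists k : Z, r = IZR k * a)) as [[k Ek]|Hk].
  - exists (m + k)%Z, n. rewrite plus_IZR, RtoC_plus.
    replace z with (r + (IZR m * a + IZR n * b)) by (unfold r; ring). rewrite Ek. ring.
  - exfalso. specialize (Hbmin r (conj Hr Hk)). lra.
Qed.

(** * The three subgroups of index 2 *)

Definition half_class_of (G H : C -> Prop) (w : C) : Prop :=
  forall v, H v <-> G (v / 2) \/ G ((v - w) / 2).

(** The predicate describes the union of [2 G] and [a + 2 G]; its two cosets are represented by 0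
    and [b]. *)
Lemma half_class_subgroup a b G : has_basis a b G ->
  is_subgroup_of_index 2 G (fun v => G (v / 2) \/ G ((v - a) / 2)).
Proof.
  intros HB. pose proof (basis_slat a b G HB) as HG. pose proof (proj1 HG) as HS.
  pose proof (basis_in_l a b G HB) as Ha. pose proof (basis_in_r a b G HB) as Hb.
  assert (D2 : RtoC 2 <> 0) by (intros E; apply RtoC_inj in E; lra).
  assert (dbl : forall v, G (v / 2) -> G v).
  { intros v H. replace v with (v / 2 + v / 2) by (field; auto). apply sub_plus; auto. }
  assert (Nb : ~ G (b / 2)) by (apply primitive_half, (basis_primitive_r a b); auto).
  assert (Nba : ~ G ((b - a) / 2)).
  { intros H. apply (primitive_half G (b + a)).
    - apply (basis_primitive_r a (b + a)), basis_plus; auto.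
    - replace ((b + a) / 2) with ((b - a) / 2 + a) by (field; auto). apply sub_plus; auto. }
  split; [|split].
  - split.
    + left. replace (0 / 2) with (RtoC 0) by (field; auto). apply HS.
    + intros x y [Hx|Hx] [Hy|Hy].
      * left. replace ((x - y) / 2) with (x / 2 - y / 2) by (field; auto). apply HS; auto.
      * right. replace ((x - y - a) / 2) with (x / 2 - (y - a) / 2 - a) by (field; auto).
        apply HS; auto. apply HS; auto.
      * right. replace ((x - y - a) / 2) with ((x - a) / 2 - y / 2) by (field; auto).
        apply HS; auto.
      * left. replace ((x - y) / 2) with ((x - a) / 2 - (y - a) / 2) by (field; auto).
        apply HS; auto.
  - intros v [H|H]; auto.
    replace v with (v - a + a) by ring. apply sub_plus; auto.
  - exists (RtoC 0 :: b :: nil). repeat split.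
    + constructor; [|constructor; [easy|constructor]].
      intros [E|[]]. apply Nb. rewrite E. replace (0 / 2) with (RtoC 0) by (field; auto).
      apply HS.
    + constructor; [apply HS|]. constructor; auto.
    + intros x Hx.
      assert (x0 : forall u, G u -> (x = 2 * u \/ x = a + 2 * u) ->
         exists! t, In t (RtoC 0 :: b :: nil) /\ (G ((x - t) / 2) \/ G ((x - t - a) / 2))).
      { intros u Hu E. exists (RtoC 0). split; [split; [left; auto|]|].
        - destruct E as [->| ->]; [left|right].
          + replace ((2 * u - 0) / 2) with u by (field; auto). auto.
          + replace ((a + 2 * u - 0 - a) / 2) with u by (field; auto). auto.
        - intros t [[<-|[<-|[]]] Ht]; auto. exfalso.
          destruct E as [->| ->]; destruct Ht as [Ht|Ht].
          + apply Nb. replace (b / 2) with (u - (2 * u - b) / 2) by (field; auto). apply HS; auto.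
          + apply Nba. replace ((b - a) / 2) with (u - (2 * u - b - a) / 2 - a) by (field; auto).
            apply HS; auto. apply HS; auto.
          + apply Nba. replace ((b - a) / 2) with (u - (a + 2 * u - b) / 2) by (field; auto).
            apply HS; auto.
          + apply Nb. replace (b / 2) with (u - (a + 2 * u - b - a) / 2) by (field; auto).
            apply HS; auto. }
      assert (x1 : forall u, G u -> (x = b + 2 * u \/ x = b + a + 2 * u) ->
         exists! t, In t (RtoC 0 :: b :: nil) /\ (G ((x - t) / 2) \/ G ((x - t - a) / 2))).
      { intros u Hu E. exists b. split; [split; [right; left; auto|]|].
        - destruct E as [->| ->]; [left|right].
          + replace ((b + 2 * u - b) / 2) with u by (field; auto). auto.
          + replace ((b + a + 2 * u - b - a) / 2) with u by (field; auto). auto.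
        - intros t [[<-|[<-|[]]] Ht]; auto. exfalso.
          destruct E as [->| ->]; destruct Ht as [Ht|Ht].
          + apply Nb. replace (b / 2) with ((b + 2 * u - 0) / 2 - u) by (field; auto). apply HS; auto.
          + apply Nba. replace ((b - a) / 2) with ((b + 2 * u - 0 - a) / 2 - u) by (field; auto).
            apply HS; auto.
          + apply Nba. replace ((b - a) / 2) with ((b + a + 2 * u - 0) / 2 - u - a) by (field; auto).
            apply HS; auto. apply HS; auto.
          + apply Nb. replace (b / 2) with ((b + a + 2 * u - 0 - a) / 2 - u) by (field; auto).
            apply HS; auto. }
      destruct (half_class a b G x HB Hx) as [[u [Hu E]]|[[u [Hu E]]|[[u [Hu E]]|[u [Hu E]]]]].
      * apply (x0 u); auto.
      * apply (x0 u); auto.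
      * apply (x1 u); auto.
      * apply (x1 u); auto.
Qed.

(** The list of representatives is used only through these two consequences: some element lies
    outside [H], and all elements outside [H] form a single coset. *)
Lemma index2_facts G H : is_subgroup G -> is_subgroup_of_index 2 G H ->
  (exists x, G x /\ ~ H x) /\ (forall x y, G x -> G y -> ~ H x -> ~ H y -> H (x - y)).
Proof.
  intros HS [HH [Hsub [ts [Hlen [Hnd [Hts Huni]]]]]].
  destruct ts as [|t1 [|t2 [|t3 ts]]]; try discriminate.
  assert (t12 : t1 <> t2).
  { intros ->. inversion Hnd as [|? ? Hn]. apply Hn. left; auto. }
  assert (plus : forall x y, H x -> H y -> H (x + y)) by (intros; apply sub_plus; auto).
  split.
  - apply NNPP; intros Hn.
    assert (all : forall x, G x -> H x).
    { intros x Hx. apply NNPP; intros Hx'. apply Hn; exists x; auto. }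
    inversion Hts as [|? ? G1 Hts']; subst. inversion Hts' as [|? ? G2 _]; subst.
    destruct (Huni 0 (proj1 HS)) as [t [_ U]].
    apply t12. rewrite <- (U t1), <- (U t2); auto.
    + split; [right; left; auto|]. apply all, HS; auto. apply HS.
    + split; [left; auto|]. apply all, HS; auto. apply HS.
  - intros x y Gx Gy Hx Hy.
    destruct (Huni 0 (proj1 HS)) as [t0 [[I0 H0] _]].
    assert (Ht0 : H t0).
    { replace t0 with (0 - (0 - t0)) by ring. apply HH; auto. apply HH. }
    destruct (Huni x Gx) as [tx [[Ix Htx] _]]. destruct (Huni y Gy) as [ty [[Iy Hty] _]].
    assert (nx : tx <> t0).
    { intros ->. apply Hx. replace x with (x - t0 + t0) by ring. auto. }
    assert (ny : ty <> t0).
    { intros ->. apply Hy. replace y with (y - t0 + t0) by ring. auto. }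
    assert (E : tx = ty).
    { destruct I0 as [<-|[<-|[]]]; destruct Ix as [<-|[<-|[]]];
        destruct Iy as [<-|[<-|[]]]; auto; exfalso; auto. }
    replace (x - y) with ((x - tx) - (y - ty)) by (rewrite E; ring). apply HH; auto.
Qed.

(** [H] contains [2 G], so it corresponds to a subgroup of order 2 of the four-group [G / 2 G],
    generated by one of the three nonzero classes. *)
Lemma index2_cases a b G H : has_basis a b G -> is_subgroup_of_index 2 G H ->
  half_class_of G H a \/ half_class_of G H b \/ half_class_of G H (b + a).
Proof.
  intros HB HH. pose proof (basis_slat a b G HB) as HG. pose proof (proj1 HG) as HS.
  pose proof (basis_in_l a b G HB) as Ha. pose proof (basis_in_r a b G HB) as Hb.
  assert (D2 : RtoC 2 <> 0) by (intros E; apply RtoC_inj in E; lra).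
  destruct (index2_facts G H HS HH) as [[z [Hz Nz]] Hdiff].
  pose proof (proj1 HH) as HHs. pose proof (proj1 (proj2 HH)) as Hsub.
  assert (opp : forall x, ~ H x -> ~ H (- x)).
  { intros x Hx Hn. apply Hx. replace x with (- - x) by ring. apply sub_opp; auto. }
  assert (dbl : forall u, G u -> H (2 * u)).
  { intros u Hu. destruct (classic (H u)) as [H1|H1].
    - replace (2 * u) with (u + u) by ring. apply sub_plus; auto.
    - replace (2 * u) with (u - - u) by ring. apply Hdiff; auto. apply sub_opp; auto. }
  assert (back : forall w, H w -> forall v, G (v / 2) \/ G ((v - w) / 2) -> H v).
  { intros w Hw v [Hv|Hv].
    - replace v with (2 * (v / 2)) by (field; auto). auto.
    - replace v with (w + 2 * ((v - w) / 2)) by (field; auto). apply sub_plus; auto. }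
  assert (even : forall u, (2 * u) / 2 = u) by (intros; field; auto).
  assert (rest : forall w u, (w + 2 * u - w) / 2 = u) by (intros; field; auto).
  assert (strip : forall w u, G u -> H (w + 2 * u) -> H w).
  { intros w u Hu Hw. replace w with (w + 2 * u - 2 * u) by ring. apply HHs; auto. }
  destruct (classic (H a)) as [Aa|Aa]; [left|right; destruct (classic (H b)) as [Bb|Bb]; [left|right]].
  - assert (Nb : ~ H b).
    { intros Bb. apply Nz. apply HB in Hz as [m [n ->]].
      apply sub_plus; auto; apply sub_int_mult; auto. }
    intros v. split; [|apply back; auto]. intros Hv.
    destruct (half_class a b G v HB (Hsub v Hv)) as [[u [Hu E]]|[[u [Hu E]]|[[u [Hu E]]|[u [Hu E]]]]];
      subst v.
    + left. rewrite even; auto.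
    + right. rewrite rest; auto.
    + exfalso. apply Nb, (strip b u); auto.
    + exfalso. apply Nb. replace b with (b + a - a) by ring. apply HHs; auto. apply (strip _ u); auto.
  - intros v. split; [|apply back; auto]. intros Hv.
    destruct (half_class a b G v HB (Hsub v Hv)) as [[u [Hu E]]|[[u [Hu E]]|[[u [Hu E]]|[u [Hu E]]]]];
      subst v.
    + left. rewrite even; auto.
    + exfalso. apply Aa, (strip a u); auto.
    + right. rewrite rest; auto.
    + exfalso. apply Aa. replace a with (b + a - b) by ring. apply HHs; auto. apply (strip _ u); auto.
  - assert (Hba : H (b + a)).
    { replace (b + a) with (b - - a) by ring. apply Hdiff; auto. apply sub_opp; auto. }
    intros v. split; [|apply back; auto]. intros Hv.
    destruct (half_class a b G v HB (Hsub v Hv)) as [[u [Hu E]]|[[u [Hu E]]|[[u [Hu E]]|[u [Hu E]]]]];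
      subst v.
    + left. rewrite even; auto.
    + exfalso. apply Aa, (strip a u); auto.
    + exfalso. apply Bb, (strip b u); auto.
    + right. rewrite rest; auto.
Qed.

Lemma edge_power (x y z : R) : (0 < x)%R -> (0 < y)%R -> (0 < z)%R ->
  (x ^ 4 * y * z / 16 <= y ^ 4 * x * z / 16 <-> x <= y)%R.
Proof.
  intros Hx Hy Hz. pose proof (Rmult_lt_0_compat _ _ (Rmult_lt_0_compat _ _ Hx Hy) Hz) as P.
  replace (x ^ 4 * y * z / 16)%R with ((x * y * z) * x ^ 3 / 16)%R by field.
  replace (y ^ 4 * x * z / 16)%R with ((x * y * z) * y ^ 3 / 16)%R by field.
  split; intros H.
  - apply Rnot_lt_le; intros Hn.
    assert (y ^ 3 < x ^ 3)%R.
    { replace (y ^ 3)%R with (y ^ 2 * y)%R by ring. replace (x ^ 3)%R with (x ^ 2 * x)%R by ring.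
      apply Rmult_le_0_lt_compat; nra. }
    nra.
  - assert (x ^ 3 <= y ^ 3)%R by (apply pow_incr; lra). nra.
Qed.

Lemma Cmod_minus_sym (x y : C) : Cmod (x - y) = Cmod (y - x).
Proof. rewrite <- Cmod_opp. f_equal. ring. Qed.

Lemma Cmod_Delta_half a b G H : has_basis a b G -> half_class_of G H a ->
  Cmod (Delta H) = (Cmod (Psum G (b / 2) - Psum G ((b + a) / 2)) ^ 4 *
    Cmod (Psum G (a / 2) - Psum G (b / 2)) * Cmod (Psum G (a / 2) - Psum G ((b + a) / 2)) / 16)%R.
Proof.
  intros HB HC. pose proof (basis_slat a b G HB) as HG.
  destruct (half_facts a b G HB) as [_ [E0 [E4 E6]]].
  rewrite (Delta_index2 G H a _ _ _ HG (basis_primitive_l a b G HB) HC eq_refl E0 E4 E6).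
  rewrite Cmod_div by (intros E; apply RtoC_inj in E; lra).
  rewrite !Cmod_mult, Cmod_pow, Cmod_R, Rabs_pos_eq by lra. auto.
Qed.

Lemma optimal_iff a b G H : has_basis a b G -> is_subgroup_of_index 2 G H ->
  half_class_of G H a ->
  let d1 := Cmod (Psum G (b / 2) - Psum G ((b + a) / 2)) in
  let d2 := Cmod (Psum G (a / 2) - Psum G ((b + a) / 2)) in
  let d3 := Cmod (Psum G (a / 2) - Psum G (b / 2)) in
  is_optimal G H <-> (d1 <= d2 /\ d1 <= d3)%R.
Proof.
  intros HB HH HC d1 d2 d3. pose proof (basis_slat a b G HB) as HG.
  destruct (half_facts a b G HB) as [[N12 [N13 N23]] _].
  assert (pos : forall x y : C, x <> y -> (0 < Cmod (x - y))%R).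
  { intros x y Hn. apply Cmod_gt_0. intros E. apply Hn, sub_eq_0; auto. }
  assert (P1 : (0 < d1)%R) by (apply pos; auto). assert (P2 : (0 < d2)%R) by (apply pos; auto).
  assert (P3 : (0 < d3)%R) by (apply pos; auto).
  assert (F1 : forall K, half_class_of G K a -> Cmod (Delta K) = (d1 ^ 4 * d2 * d3 / 16)%R).
  { intros K HK. rewrite (Cmod_Delta_half a b G K HB HK). unfold d1, d2, d3. field. }
  assert (F2 : forall K, half_class_of G K b -> Cmod (Delta K) = (d2 ^ 4 * d1 * d3 / 16)%R).
  { intros K HK. rewrite (Cmod_Delta_half b a G K (basis_swap _ _ _ HB) HK).
    rewrite (Cplus_comm a b), (Cmod_minus_sym (Psum G (b / 2)) (Psum G (a / 2))).
    unfold d1, d2, d3. field. }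
  assert (F3 : forall K, half_class_of G K (b + a) -> Cmod (Delta K) = (d3 ^ 4 * d1 * d2 / 16)%R).
  { intros K HK.
    rewrite (Cmod_Delta_half (b + a) a G K (basis_swap _ _ _ (basis_plus _ _ _ HB)) HK).
    (* For the basis [(b + a, a)] the third half period is half of [b + 2 a], which is congruent to
       [b / 2] modulo [G]. *)
    replace (a + (b + a)) with (b + 2 * a) by ring.
    rewrite P_class by (auto; apply (basis_in_l a b); auto).
    rewrite (Cmod_minus_sym (Psum G ((b + a) / 2)) (Psum G (a / 2))),
      (Cmod_minus_sym (Psum G ((b + a) / 2)) (Psum G (b / 2))).
    unfold d1, d2, d3. field. }
  split.
  - intros [_ Hopt]. split.
    + pose proof (Hopt _ (half_class_subgroup b a G (basis_swap _ _ _ HB))) as L.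
      rewrite (F1 H HC) in L. rewrite F2 in L by (intros v; tauto).
      apply (edge_power d1 d2 d3); auto.
    + pose proof (Hopt _ (half_class_subgroup (b + a) a G
        (basis_swap _ _ _ (basis_plus _ _ _ HB)))) as L.
      rewrite (F1 H HC) in L. rewrite F3 in L by (intros v; tauto).
      apply (edge_power d1 d3 d2); auto. lra.
  - intros [L2 L3]. split; auto. intros K HK. rewrite (F1 H HC).
    destruct (index2_cases a b G K HB HK) as [C|[C|C]].
    + rewrite (F1 K C). lra.
    + rewrite (F2 K C). apply edge_power; auto.
    + rewrite (F3 K C).
      replace (d1 ^ 4 * d2 * d3 / 16)%R with (d1 ^ 4 * d3 * d2 / 16)%R by field.
      apply edge_power; auto.
Qed.

Lemma index2_basis G H : is_lattice G -> is_subgroup_of_index 2 G H ->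
  exists a b, has_basis a b G /\ half_class_of G H a.
Proof.
  intros HL HH. destruct (shortest_exists G HL) as [a Ha].
  destruct (shortest_basis G a HL Ha) as [b HB].
  destruct (index2_cases a b G H HB HH) as [C|[C|C]].
  - exists a, b; auto.
  - exists b, a. split; auto. apply basis_swap; auto.
  - exists (b + a), a. split; auto. apply basis_swap, basis_plus; auto.
Qed.

(** * Optimality in terms of the roots and of the shortest vectors *)

Lemma optimal_iff_edges Gamma Gamma' omega e1 e2 e3 :
  is_lattice Gamma -> is_subgroup_of_index 2 Gamma Gamma' -> Gamma' omega ->
  ~ (exists v, Gamma v /\ omega = 2 * v) ->
  (forall x : C, 4 * x ^ 3 - g2 Gamma * x - g3 Gamma = 0 <-> x = e1 \/ x = e2 \/ x = e3) ->
  e1 = wp (omega / 2) Gamma ->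
  (is_optimal Gamma Gamma' <->
   (Cmod (e2 - e3) <= Rmin (Cmod (e1 - e2)) (Cmod (e1 - e3)))%R).
Proof.
  intros HL HI Hw Hnd Hroots He1.
  destruct (index2_basis Gamma Gamma' HL HI) as [a [b [HB HC]]].
  pose proof (basis_slat a b Gamma HB) as HG.
  assert (D2 : RtoC 2 <> 0) by (intros E; apply RtoC_inj in E; lra).
  destruct (half_facts a b Gamma HB) as [[N12 [N13 N23]] [E0 [E4 E6]]].
  rewrite (optimal_iff a b Gamma Gamma' HB HI HC).
  set (f1 := Psum Gamma (a / 2)) in *. set (f2 := Psum Gamma (b / 2)) in *.
  set (f3 := Psum Gamma ((b + a) / 2)) in *.
  (* [omega] lies in [Gamma'] but not in [2 Gamma], hence in [a + 2 Gamma]. *)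
  assert (Ef : e1 = f1).
  { rewrite He1, wp_eq by auto. apply HC in Hw as [H|H].
    - exfalso. apply Hnd. exists (omega / 2). split; auto. field; auto.
    - unfold f1. rewrite <- (P_class Gamma a ((omega - a) / 2)) by auto. f_equal. field; auto. }
  assert (root : forall x, x ^ 3 - 15 * Esum Gamma 4 * x - 35 * Esum Gamma 6 = 0 ->
     x = e1 \/ x = e2 \/ x = e3).
  { intros x Hx. apply Hroots.
    rewrite (g2_eq _ _ (E_has_sum Gamma 4 HG ltac:(lia))),
      (g3_eq _ _ (E_has_sum Gamma 6 HG ltac:(lia))).
    transitivity (4 * (x ^ 3 - 15 * Esum Gamma 4 * x - 35 * Esum Gamma 6)); [ring|].
    rewrite Hx. ring. }
  pose proof (root f2 (half_cubic Gamma b HG (basis_primitive_r a b Gamma HB))) as R2.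
  pose proof (root f3 (half_cubic Gamma (b + a) HG
    (basis_primitive_r a (b + a) Gamma (basis_plus _ _ _ HB)))) as R3.
  rewrite Ef in *.
  (* [f2] and [f3] are two distinct roots other than [e1], so they are [e2] and [e3] in some order;
     the condition is symmetric in these. *)
  assert (cases : (f2 = e2 /\ f3 = e3) \/ (f2 = e3 /\ f3 = e2)).
  { destruct R2 as [R2|[R2|R2]]; [exfalso; auto| |];
    destruct R3 as [R3|[R3|R3]]; try (exfalso; congruence); auto. }
  destruct cases as [[<- <-]|[<- <-]].
  - split; intros H; [apply Rmin_glb; apply H|].
    pose proof (Rmin_l (Cmod (f1 - f2)) (Cmod (f1 - f3))).
    pose proof (Rmin_r (Cmod (f1 - f2)) (Cmod (f1 - f3))). lra.
  - rewrite (Cmod_minus_sym f3 f2).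
    split; intros H; [apply Rmin_glb; apply H|].
    pose proof (Rmin_l (Cmod (f1 - f3)) (Cmod (f1 - f2))).
    pose proof (Rmin_r (Cmod (f1 - f3)) (Cmod (f1 - f2))). lra.
Qed.

Lemma Glb_shortest G a : shortest G a ->
  Glb_Rbar (fun r => exists w, (G w /\ w <> 0) /\ r = Cmod w) = Finite (Cmod a).
Proof.
  intros [Ha [Ha0 Hm]]. apply is_glb_Rbar_unique. split.
  - intros r [w [[Hw Hw0] ->]]. simpl. auto.
  - intros l Hl. apply Hl. exists a; auto.
Qed.

Lemma shortest_optimal G H w : is_lattice G -> is_subgroup_of_index 2 G H ->
  shortest G w -> H w -> is_optimal G H.
Proof.
  intros HL HI Hsh Hw. destruct (shortest_basis G w HL Hsh) as [b HB].
  pose proof (basis_slat w b G HB) as HG.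
  assert (D2 : RtoC 2 <> 0) by (intros E; apply RtoC_inj in E; lra).
  assert (Gw : G w) by apply Hsh.
  assert (HC : half_class_of G H w).
  { destruct (index2_basis G H HL HI) as [a [c [_ HC]]].
    apply HC in Hw as [Hw|Hw].
    - exfalso. apply (shortest_not_double G w (w / 2)); auto. field; auto.
    - intros v. rewrite (HC v).
      split; intros [Hv|Hv]; auto; right.
      + replace ((v - w) / 2) with ((v - a) / 2 - (w - a) / 2) by (field; auto).
        apply HG; auto.
      + replace ((v - a) / 2) with ((v - w) / 2 + (w - a) / 2) by (field; auto).
        apply sub_plus; auto. apply HG. }
  apply (optimal_iff w b G H HB HI HC). split.
  - apply opposite_edges; auto.
  (* The second inequality is the first one for the basis [(w, b + w)], which exchanges the two half
     periods other than [w / 2]. *)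
  - pose proof (opposite_edges w (b + w) G (basis_plus _ _ _ HB) Hsh) as P.
    replace (b + w + w) with (b + 2 * w) in P by ring.
    rewrite P_class in P by auto. rewrite Cmod_minus_sym. exact P.
Qed.

(** Optimality of the subgroup of [b] gives the inequality opposite to [opposite_edges], so both
    edges are equal and [equality_case] yields a shortest vector in [b + 2 G]. *)
Lemma optimal_second_class a b G H : has_basis a b G -> shortest G a ->
  is_subgroup_of_index 2 G H -> half_class_of G H b -> is_optimal G H ->
  exists v, shortest G v /\ H v.
Proof.
  intros HB Ha HI HC Hopt. pose proof (basis_slat a b G HB) as HG.
  pose proof (proj1 (optimal_iff b a G H (basis_swap _ _ _ HB) HI HC) Hopt) as [L _].
  rewrite (Cplus_comm a b) in L.
  pose proof (opposite_edges a b G HB Ha) as L'.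
  destruct (equality_case a b G HB Ha) as [v [u [Hv [Hu ->]]]]; [lra|].
  exists (b + 2 * u). split; auto. apply HC. right.
  replace ((b + 2 * u - b) / 2) with u by (field; intros E; apply RtoC_inj in E; lra). auto.
Qed.

Lemma optimal_shortest G H : is_lattice G -> is_subgroup_of_index 2 G H ->
  is_optimal G H -> exists v, shortest G v /\ H v.
Proof.
  intros HL HI Hopt. destruct (shortest_exists G HL) as [a Ha].
  destruct (shortest_basis G a HL Ha) as [b HB].
  destruct (index2_cases a b G H HB HI) as [HC|[HC|HC]].
  - exists a. split; auto. apply HC. right. replace ((a - a) / 2) with (RtoC 0).
    + apply (proj1 (basis_slat a b G HB)).
    + field.
  - apply (optimal_second_class a b); auto.
  - apply (optimal_second_class a (b + a)); auto. apply basis_plus; auto.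
Qed.

Theorem proposition3p13 :
  forall Gamma Gamma' : C -> Prop,
    is_lattice Gamma ->
    is_subgroup_of_index 2 Gamma Gamma' ->
    (forall omega e1 e2 e3 : C,
       Gamma' omega ->
       ~ (exists v, Gamma v /\ omega = 2 * v) ->
       (forall x : C,
          4 * x ^ 3 - g2 Gamma * x - g3 Gamma = 0 <->
          x = e1 \/ x = e2 \/ x = e3) ->
       e1 = wp (omega / 2) Gamma ->
       (is_optimal Gamma Gamma' <->
        (Cmod (e2 - e3) <= Rmin (Cmod (e1 - e2)) (Cmod (e1 - e3)))%R))
    /\
    (is_optimal Gamma Gamma' <->
     exists omega : C,
       Gamma omega /\ Gamma' omega /\
       Finite (Cmod omega) =
       Glb_Rbar (fun r => exists w, (Gamma w /\ w <> 0) /\ r = Cmod w)).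
Proof.
  intros Gamma Gamma' HL HI. split.
  - intros omega e1 e2 e3. apply optimal_iff_edges; auto.
  - split.
    + intros Hopt. destruct (optimal_shortest Gamma Gamma' HL HI Hopt) as [v [Hv Hv']].
      exists v. split; [apply Hv|]. split; auto. rewrite (Glb_shortest Gamma v Hv). auto.
    + intros [omega [Hw [Hw' E]]]. destruct (shortest_exists Gamma HL) as [a Ha].
      rewrite (Glb_shortest Gamma a Ha) in E. injection E as E.
      apply (shortest_optimal Gamma Gamma' omega); auto.
      destruct Ha as [_ [Ha0 Hm]]. repeat split; auto.
      * apply Cmod_gt_0. rewrite E. apply Cmod_gt_0; auto.
      * rewrite E; auto.
Qed.
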